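(* Let $F:T_0\times\mathbb{R}^n\to\mathbb{R}$, $(t,x)\mapsto F(t,x)$, be measurable in $t$ for any $x\in\mathbb{R}^n$ and of class $C^1$ in $x$ for any $t\in T_0$. Suppose there exist $a\in C^1(\mathbb{R}^+,\mathbb{R}^+)$ with derivative $a'$ bounded from above and $b\in C(T_0,\mathbb{R}^+)$ such that $$|F(t,x)|\le a(|x|)\,b(t),\qquad |\nabla_xF(t,x)|\le a(|x|)\,b(t)$$ for any $x\in\mathbb{R}^n$ and any $t\in T_0$. Suppose moreover that $$\int_{T_0}F(t,x)\,dt^1\wedge\dots\wedge dt^p\to\infty\quad\text{as }|x|\to\infty,$$ and that $F(t,x)$ is convex in $x$ for any $t\in T_0$. Then there exists a function $u\in H^1_T$, having a weak Laplacian $\Delta u$, that is a solution of the boundary value problem $$\Delta u(t)=\nabla F(t,u(t))\quad\text{a.e. on }T_0,$$ $$u|_{S_i^-}=u|_{S_i^+},\qquad \frac{\partial u}{\partial t}\Big|_{S_i^-}=\frac{\partial u}{\partial t}\Big|_{S_i^+},\qquad i=1,\dots,p.$$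
   Context: $T_0=[0,T^1]\times\dots\times[0,T^p]\subset\mathbb{R}^p$ with $T^1,\dots,T^p>0$, $T=(T^1,\dots,T^p)$, $t=(t^1,\dots,t^p)$, and $dt^1\wedge\dots\wedge dt^p$ is Lebesgue measure. $\mathbb{R}^+=[0,\infty)$ and $|x|=\sqrt{\delta_{ij}x^ix^j}$ is the Euclidean norm on $\mathbb{R}^n$. $\nabla F(t,x)=\nabla_xF(t,x)$ is the gradient with respect to $x$. $C_T^\infty$ is the space of all indefinitely differentiable functions $\mathbb{R}^p\to\mathbb{R}^n$ that are multiple $T$-periodic (periodic in each variable $t^i$ with period $T^i$). Weak derivatives are defined with test functions in $C_T^\infty$: $w_\alpha$ is the weak derivative $\partial u/\partial t^\alpha$ of $u$ if $\int_{T_0}\delta_{ij}u^i\,\frac{\partial v^j}{\partial t^\alpha}\,dt^1\wedge\dots\wedge dt^p=-\int_{T_0}\delta_{ij}w_\alpha^i v^j\,dt^1\wedge\dots\wedge dt^p$ for all $v\in C_T^\infty$. $H_T^1$ (the Sobolev space $W_T^{1,2}$) is the Hilbert space of functions $u\in L^2[T_0,\mathbb{R}^n]$ having weak derivatives $\frac{\partial u}{\partial t}\in L^2$ in this sense, with scalar product $\langle u,v\rangle=\int_{T_0}\left(\delta_{ij}u^iv^j+\delta_{ij}\delta^{\alpha\beta}\frac{\partial u^i}{\partial t^\alpha}\frac{\partial v^j}{\partial t^\beta}\right)dt^1\wedge\dots\wedge dt^p$ (summation over repeated indices). A function $u\in H^1_T$ has weak Laplacian $\Delta u$ (an integrable $\mathbb{R}^n$-valued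 function on $T_0$) if $\int_{T_0}\delta^{\alpha\beta}\delta_{ij}\frac{\partial u^i}{\partial t^\alpha}\frac{\partial v^j}{\partial t^\beta}\,dt^1\wedge\dots\wedge dt^p=-\int_{T_0}\delta_{ij}(\Delta u)^iv^j\,dt^1\wedge\dots\wedge dt^p$ for all $v\in C^\infty_T$. $S_i^-$ and $S_i^+$ are the opposite faces of $T_0$ given by $t^i=0$ and $t^i=T^i$, identified by translation; boundary values are understood in the sense of traces. *)

(* Defs.v *)
From HB Require Import structures.
From mathcomp Require Import all_boot all_order all_algebra.
From mathcomp Require Import all_classical all_reals all_analysis.
From mathcomp Require Import measurable_realfun.

Set Implicit Arguments.
Unset Strict Implicit.
Unset Printing Implicit Defensive.

Import Order.TTheory GRing.Theory Num.Theory.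
Import numFieldNormedType.Exports.

Local Open Scope classical_set_scope.
Local Open Scope ring_scope.

(* The sigma-algebra on 'rV[R]_n is generated by the coordinate projections, *)
(* as the library does for n.-tuple: it is the Borel sigma-algebra of R^n.   *)
Definition rV_display : measure_display.
Proof. exact: default_measure_display. Qed.

Section measurable_rV.
Variables (R : realType) (n : nat).

Let coord : 'I_n -> 'rV[R]_n -> R := fun i x => x 0 i.

Let rV_set0 : g_sigma_preimage coord set0.
Proof. exact: sigma_algebra0. Qed.

Let rV_setC A : g_sigma_preimage coord A -> g_sigma_preimage coord (~` A).
Proof. exact: sigma_algebraC. Qed.

Let rV_bigcup (F : (set 'rV[R]_n)^nat) :
  (forall i, g_sigma_preimage coord (F i)) ->
  g_sigma_preimage coord (\bigcup_i (F i)).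
Proof. exact: sigma_algebra_bigcup. Qed.

HB.instance Definition _ := @isMeasurable.Build rV_display
  'rV[R]_n (g_sigma_preimage coord) rV_set0 rV_setC rV_bigcup.

Lemma measurable_coord (i : 'I_n) :
  measurable_fun [set: 'rV[R]_n] (fun x : 'rV[R]_n => x 0 i).
Proof.
move=> _ Y mY; rewrite setTI; apply: sub_sigma_algebra => /=.
rewrite -bigcup_seq/=; exists i => /=; first by rewrite mem_index_enum.
by exists Y => //; rewrite setTI.
Qed.

Lemma measurable_fun_rVP d (S : measurableType d) (f : S -> 'rV[R]_n) :
  (forall i, measurable_fun [set: S] (fun s => f s 0 i)) ->
  measurable_fun [set: S] f.
Proof.
move=> mf; apply: (@measurability _ _ _ _ _ _
  (\big[setU/set0]_(i < n) preimage_set_system setT (coord i) measurable)) => //.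
move=> _ [B] + <-; rewrite -bigcup_seq/= => -[i _ [Y mY <-]].
by rewrite !setTI; have := mf i measurableT Y mY; rewrite setTI.
Qed.

End measurable_rV.

Section insert_coord.
Variables (R : realType) (p : nat).

(* (y^1, ..., y^(i-1), c, y^i, ..., y^(p-1)) *)
Definition insert_coord (i : 'I_p) (c : R) (y : 'rV[R]_p.-1) : 'rV[R]_p :=
  \row_j oapp (y 0) c (unlift i j).

Lemma measurable_insert_coord (i : 'I_p) :
  measurable_fun [set: (measurableTypeR R * 'rV[R]_p.-1)%type]
    (fun z => insert_coord i z.1 z.2).
Proof.
apply: measurable_fun_rVP => j; rewrite /insert_coord.
case E : (unlift i j) => [k|] /=.
  rewrite (_ : (fun _ => _) = (fun x : 'rV[R]_p.-1 => x 0 k) \o snd).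
    by apply: measurableT_comp => //; exact: measurable_coord.
  by apply/funext => z /=; rewrite mxE E.
rewrite (_ : (fun _ => _) = fst); first exact: measurable_fst.
by apply/funext => z /=; rewrite mxE E.
Qed.

End insert_coord.

Section lebesgue_rV.
Variable R : realType.
Local Open Scope ereal_scope.

Section step.
Variables (q : nat) (m : {sigma_finite_measure set 'rV[R]_q -> \bar R}).

Let consf (z : measurableTypeR R * 'rV[R]_q) : 'rV[R]_q.+1 :=
  @insert_coord R q.+1 ord0 z.1 z.2.

Let mconsf : measurable_fun setT consf.
Proof. exact: (@measurable_insert_coord R q.+1 ord0). Qed.

Definition cons_measure : set 'rV[R]_q.+1 -> \bar R :=
  pushforward (lebesgue_measure \x m) consf.

Let cons_measure0 : cons_measure set0 = 0.
Proof. by rewrite /cons_measure /pushforward preimage_set0 measure0. Qed.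

Let cons_measure_ge0 A : 0 <= cons_measure A.
Proof. exact: measure_ge0. Qed.

Let cons_measure_sigma_additive : semi_sigma_additive cons_measure.
Proof.
have mE A : measurable A -> measurable (consf @^-1` A).
  by move=> mA; rewrite -[X in measurable X]setTI; exact: mconsf.
move=> F mF tF mUF; rewrite /cons_measure /pushforward preimage_bigcup.
apply: measure_semi_sigma_additive.
- by move=> k; exact: mE.
- apply/trivIsetP => /= i j _ _ ij; rewrite -preimage_setI.
  by move/trivIsetP : tF => /(_ _ _ _ _ ij) ->//; rewrite preimage_set0.
- by rewrite -preimage_bigcup; exact: mE.
Qed.

HB.instance Definition _ := isMeasure.Build _ _ _ cons_measure
  cons_measure0 cons_measure_ge0 cons_measure_sigma_additive.

Lemma cons_measureE (A : 'I_q.+1 -> set R) :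
  (forall i, measurable (A i)) ->
  cons_measure [set x : 'rV_q.+1 | forall i, A i (x ord0 i)] =
  lebesgue_measure (A ord0) * m [set x : 'rV_q | forall i, A (lift ord0 i) (x ord0 i)].
Proof.
move=> mA.
have mtl : measurable [set x : 'rV[R]_q | forall i, A (lift ord0 i) (x ord0 i)].
  rewrite [X in measurable X](_ : _ = \bigcap_(i in [set: 'I_q])
      (fun x : 'rV[R]_q => x ord0 i) @^-1` A (lift ord0 i)).
    apply: fin_bigcap_measurable => // i _.
    have := @measurable_coord R q i measurableT _ (mA (lift ord0 i)).
    by rewrite setTI.
  by apply/seteqP; split => x /= Ax; [move=> i _; exact: Ax|move=> i; exact: Ax].
rewrite -product_measure1E//; last exact: mA.
rewrite /cons_measure /pushforward.
suff -> : consf @^-1` [set x : 'rV_q.+1 | forall i, A i (x ord0 i)] =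
  A ord0 `*` [set x : 'rV[R]_q | forall i, A (lift ord0 i) (x ord0 i)] by [].
apply/seteqP; split => -[c y] /= H.
- split => [|i]; first by have := H ord0; rewrite mxE unlift_none.
  by have := H (lift ord0 i); rewrite mxE liftK.
- by move: H => [Hc Hy] i; rewrite mxE; case: unliftP => [j ->|->].
Qed.

Let cons_measure_sigma_finite : sigma_finite setT cons_measure.
Proof.
have /sigma_finiteP[F [TF ndF Foo]] := sigma_finiteT (@lebesgue_measure R).
have /sigma_finiteP[G [TG ndG Goo]] := sigma_finiteT m.
pose hd (x : 'rV[R]_q.+1) : R := x ord0 ord0.
pose tl (x : 'rV[R]_q.+1) : 'rV[R]_q := \row_j x ord0 (lift ord0 j).
have mhd : measurable_fun setT hd by exact: measurable_coord.
have mtl : measurable_fun setT tl.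
  apply: measurable_fun_rVP => i; under eq_fun do rewrite mxE.
  exact: measurable_coord.
exists (fun k => hd @^-1` F k `&` tl @^-1` G k).
  apply/seteqP; split => // x _.
  have [k _ Fk] : (\bigcup_i F i) (hd x) by rewrite -TF.
  have [l _ Gl] : (\bigcup_i G i) (tl x) by rewrite -TG.
  exists (maxn k l) => //; split.
  - by have /subsetPset := ndF _ _ (leq_maxl k l); apply.
  - by have /subsetPset := ndG _ _ (leq_maxr k l); apply.
move=> k; have [mF Fk] := Foo k; have [mG Gk] := Goo k; split.
  apply: measurableI.
    by rewrite -[X in measurable X]setTI; exact: mhd.
  by rewrite -[X in measurable X]setTI; exact: mtl.
rewrite /cons_measure /pushforward (_ : _ @^-1` _ = F k `*` G k).
  by rewrite product_measure1E// lte_mul_pinfty// ge0_fin_numE.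
apply/seteqP; split => -[c y]; rewrite /hd /tl /= mxE unlift_none /=.
- by move=> [? Gy]; split => //; move: Gy; congr (G k _);
    apply/rowP => j; rewrite !mxE liftK.
- by move=> [? Gy]; split => //; move: Gy; congr (G k _);
    apply/rowP => j; rewrite !mxE liftK.
Qed.

HB.instance Definition _ := Measure_isSigmaFinite.Build _ _ _ cons_measure
  cons_measure_sigma_finite.

End step.

Lemma dirac_sigma_finite :
  sigma_finite setT (\d_(0%R : 'rV[R]_0) : set 'rV[R]_0 -> \bar R).
Proof. by apply: fin_num_fun_sigma_finite => //; rewrite measure0. Qed.

Fixpoint lebesgue_rV (p : nat) : {sigma_finite_measure set 'rV[R]_p -> \bar R} :=
  match p with
  | 0 => [the {sigma_finite_measure set 'rV[R]_0 -> \bar R} of \d_(0%R : 'rV[R]_0)]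
  | q.+1 => [the {sigma_finite_measure set 'rV[R]_q.+1 -> \bar R} of
              cons_measure (lebesgue_rV q)]
  end.

Lemma lebesgue_rV_prod p (A : 'I_p -> set R) :
  (forall i, measurable (A i)) ->
  lebesgue_rV p [set x : 'rV_p | forall i, A i (x ord0 i)] =
  \prod_(i < p) lebesgue_measure (A i).
Proof.
elim: p A => [|q IH] A mA.
  by rewrite big_ord0 /= diracE mem_set// => -[].
rewrite big_ord_recl /= cons_measureE//; congr (_ * _).
exact: (IH (fun i => A (lift ord0 i))).
Qed.

End lebesgue_rV.

Arguments lebesgue_rV {R p}.

Section euclidean.
Variable R : realType.

Definition dotv n (x y : 'rV[R]_n) : R := \sum_i x 0 i * y 0 i.

(* The library's norm `|x| on row vectors is the sup norm. *)
Definition enorm n (x : 'rV[R]_n) : R := Num.sqrt (dotv x x).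

Definition basis_vec n (i : 'I_n) : 'rV[R]_n := delta_mx 0 i.

Definition grad n (f : 'rV[R]_n -> R) (x : 'rV[R]_n) : 'rV[R]_n :=
  \row_i 'D_(basis_vec i) f x.

Definition class_C1 n (f : 'rV[R]_n -> R) : Prop :=
  (forall x, differentiable f x) /\ continuous (grad f).

Definition iter_partial p n (s : seq 'I_p) (v : 'rV[R]_p -> 'rV[R]_n) :
    'rV[R]_p -> 'rV[R]_n :=
  foldr (fun i w t => 'D_(basis_vec i) w t) v s.

Definition smooth p n (v : 'rV[R]_p -> 'rV[R]_n) : Prop :=
  forall (s : seq 'I_p) (t : 'rV[R]_p), differentiable (iter_partial s v) t.

(* a is of class C^1 on [0, +oo[ with derivative da, the derivative at 0 being *)
(* one-sided; the values of a and da on ]-oo, 0[ are irrelevant.               *)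
Definition C1_Rplus (a da : R -> R) : Prop :=
  (forall s : R, 0 <= s ->
    (a r - a s) / (r - s) @[r --> within [set r | 0 <= r] s^'] --> da s) /\
  {within `[0, +oo[, continuous da}.

End euclidean.

Section sobolev.
Variable R : realType.
Local Notation mu := lebesgue_rV.

Definition box p (T : 'rV[R]_p) : set 'rV[R]_p :=
  [set t | forall i, 0 <= t 0 i <= T 0 i].

(* Measurability with respect to the completed (Lebesgue) sigma-algebra. Such  *)
(* an f agrees almost everywhere with a Borel function, and the integral, being *)
(* defined from suprema of integrals of simple functions, is the same for both. *)
Definition Lebesgue_measurable_on p (D : set 'rV[R]_p) (f : 'rV[R]_p -> R) :
    Prop :=
  forall Y : set R, measurable Y -> completed_algebra_gen mu (D `&` f @^-1` Y).

(* Elements of L^2 and L^1 are given by Borel representatives, functions on   *)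
(* the whole of R^p of which only the restriction to D matters.               *)
Definition L2 p n (D : set 'rV[R]_p) (u : 'rV[R]_p -> 'rV[R]_n) : Prop :=
  measurable_fun D u /\
  (\int[mu]_(t in D) (enorm (u t) ^+ 2)%:E < +oo)%E.

Definition L1 p n (D : set 'rV[R]_p) (u : 'rV[R]_p -> 'rV[R]_n) : Prop :=
  forall i, mu.-integrable D (fun t => (u t 0 i)%:E).

Definition L2_cvg p n (D : set 'rV[R]_p) (u : nat -> 'rV[R]_p -> 'rV[R]_n)
    (w : 'rV[R]_p -> 'rV[R]_n) : Prop :=
  (\int[mu]_(t in D) (enorm (u k t - w t) ^+ 2)%:E)%E @[k --> \oo] --> 0%E.

Definition CT_infty p n (T : 'rV[R]_p) (v : 'rV[R]_p -> 'rV[R]_n) : Prop :=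
  smooth v /\ forall i t, v (t + T 0 i *: basis_vec R i) = v t.

Definition weak_partial p n (T : 'rV[R]_p) (i : 'I_p)
    (u w : 'rV[R]_p -> 'rV[R]_n) : Prop :=
  forall v, CT_infty T v ->
    \int[mu]_(t in box T) dotv (u t) ('D_(basis_vec R i) v t) =
    - \int[mu]_(t in box T) dotv (w t) (v t).

(* u belongs to H^1_T and du i is its weak derivative in the variable t^i. *)
Definition H1T p n (T : 'rV[R]_p) (u : 'rV[R]_p -> 'rV[R]_n)
    (du : 'I_p -> 'rV[R]_p -> 'rV[R]_n) : Prop :=
  L2 (box T) u /\ forall i, L2 (box T) (du i) /\ weak_partial T i u (du i).

(* L is the weak Laplacian of the function with weak partial derivatives du. *)
Definition weak_laplacian p n (T : 'rV[R]_p)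
    (du : 'I_p -> 'rV[R]_p -> 'rV[R]_n) (L : 'rV[R]_p -> 'rV[R]_n) : Prop :=
  L1 (box T) L /\
  forall v, CT_infty T v ->
    \int[mu]_(t in box T) (\sum_i dotv (du i t) ('D_(basis_vec R i) v t)) =
    - \int[mu]_(t in box T) dotv (L t) (v t).

(* The faces t^i = 0 and t^i = T^i are both parametrized, via insert_coord i 0 *)
(* and insert_coord i (T 0 i), by the (p-1)-dimensional box of the other       *)
(* coordinates; this is the identification of the two by translation.          *)
Definition face_box p (T : 'rV[R]_p) (i : 'I_p) : set 'rV[R]_p.-1 :=
  box (col' i T).

(* g is the trace on the face t^i = c of w in W^{1,2} of the interior of the   *)
(* box. The trace operator is the continuous extension to W^{1,2}, into L^2 of *)
(* the face, of the restriction of functions smooth up to the boundary: the    *)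
(* phi k tend to w in W^{1,2} (dw being the limit of their gradients, i.e. the *)
(* weak gradient of w on the interior) and their restrictions tend to g.       *)
Definition is_trace p n (T : 'rV[R]_p) (i : 'I_p) (c : R)
    (w : 'rV[R]_p -> 'rV[R]_n) (g : 'rV[R]_p.-1 -> 'rV[R]_n) : Prop :=
  [/\ L2 (box T) w, L2 (face_box T i) g &
    exists (dw : 'I_p -> 'rV[R]_p -> 'rV[R]_n)
           (phi : nat -> 'rV[R]_p -> 'rV[R]_n),
      [/\ forall j, L2 (box T) (dw j),
          forall k, smooth (phi k),
          L2_cvg (box T) phi w,
          forall j, L2_cvg (box T)
            (fun k t => 'D_(basis_vec R j) (phi k) t) (dw j) &
          L2_cvg (face_box T i) (fun k y => phi k (insert_coord i c y)) g]].

Definition same_trace p n (T : 'rV[R]_p) (i : 'I_p)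
    (w : 'rV[R]_p -> 'rV[R]_n) : Prop :=
  exists g, is_trace T i 0 w g /\ is_trace T i (T 0 i) w g.

End sobolev.

(* Main.v *)
(* The solution minimizes the action A(u) = int |grad u|^2 / 2 + F(t, u) over     *)
(* trigonometric polynomials. By convexity and the parallelogram identity the     *)
(* gradients of a minimizing sequence are Cauchy in L^2; the spectral gap         *)
(* controls the oscillating parts, and convexity with coercivity of the           *)
(* integrated potential bounds the means. Differentiating A at the limit u gives  *)
(* the weak Euler-Lagrange equation, with grad F(t, u) in L^2 because a' bounded  *)
(* above makes grad F grow at most linearly. Projecting (u, Delta u, grad u) onto *)
(* the closure of the graph s |-> (s, Delta s, grad s) and using completeness of  *)
(* the trigonometric system yields trigonometric polynomials converging to u in   *)
(* H^2. Being periodic they take equal values on opposite faces, and a            *)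
(* one-dimensional trace inequality passes this to u and to its derivatives.      *)
Require Import Defs.
From HB Require Import structures.
From mathcomp Require Import all_boot all_order all_algebra.
From mathcomp Require Import all_classical all_reals all_analysis.
From mathcomp Require Import measurable_realfun.
From mathcomp Require Import ring lra.

Set Implicit Arguments.
Unset Strict Implicit.
Unset Printing Implicit Defensive.

Import Order.TTheory GRing.Theory Num.Theory.
Import numFieldNormedType.Exports.

Local Open Scope classical_set_scope.
Local Open Scope ring_scope.

(** * Square-integrable functions *)

(** The equation is the Euler-Lagrange equation of the action A(u) = int |grad u|^2 / 2 + int F(t,
    u), and convexity takes the place of weak compactness. All competitors are trigonometric
    polynomials, which are periodic and explicit; other functions of L^2 enter only as limits.

    Since a' is bounded above, F and its gradient grow at most linearly in x, and F can be replaced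
    off a null set by a Borel integrand G ([borel_version]). Half of the mean of u is the midpoint
    of u and of minus its oscillating part, so convexity and the spectral gap give [action_lbound],
    and coercivity then bounds the means along a minimizing sequence ([near_minimizers]). By
    [action_midpoint] the gradients of such a sequence are Cauchy; with [spectral_gap], completeness
    of L^2 and a subsequence for the means, the sequence converges strongly in L^2 with its
    gradients ([minimizing_limit]). Perturbing the limit u by h V and letting h tend to 0 gives
    Delta u = grad G(t, u), tested on trigonometric polynomials ([weak_solution]), with right-hand
    side in L^2.

    The traces of the derivatives call for convergence in H^2, which the minimizing sequence does
    not provide. The triple (u, Delta u, grad u) is therefore projected onto the closure of the
    triples coming from trigonometric polynomials. The residual obeys the same weak relations, so
    each Fourier coefficient c of its first component satisfies (1 + l + l^2) c = 0 with l >= 0, and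
    [trig_complete] makes it vanish. Thus [second_order_approx] yields polynomials converging to u
    together with gradients and Laplacians. Integration by parts against smooth periodic test
    functions passes to the limit; [ip_hessian_le] bounds all second derivatives by the Laplacian,
    and [trace_le] makes the restrictions to a face converge, for u and for its first derivatives.
    Periodicity of the approximants identifies the traces on opposite faces ([same_trace_rowf],
    [same_trace_partial]). *)

Lemma sqr_sum_le (R : realFieldType) (I : finType) (a : I -> R) :
  (\sum_i a i) ^+ 2 <= #|I|%:R * \sum_i a i * a i.
Proof.
have : 0 <= \sum_i \sum_j (a i - a j) ^+ 2.
  by apply: sumr_ge0 => i _; apply: sumr_ge0 => j _; exact: sqr_ge0.
have -> : \sum_i \sum_j (a i - a j) ^+ 2 =
    \sum_i (#|I|%:R * (a i * a i) + \sum_j a j * a j - 2 * (a i * \sum_j a j)).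
  apply: eq_bigr => i _; rewrite mulr_natl -sumr_const mulrA mulr_sumr.
  by rewrite -big_split/= -sumrB; apply: eq_bigr => j _; ring.
rewrite sumrB big_split/= -!mulr_sumr -mulr_suml sumr_const -mulr_natl.
by rewrite expr2; lra.
Qed.

Section square_integrable.
Context d (X : measurableType d) (R : realType).
Variables (mu : {measure set X -> \bar R}) (D : set X).
Hypotheses (mD : measurable D) (muD : (mu D < +oo)%E).
Implicit Types f g h : X -> R.

Definition itg f := mu.-integrable D (EFin \o f).

Lemma itg_le f g : measurable_fun D f -> (forall x, D x -> `|f x| <= g x) ->
  itg g -> itg f.
Proof.
move=> mf fg; apply: le_integrable => //; first exact/measurable_EFinP.
by move=> x Dx /=; rewrite lee_fin (le_trans (fg _ Dx))// ler_norm.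
Qed.

Lemma itgD f g : itg f -> itg g -> itg (fun x => f x + g x).
Proof. by move=> itf ig; have := integrableD mD itf ig. Qed.

Lemma itgZ a f : itg f -> itg (fun x => a * f x).
Proof. by move=> itf; have := integrableZl mD a itf. Qed.

Lemma itgB f g : itg f -> itg g -> itg (fun x => f x - g x).
Proof. by move=> itf ig; have := integrableB mD itf ig. Qed.

Lemma itg_norm f : itg f -> itg (fun x => `|f x|).
Proof. by move=> itf; have := integrable_norm itf. Qed.

Lemma itg_cst a : itg (fun=> a).
Proof.
apply: measurable_bounded_integrable => //.
by exists `|a|; split; [exact: num_real|move=> M aM x _ /=; exact: ltW].
Qed.

Lemma itg_sum (I : Type) (s : seq I) (F : I -> X -> R) :
  (forall i, itg (F i)) -> itg (fun x => \sum_(i <- s) F i x).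
Proof.
move=> iF; elim: s => [|i s IH].
  by under eq_fun do rewrite big_nil; exact: itg_cst.
under eq_fun do rewrite big_cons; exact: itgD.
Qed.

Lemma Rint_sum (I : Type) (s : seq I) (F : I -> X -> R) :
  (forall i, itg (F i)) -> \int[mu]_(x in D) (\sum_(i <- s) F i x) =
    \sum_(i <- s) \int[mu]_(x in D) F i x.
Proof.
move=> iF; elim: s => [|i s IH].
  under eq_Rintegral do rewrite big_nil.
  by rewrite big_nil Rintegral_cst// mul0r.
under eq_Rintegral do rewrite big_cons.
rewrite RintegralD//; [by rewrite big_cons IH|exact: iF|exact: itg_sum].
Qed.

Lemma itg_bounded f (M : R) : measurable_fun D f ->
  (forall x, D x -> `|f x| <= M) -> itg f.
Proof. by move=> mf fM; apply: (itg_le mf fM); exact: itg_cst. Qed.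

Lemma le_Rint f g : itg f -> itg g -> (forall x, D x -> f x <= g x) ->
  \int[mu]_(x in D) f x <= \int[mu]_(x in D) g x.
Proof. by move=> *; apply: le_Rintegral. Qed.

(** Elements of the scalar L^2(D) are plain functions, with no quotient by equality almost
    everywhere. As D has finite measure, they include the constants and are integrable. *)
Definition sqi f := measurable_fun D f /\ itg (fun x => f x ^+ 2).

Lemma sqi_meas f : sqi f -> measurable_fun D f. Proof. by case. Qed.

Lemma sqi_mul f g : sqi f -> sqi g -> itg (fun x => f x * g x).
Proof.
move=> [mf if2] [mg ig2]; apply: (itg_le _ _ (itgD if2 ig2)).
  exact: measurable_funM.
move=> x _; rewrite ler_norml; apply/andP; split.
  have := sqr_ge0 (f x + g x); have := sqr_ge0 (f x); have := sqr_ge0 (g x).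
  by rewrite sqrrD; nra.
have := sqr_ge0 (f x - g x); have := sqr_ge0 (f x); have := sqr_ge0 (g x).
by rewrite sqrrB; nra.
Qed.

Lemma sqi_cst a : sqi (fun=> a).
Proof. by split; [exact: measurable_cst|exact: itg_cst]. Qed.

Lemma sqi_itg f : sqi f -> itg f.
Proof.
by move=> sf; have := sqi_mul sf (sqi_cst 1); under eq_fun do rewrite mulr1.
Qed.

Lemma sqiD f g : sqi f -> sqi g -> sqi (fun x => f x + g x).
Proof.
move=> sf sg; split; first by apply: measurable_funD; apply: sqi_meas.
have fg := sqi_mul sf sg.
under eq_fun do rewrite sqrrD -mulr_natl.
by apply: itgD; [apply: itgD; [case: sf|exact: itgZ]|case: sg].
Qed.

Lemma sqiZ a f : sqi f -> sqi (fun x => a * f x).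
Proof.
move=> [mf if2]; split; first exact: measurable_funM.
by under eq_fun do rewrite exprMn; exact: itgZ.
Qed.

Lemma sqiN f : sqi f -> sqi (fun x => - f x).
Proof. by move=> /(sqiZ (-1)); under eq_fun do rewrite mulN1r. Qed.

Lemma sqiB f g : sqi f -> sqi g -> sqi (fun x => f x - g x).
Proof. by move=> sf sg; apply: sqiD => //; exact: sqiN. Qed.

Lemma sqi_bounded f (M : R) : measurable_fun D f ->
  (forall x, D x -> `|f x| <= M) -> sqi f.
Proof.
move=> mf fM; split => //; apply: (@itg_bounded _ (M ^+ 2)).
  exact: measurable_funX.
by move=> x Dx; rewrite normrX lerXn2r// ?nnegrE ?fM// (le_trans _ (fM x Dx)).
Qed.

Lemma sqi_norm f : sqi f -> sqi (fun x => `|f x|).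
Proof.
move=> [mf if2]; split; first exact: measurableT_comp.
by under eq_fun do rewrite real_normK ?num_real//.
Qed.

Lemma sqi_sum (I : Type) (s : seq I) (F : I -> X -> R) :
  (forall i, sqi (F i)) -> sqi (fun x => \sum_(i <- s) F i x).
Proof.
move=> iF; elim: s => [|i s IH].
  by under eq_fun do rewrite big_nil; exact: sqi_cst.
by under eq_fun do rewrite big_cons; exact: sqiD.
Qed.

Lemma sqi_le f g : measurable_fun D f -> (forall x, D x -> `|f x| <= g x) ->
  sqi g -> sqi f.
Proof.
move=> mf fg [mg ig]; split => //; apply: (itg_le _ _ ig).
  exact: measurable_funX.
move=> x Dx; rewrite normrX lerXn2r// ?nnegrE ?fg// (le_trans _ (fg x Dx))//.
Qed.

Definition ip f g := \int[mu]_(x in D) (f x * g x).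

Lemma ipC f g : ip f g = ip g f.
Proof. by apply: eq_Rintegral => x _; rewrite mulrC. Qed.

Lemma eq_ip f f' g g' : (forall x, D x -> f x = f' x) ->
  (forall x, D x -> g x = g' x) -> ip f g = ip f' g'.
Proof. by move=> ff' gg'; apply: eq_Rintegral => x /set_mem Dx; rewrite ff' ?gg'. Qed.

Lemma ipDl f g h : sqi f -> sqi g -> sqi h ->
  ip (fun x => f x + g x) h = ip f h + ip g h.
Proof.
move=> sf sg sh; rewrite /ip; under eq_Rintegral do rewrite mulrDl.
by rewrite RintegralD//; exact: sqi_mul.
Qed.

Lemma ipZl a f h : sqi f -> sqi h -> ip (fun x => a * f x) h = a * ip f h.
Proof.
move=> sf sh; rewrite /ip; under eq_Rintegral do rewrite -mulrA.
by rewrite RintegralZl//; exact: sqi_mul.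
Qed.

Lemma ipNl f h : sqi f -> sqi h -> ip (fun x => - f x) h = - ip f h.
Proof.
move=> sf sh; rewrite -mulN1r -ipZl//; congr ip.
by apply/funext => x; rewrite mulN1r.
Qed.

Lemma ipBl f g h : sqi f -> sqi g -> sqi h ->
  ip (fun x => f x - g x) h = ip f h - ip g h.
Proof. by move=> sf sg sh; rewrite ipDl ?ipNl//; exact: sqiN. Qed.

Lemma ipDr f g h : sqi f -> sqi g -> sqi h ->
  ip h (fun x => f x + g x) = ip h f + ip h g.
Proof. by move=> *; rewrite ipC ipDl// !(ipC h). Qed.

Lemma ipZr a f h : sqi f -> sqi h -> ip h (fun x => a * f x) = a * ip h f.
Proof. by move=> *; rewrite ipC ipZl// (ipC h). Qed.

Lemma ipBr f g h : sqi f -> sqi g -> sqi h ->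
  ip h (fun x => f x - g x) = ip h f - ip h g.
Proof. by move=> *; rewrite ipC ipBl// !(ipC h). Qed.

Lemma ip_suml (I : Type) (s : seq I) (F : I -> X -> R) h :
  (forall i, sqi (F i)) -> sqi h ->
  ip (fun x => \sum_(i <- s) F i x) h = \sum_(i <- s) ip (F i) h.
Proof.
move=> sF sh; rewrite /ip -Rint_sum; last by move=> i; exact: sqi_mul.
by apply: eq_Rintegral => x _; rewrite mulr_suml.
Qed.

Lemma ip_sumr (I : Type) (s : seq I) (F : I -> X -> R) h :
  (forall i, sqi (F i)) -> sqi h ->
  ip h (fun x => \sum_(i <- s) F i x) = \sum_(i <- s) ip h (F i).
Proof. by move=> sF sh; rewrite ipC ip_suml//; apply: eq_bigr => i _; rewrite ipC. Qed.

Lemma ip_ge0 f : 0 <= ip f f.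
Proof. by apply: Rintegral_ge0 => x _; rewrite -expr2 sqr_ge0. Qed.

Lemma ip_lin a b f g : sqi f -> sqi g ->
  ip (fun x => a * f x + b * g x) (fun x => a * f x + b * g x) =
  a ^+ 2 * ip f f + 2 * a * b * ip f g + b ^+ 2 * ip g g.
Proof.
move=> sf sg; have sa := sqiZ a sf; have sb := sqiZ b sg.
rewrite ipDl//; last exact: sqiD.
by rewrite !ipZl// ?ipDr// ?ipZr// ?(ipC g f); [ring|exact: sqiD..].
Qed.

Lemma ip_sqD f g : sqi f -> sqi g ->
  ip (fun x => f x + g x) (fun x => f x + g x) = ip f f + 2 * ip f g + ip g g.
Proof.
move=> sf sg; transitivity (ip (fun x => 1 * f x + 1 * g x) (fun x => 1 * f x + 1 * g x)).
  by apply: eq_ip => x _; rewrite !mul1r.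
by rewrite ip_lin//; ring.
Qed.

Lemma ip_sqB f g : sqi f -> sqi g ->
  ip (fun x => f x - g x) (fun x => f x - g x) = ip f f - 2 * ip f g + ip g g.
Proof.
move=> sf sg; transitivity (ip (fun x => 1 * f x + -1 * g x) (fun x => 1 * f x + -1 * g x)).
  by apply: eq_ip => x _; rewrite mul1r mulN1r.
by rewrite ip_lin//; ring.
Qed.

Lemma ip_sqD_le f g : sqi f -> sqi g ->
  ip (fun x => f x + g x) (fun x => f x + g x) <= 2 * ip f f + 2 * ip g g.
Proof.
move=> sf sg; rewrite ip_sqD//.
have := ip_ge0 (fun x => f x - g x); rewrite ip_sqB//; lra.
Qed.

Lemma ip_sqB_le f g : sqi f -> sqi g ->
  ip (fun x => f x - g x) (fun x => f x - g x) <= 2 * ip f f + 2 * ip g g.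
Proof.
move=> sf sg; rewrite ip_sqB//.
have := ip_ge0 (fun x => f x + g x); rewrite ip_sqD//; lra.
Qed.

Lemma quad_discr (a b c : R) : 0 <= c ->
  (forall r, 0 <= a + 2 * r * b + r ^+ 2 * c) -> b ^+ 2 <= a * c.
Proof.
rewrite le_eqVlt => /predU1P[<- H|c0 H].
  rewrite mulr0; have [->|b0] := eqVneq b 0; first by rewrite expr0n.
  (* For c = 0 the expression is affine in r, and this r gives it the value -1. *)
  have := H (- (a + 1) / (2 * b)).
  rewrite mulr0 addr0.
  have -> : a + 2 * (- (a + 1) / (2 * b)) * b = - 1 by field; rewrite b0.
  by rewrite lerNr oppr0 ler10.
(* The vertex of the parabola, where c times the value is a c - b^2. *)
have := H (- b / c); rewrite -(ler_pM2r c0) mul0r.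
rewrite (_ : (a + 2 * (- b / c) * b + (- b / c) ^+ 2 * c) * c = a * c - b ^+ 2).
  by rewrite subr_ge0.
by field; rewrite gt_eqF.
Qed.

Lemma cauchy_schwarz f g : sqi f -> sqi g -> ip f g ^+ 2 <= ip f f * ip g g.
Proof.
move=> sf sg; apply: quad_discr => [|r]; first exact: ip_ge0.
have := ip_ge0 (fun x => 1 * f x + r * g x); rewrite ip_lin// expr1n.
by rewrite mul1r mulr1.
Qed.

Lemma ip_sum_sq (I : finType) (F : I -> X -> R) : (forall i, sqi (F i)) ->
  ip (fun x => \sum_i F i x) (fun x => \sum_i F i x)
    <= #|I|%:R * \sum_i ip (F i) (F i).
Proof.
move=> sF; rewrite /ip -Rint_sum; last by move=> i; exact: sqi_mul.
rewrite -RintegralZl//; last by apply: itg_sum => i; exact: sqi_mul.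
apply: le_Rint; first by apply: sqi_mul; exact: sqi_sum.
  by apply: itgZ; apply: itg_sum => i; exact: sqi_mul.
by move=> x _; rewrite -expr2 sqr_sum_le.
Qed.

Definition l2c (u : nat -> X -> R) f :=
  ip (fun x => u k x - f x) (fun x => u k x - f x) @[k --> \oo] --> 0.

(** Strong convergence implies weak convergence, by Cauchy-Schwarz. Identities proved for
    trigonometric polynomials are passed to L^2 limits in this way. *)
Lemma l2c_ipl u f g : (forall k, sqi (u k)) -> sqi f -> sqi g -> l2c u f ->
  ip (u k) g @[k --> \oo] --> ip f g.
Proof.
move=> su sf sg uf.
have h : (ip (fun x => u k x - f x) (fun x => u k x - f x) * ip g g)
     @[k --> \oo] --> 0.
  by rewrite -(mul0r (ip g g)); apply: cvgM => //; exact: cvg_cst.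
apply/cvgrPdist_lt => e e0; move/cvgrPdist_lt : h => /(_ (e ^+ 2)).
rewrite exprn_gt0// => /(_ isT); apply: filterS => k; rewrite sub0r normrN => hk.
rewrite distrC -ipBl// -(@ltr_pXn2r _ 2)// ?nnegrE// ?(ltW e0)//.
rewrite real_normK ?num_real//.
have skf : sqi (fun x => u k x - f x) by exact: sqiB.
by rewrite (le_lt_trans (cauchy_schwarz skf sg))// (le_lt_trans (ler_norm _)).
Qed.

Lemma l2cD u v f g : (forall k, sqi (u k)) -> sqi f -> (forall k, sqi (v k)) ->
  sqi g -> l2c u f -> l2c v g -> l2c (fun k x => u k x + v k x) (fun x => f x + g x).
Proof.
move=> su sf sv sg uf vg; apply: (@squeeze_cvgr _ _ _ _ (fun=> 0)
  (fun k => 2 * ip (fun x => u k x - f x) (fun x => u k x - f x) +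
     2 * ip (fun x => v k x - g x) (fun x => v k x - g x))).
- near=> k; rewrite ip_ge0/=.
  rewrite (@eq_ip _ (fun x => (u k x - f x) + (v k x - g x)) _
                    (fun x => (u k x - f x) + (v k x - g x)));
    try by move=> x _; ring.
  by apply: ip_sqD_le; exact: sqiB.
- exact: cvg_cst.
- have h w : w @ \oo --> (0 : R) -> 2 * w k @[k --> \oo] --> (0 : R).
    by move=> w0; rewrite -(mulr0 2); apply: cvgM => //; exact: cvg_cst.
  by rewrite -(addr0 0); apply: cvgD; exact: h.
Unshelve. all: by end_near. Qed.

(** Integrates the pointwise Young inequality |f| <= e + f^2 / e. The free parameter e turns an L^2
    estimate into an L^1 estimate of prescribed size. *)
Lemma ip_abs_bound e f : 0 < e -> sqi f ->
  \int[mu]_(x in D) `|f x| <= e * fine (mu D) + e^-1 * ip f f.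
Proof.
move=> e0 sf; have i2 := sqi_mul sf sf.
rewrite -Rintegral_cst// -RintegralZl// -RintegralD//; last 2 first.
  exact: itg_cst.
  exact: itgZ.
apply: le_Rint; first by apply: itg_norm; exact: sqi_itg.
  by apply: itgD; [exact: itg_cst|exact: itgZ].
move=> x _; rewrite -expr2 -real_normK ?num_real//.
rewrite -(ler_pM2l e0) mulrDr mulrA mulfV ?gt_eqF// mul1r.
have := sqr_ge0 (e - `|f x|); have := sqr_ge0 e; have := sqr_ge0 `|f x|; nra.
Qed.

Definition l2cauchy (u : nat -> X -> R) := forall e, 0 < e -> exists N,
  forall k l, (N <= k)%N -> (N <= l)%N ->
    ip (fun x => u k x - u l x) (fun x => u k x - u l x) <= e.

End square_integrable.

(** * Completeness of L^2 *)

Section riesz_fischer.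
Context d (X : measurableType d) (R : realType).
Variables (mu : {measure set X -> \bar R}) (D : set X).
Hypotheses (mD : measurable D) (muD : (mu D < +oo)%E).
Implicit Types f g h : X -> R.

Local Notation sqi := (sqi mu D).
Local Notation ip := (ip mu D).

Lemma Rint_EFin f : itg mu D f ->
  (\int[mu]_(x in D) (f x)%:E)%E = (\int[mu]_(x in D) f x)%:E.
Proof. by move=> itf; rewrite /Rintegral fineK//; exact: integrable_fin_num. Qed.

Lemma limn_einf_le (v : nat -> \bar R) (e : \bar R) K :
  (forall k, (K <= k)%N -> (v k <= e)%E) -> (limn_einf v <= e)%E.
Proof.
move=> ve; rewrite limn_einf_lim; apply: lime_le; first exact: is_cvg_einfs.
near=> n; apply: (@le_trans _ _ (v (maxn n K))); last exact/ve/leq_maxr.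
by apply: ereal_inf_lbound; exists (maxn n K) => //=; exact: leq_maxl.
Unshelve. all: by end_near. Qed.

(* A subsequence whose increments are summable in L^1 converges almost everywhere; *)
(* Fatou's lemma then identifies the pointwise limit as the limit in the mean.     *)
Lemma ae_cvg_of_summable (g : nat -> X -> R) : (forall k, sqi (g k)) ->
  (forall k, \int[mu]_(x in D) `|g k.+1 x - g k x| <= 1 / (2 ^ k.+1)%:R) ->
  {ae mu, forall x, D x -> cvgn (fun k => g k x)}.
Proof.
move=> sg hg.
pose S x := (\sum_(k <oo) (`|g k.+1 x - g k x|)%:E)%E.
have sd k : sqi (fun x => g k.+1 x - g k x) by exact: sqiB.
have mS : measurable_fun D S.
  apply: ge0_emeasurable_sum => [//|k _]; apply/measurable_EFinP.
  by apply: measurableT_comp => //; exact: sqi_meas (sd k).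
have iS : mu.-integrable D S.
  apply/integrableP; split => //.
  under eq_integral do rewrite gee0_abs ?nneseries_ge0//.
  rewrite integral_nneseries//; last first.
    move=> k; apply/measurable_EFinP.
    by apply: measurableT_comp => //; exact: sqi_meas (sd k).
  apply: (@le_lt_trans _ _ (1%:E)); last exact: ltry.
  apply: le_trans (epsilon_trick0 xpredT (@ler01 R)).
  apply: lee_nneseries => [k _ _|k _]; first by apply: integral_ge0.
  by rewrite Rint_EFin ?lee_fin//; apply: itg_norm; exact: sqi_itg.
apply: filterS (integrable_ae mD iS) => x + Dx => /(_ Dx) Sx.
suff : cvgn (series (telescope (fun k => g k x))).
  rewrite telescopeK => cg.
  have : cvgn (fun k => (g k x - g 0 x) + g 0 x).
    by apply: is_cvgD => //; exact: is_cvg_cst.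
  by under eq_fun do rewrite subrK.
apply: normed_cvg; apply: nondecreasing_is_cvgn.
  by apply: nondecreasing_series => i _ _ ; exact: normr_ge0.
exists (fine (S x)) => _ [n _ <-].
rewrite -lee_fin fineK//=; apply: le_trans (nneseries_lim_ge n _) => //.
by rewrite sumEFin.
Qed.

Lemma l2_complete (u : nat -> X -> R) : (forall k, sqi (u k)) ->
  l2cauchy mu D u -> exists2 f, sqi f & l2c mu D u f.
Proof.
move=> su cu.
pose c := fine (mu D) + 1.
have c0 : 0 < c by rewrite ltr_wpDl// fine_ge0.
pose r k : R := 1 / (2 ^ k.+1)%:R.
have r0 k : 0 < r k by rewrite divr_gt0// ltr0n expn_gt0.
(* In [ip_abs_bound] with parameter e k and squared norm at most e k * r k / 2, each of the two
   terms is at most r k / 2. *)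
pose e k := r k / (2 * c).
have e0 k : 0 < e k by rewrite divr_gt0// mulr_gt0.
have eta0 k : 0 < e k * r k / 2 by rewrite divr_gt0// mulr_gt0.
have [N hN] := choice (fun k => cu _ (eta0 k)).
(* Summing makes both n k and n k.+1 at least N k; the summand k makes n k at least k. *)
pose n k := (k + \sum_(i < k.+1) N i)%N.
have nN k : (N k <= n k)%N.
  by rewrite /n big_ord_recr/= addnA leq_addl.
have nS k : (N k <= n k.+1)%N.
  rewrite /n big_ord_recr/= big_ord_recr/= addnA.
  by apply: leq_trans (leq_addr (N k.+1) _); rewrite addnA leq_addl.
pose g k := u (n k).
have sg k : sqi (g k) by exact: su.
have gcv : {ae mu, forall x, D x -> cvgn (fun k => g k x)}.
  apply: ae_cvg_of_summable => // k.
  apply: le_trans (ip_abs_bound mD muD (e0 k) (sqiB mD (sg k.+1) (sg k))) _.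
  have h := hN k _ _ (nS k) (nN k).
  apply: (@le_trans _ _ (e k * c + (e k)^-1 * (e k * r k / 2))).
    apply: lerD; first by rewrite ler_pM2l// /c lerDl.
    by rewrite ler_pM2l ?invr_gt0.
  rewrite -mulrA mulKf ?gt_eqF// /e.
  have -> : r k / (2 * c) * c = r k / 2 by field; rewrite gt_eqF.
  by rewrite -splitr.
(* The upper limit is measurable on all of D and equals the limit wherever the latter exists. *)
pose f x := fine (limn_esup (fun k => (g k x)%:E)).
have mf : measurable_fun D f.
  apply: measurableT_comp => //; apply: measurable_fun_limn_esup => k.
  by apply/measurable_EFinP; exact: sqi_meas (sg k).
have gf : {ae mu, forall x, D x -> g k x @[k --> \oo] --> f x}.
  apply: filterS gcv => x + Dx => /(_ Dx) cg.
  have h : (g k x)%:E @[k --> \oo] --> (limn (g ^~ x))%:E.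
    by apply: cvg_EFin => //; exact: nearW.
  rewrite /f is_cvg_limn_esupE; last by apply/cvg_ex; eexists; exact: h.
  by rewrite (cvg_lim _ h).
(* Fatou's lemma lets the second index of the Cauchy estimate go to infinity along the subsequence.
   The first index m is arbitrary beyond M, so the whole sequence converges and not only the
   subsequence. *)
have key M ee : (forall k l, (M <= k)%N -> (M <= l)%N ->
    ip (fun x => u k x - u l x) (fun x => u k x - u l x) <= ee) ->
  forall m, (M <= m)%N -> sqi (fun x => u m x - f x) /\
    ip (fun x => u m x - f x) (fun x => u m x - f x) <= ee.
  move=> hM m Mm.
  have mum : measurable_fun D (fun x => u m x - f x).
    by apply: measurable_funB => //; exact: sqi_meas (su m).
  have le_ee : (\int[mu]_(x in D) ((u m x - f x) ^+ 2)%:E <= ee%:E)%E.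
    rewrite (_ : (\int[mu]_(x in D) ((u m x - f x) ^+ 2)%:E =
      \int[mu]_(x in D) limn_einf (fun k => ((u m x - g k x) ^+ 2)%:E))%E).
      apply: le_trans (fatou _ _ _ _) _ => //.
      - move=> k; apply/measurable_EFinP; apply: measurable_funX.
        by apply: measurable_funB; [exact: sqi_meas (su m)|exact: sqi_meas (sg k)].
      - by move=> k x Dx; rewrite lee_fin sqr_ge0.
      apply: (@limn_einf_le _ _ M) => k Mk.
      rewrite Rint_EFin; last by have [] := sqiB mD (su m) (sg k).
      rewrite lee_fin; apply: le_trans (hM m (n k) Mm _).
        by rewrite /ip; under eq_Rintegral do rewrite expr2.
      by rewrite (leq_trans Mk)// /n leq_addr.
    apply: ae_eq_integral => //.
    - by apply/measurable_EFinP; exact: measurable_funX.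
    - rewrite /limn_einf; apply: measurableT_comp => //.
      apply: measurable_fun_limn_esup => k; apply: measurableT_comp => //.
      apply/measurable_EFinP.
      apply: measurable_funX; apply: measurable_funB; first exact: sqi_meas (su m).
      exact: sqi_meas (sg k).
    apply: filterS gf => x + Dx => /(_ Dx) gfx.
    have h : ((u m x - g k x) ^+ 2)%:E @[k --> \oo] --> ((u m x - f x) ^+ 2)%:E.
      apply: cvg_EFin; first exact: nearW.
      by rewrite expr2; under eq_cvg do rewrite /= expr2; apply: cvgM;
        apply: cvgB => //; exact: cvg_cst.
    by rewrite is_cvg_limn_einfE ?(cvg_lim _ h)//; apply/cvg_ex; eexists; exact: h.
  have s : sqi (fun x => u m x - f x).
    split=> //; apply/integrableP; split.
      by apply/measurable_EFinP; exact: measurable_funX.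
    under eq_integral do rewrite /= ger0_norm ?sqr_ge0//.
    by rewrite (le_lt_trans le_ee)// ltry.
  split => //; rewrite -lee_fin -Rint_EFin; last exact: sqi_mul.
  by under eq_integral do rewrite -expr2.
have sf : sqi f.
  have [M hM] := cu 1 ltr01; have [s _] := key M 1 hM M (leqnn M).
  have := sqiB mD (su M) s; congr (sqi _); apply/funext => x; ring.
exists f => //; apply/cvgrPdist_le => ee ee0; have [M hM] := cu ee ee0.
exists M => // m /= Mm; rewrite sub0r normrN ger0_norm ?ip_ge0//.
by have [] := key M ee hM m Mm.
Qed.

End riesz_fischer.

(** * Minimizing sequences *)

Section near_minimizers.
Variables (R : realType) (W : Type) (inW : W -> Prop) (J : W -> R) (q : W -> W -> R).

(** Stated for an abstract functional because it serves twice: for the action, and for the squared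
    distance to a linear family in [projection]. *)
Lemma near_min_seq (w0 : W) (c : R) : inW w0 -> (forall w, inW w -> c <= J w) ->
  exists m : R, (forall w, inW w -> m <= J w) /\
    exists w : nat -> W, forall k, inW (w k) /\ J (w k) <= m + k.+1%:R^-1.
Proof.
move=> w00 Jc; pose m := inf [set J w | w in [set w | inW w]].
have hi : has_inf [set J w | w in [set w | inW w]].
  by split; [exists (J w0), w0|exists c => _ [w Ww <-]; exact: Jc].
have mJ w : inW w -> m <= J w.
  by move=> Ww; apply: ge_inf; [case: hi|exists w].
exists m; split => //.
suff /choice[w hw] : forall k : nat, exists w, inW w /\ J w <= m + k.+1%:R^-1 by exists w.
move=> k; have k0 : 0 < k.+1%:R^-1 :> R by rewrite invr_gt0.
by have [_ [w Ww <-] /ltW h] := inf_adherent k0 hi; exists w.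
Qed.

End near_minimizers.

(** * Lebesgue measure on R^p and the divergence theorem on a box *)

Section borel_rV.
Variable R : realType.

Lemma measurable_box_prod p (A : 'I_p -> set R) : (forall i, measurable (A i)) ->
  measurable [set x : 'rV[R]_p | forall i, A i (x ord0 i)].
Proof.
move=> mA; rewrite [X in measurable X](_ : _ = \bigcap_(i in [set: 'I_p])
    (fun x : 'rV[R]_p => x ord0 i) @^-1` A i).
  apply: fin_bigcap_measurable => // i _.
  by have := @measurable_coord R p i measurableT _ (mA i); rewrite setTI.
by apply/seteqP; split => x /= Ax; [move=> i _; exact: Ax|move=> i; exact: Ax].
Qed.

Definition gridpt n (m : nat) (z : 'rV[int]_n) : 'rV[R]_n :=
  \row_k ((z 0 k)%:~R / m.+1%:R).

Definition grid_floor n (m : nat) (x : 'rV[R]_n) : 'rV[int]_n :=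
  \row_k Num.floor (m.+1%:R * x 0 k).

Lemma cvg_grid n (x : 'rV[R]_n) : gridpt m (grid_floor m x) @[m --> \oo] --> x.
Proof.
apply/cvg_ballP => e e0.
near=> m; split => // i k; rewrite (ord1 i) /ball/= !mxE.
have m0 : 0 < m.+1%:R :> R by rewrite ltr0n.
set f := Num.floor _.
have f1 : f%:~R <= m.+1%:R * x 0 k by exact: floor_le.
have f2 : m.+1%:R * x 0 k < f%:~R + 1.
  by have := floorD1_gt (m.+1%:R * x 0 k); rewrite intrD.
have h1 : m.+1%:R^-1 < e by near: m; exact: near_infty_natSinv_lt (PosNum e0).
rewrite ger0_norm ?subr_ge0 ?ler_pdivrMr ?(mulrC (x 0 k))//.
apply: le_lt_trans h1; rewrite lerBlDr -(ler_pM2l m0) mulrDr mulfV ?gt_eqF//.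
by rewrite mulrCA mulfV ?gt_eqF// mulr1 addrC ltW.
Unshelve. all: by end_near. Qed.

(* Rounding to the grid reduces the composition to countably many values of the *)
(* second argument.                                                             *)
Lemma measurable_fun_superposition d (S : measurableType d) n
    (G : S -> 'rV[R]_n -> R) (U : S -> 'rV[R]_n) :
  (forall x, measurable_fun [set: S] (G ^~ x)) -> (forall s, continuous (G s)) ->
  (forall k, measurable_fun [set: S] (fun s => U s 0 k)) ->
  measurable_fun [set: S] (fun s => G s (U s)).
Proof.
move=> mG cG mU.
apply: (@measurable_fun_cvg _ _ _ setT
  (fun m s => G s (gridpt m (grid_floor m (U s))))); last first.
  move=> s _; apply: (cvg_comp (fun m => gridpt m (grid_floor m (U s))) (G s)).
    exact: cvg_grid.
  exact: cG.
move=> m _ Y mY; rewrite setTI.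
rewrite (_ : _ @^-1` _ = \bigcup_(x in [set: 'rV[int]_n])
    ([set s | grid_floor m (U s) = x] `&` (G ^~ (gridpt m x)) @^-1` Y)); last first.
  apply/seteqP; split => s /=; first by move=> h; exists (grid_floor m (U s)).
  by move=> [x _ [<-]].
apply: countable_bigcupT_measurable => [//|x].
apply: measurableI; last by rewrite -[X in measurable X]setTI; exact: mG.
rewrite (_ : [set s | grid_floor m (U s) = x] = \bigcap_(k in [set: 'I_n])
    (fun s => m.+1%:R * U s 0 k) @^-1` `[(x 0 k)%:~R, (x 0 k + 1)%:~R[%classic).
  apply: fin_bigcap_measurable => // k _; rewrite -[X in measurable X]setTI.
  by apply: measurable_funM => //; exact: measurable_cst.
apply/seteqP; split => s /=.
  by move=> <- k _ /=; rewrite in_itv/= mxE floor_le ?floorD1_gt.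
move=> h; apply/rowP => k; rewrite mxE; apply: floor_def.
by have /= := h k I; rewrite in_itv.
Qed.

Lemma continuous_measurable_rV p (f : 'rV[R]_p -> R) : continuous f ->
  measurable_fun setT f.
Proof.
move=> cf; apply: (@measurable_fun_superposition _ _ _ (fun=> f) id) => //.
exact: measurable_coord.
Qed.

End borel_rV.

Lemma prode_lty (R : realType) n (F : 'I_n -> \bar R) :
  (forall i, (0 <= F i < +oo)%E) -> (\prod_(i < n) F i < +oo)%E.
Proof.
move=> hF; suff /andP[] : (0 <= \prod_(i < n) F i < +oo)%E by [].
elim/big_ind : _ => [|x y /andP[x0 xoo] /andP[y0 yoo]|i _]; last exact: hF.
  by rewrite lee01 ltry.
by rewrite mule_ge0//= lte_mul_pinfty// ge0_fin_numE.
Qed.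

Lemma lebesgue_measure_cc_lty (R : realType) (a b : R) :
  (lebesgue_measure (`[a, b]%classic : set R) < +oo)%E.
Proof. by rewrite lebesgue_measure_itv/=; case: ifP => _; rewrite ?ltry// -EFinB ltry. Qed.

Section slicing.
Variables (R : realType) (q : nat) (i : 'I_q.+1).

Let ins (z : measurableTypeR R * 'rV[R]_q) : 'rV[R]_q.+1 :=
  @insert_coord R q.+1 i z.1 z.2.

Let mins : measurable_fun setT ins.
Proof. exact: (@measurable_insert_coord R q.+1 i). Qed.

(** [lebesgue_rV] is defined by splitting off the first coordinate; splitting off coordinate i gives
    the same measure. Both give a product set the product of the lengths, product sets form a
    generating pi-system, and the cubes [-k, k]^p have finite measure and exhaust the space. *)
Lemma lebesgue_rV_slice (A : set 'rV[R]_q.+1) : measurable A ->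
  @lebesgue_rV R q.+1 A = pushforward (lebesgue_measure \x @lebesgue_rV R q)%E ins A.
Proof.
pose G : set (set 'rV[R]_q.+1) := [set B | exists2 A : 'I_q.+1 -> set R,
  (forall i, measurable (A i)) & B = [set x : 'rV[R]_q.+1 | forall j, A j (x ord0 j)]].
have GE (A' : 'I_q.+1 -> set R) : (forall i, measurable (A' i)) ->
    @lebesgue_rV R q.+1 [set x | forall i, A' i (x ord0 i)] =
    pushforward (lebesgue_measure \x @lebesgue_rV R q)%E ins [set x | forall i, A' i (x ord0 i)].
  move=> mA; rewrite lebesgue_rV_prod// (bigD1_ord i)//=.
  rewrite -(@lebesgue_rV_prod R q (fun j => A' (lift i j)))//.
  rewrite -product_measure1E; [|exact: mA|].
    2: exact: (@measurable_box_prod R q (fun j => A' (lift i j))).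
  rewrite /pushforward; congr (_ _).
  apply/seteqP; split => -[c y] /= H.
  - by move: H => [Hc Hy] j; rewrite mxE; case: unliftP => [k ->|->].
  - split => [|j]; first by have := H i; rewrite mxE unlift_none.
    by have := H (lift i j); rewrite mxE liftK.
pose I k : set R := `[- k%:R, k%:R]%classic.
apply: (@measure_unique _ _ _ G (fun k => [set x : 'rV[R]_q.+1 | forall j,
  I k (x ord0 j)])) => //.
- apply/seteqP; split => [B|B].
    have msA : sigma_algebra setT <<s G >> by exact: smallest_sigma_algebra.
    apply: smallest_sub => // C; rewrite -bigcup_seq => -[/= j _ [Y mY <-]].
    apply: sub_sigma_algebra; exists (fun k => if k == j then Y else setT).
      by move=> k; case: ifP.
    rewrite setTI; apply/seteqP; split => x /=.
      by move=> Yx k; case: ifPn => // /eqP ->.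
    by move=> /(_ j); rewrite eqxx.
  apply: smallest_sub; first exact: sigma_algebra_measurable.
  by move=> _ [A' mA ->]; exact: measurable_box_prod.
- move=> _ _ [A1 mA1 ->] [A2 mA2 ->]; exists (fun j => A1 j `&` A2 j).
    by move=> j; exact: measurableI.
  apply/seteqP; split => x /=; first by move=> [h1 h2] j; split.
  by move=> h; split => j; have [] := h j.
- by move=> k; exists (fun=> I k) => // j; exact: measurable_itv.
- apply/seteqP; split => // x _.
  pose M := \sum_j `|x ord0 j|.
  exists (Num.truncn M).+1 => // j; rewrite /I/= in_itv/= -ler_norml.
  have h : `|x ord0 j| <= M.
    rewrite /M (bigD1 j)//= lerDl; exact: sumr_ge0.
  by rewrite (le_trans h)// ltW// truncnS_gt.
- by move=> _ [A' mA ->]; exact: GE.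
- move=> k; change (@lebesgue_rV R q.+1 [set x : 'rV[R]_q.+1 |
    forall j, I k (x ord0 j)] < +oo)%E.
  rewrite (@lebesgue_rV_prod R q.+1 (fun=> I k)); last by move=> j; exact: measurable_itv.
  by apply: prode_lty => j; rewrite measure_ge0 lebesgue_measure_cc_lty.
Qed.
End slicing.

Section box.
Variable R : realType.

Lemma boxE p (T : 'rV[R]_p) :
  box T = [set t | forall i, `[0, T 0 i]%classic (t ord0 i)].
Proof. by apply/seteqP; split => t /= h i; have := h i; rewrite in_itv. Qed.

Lemma measurable_box p (T : 'rV[R]_p) : measurable (box T).
Proof. by rewrite boxE; apply: (@measurable_box_prod R p (fun i => `[0, T 0 i]%classic)). Qed.

Lemma box_lty p (T : 'rV[R]_p) : (@lebesgue_rV R p (box T) < +oo)%E.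
Proof.
rewrite boxE (@lebesgue_rV_prod R p (fun i => `[0, T 0 i]%classic))//.
by apply: prode_lty => j; rewrite measure_ge0 lebesgue_measure_cc_lty.
Qed.

Lemma box_compact p (T : 'rV[R]_p) : compact (box T).
Proof.
rewrite boxE; apply: (@rV_compact R p (fun i => `[0, T 0 i]%classic)) => i.
exact: segment_compact.
Qed.

Lemma box_bounded p (T : 'rV[R]_p) (f : 'rV[R]_p -> R) :
  {within box T, continuous f} ->
  exists2 M : R, 0 < M & forall t, box T t -> `|f t| <= M.
Proof.
move=> cf; have /compact_bounded[M [_ hM]] := continuous_compact cf (@box_compact _ T).
exists (`|M| + 1) => [|t Tt]; first by rewrite ltr_wpDl.
apply: (hM (`|M| + 1)); last by exists t.
by rewrite ltr_pwDr// ler_norm.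
Qed.

Lemma continuous_box_bounded p (T : 'rV[R]_p) (f : 'rV[R]_p -> R) :
  continuous f -> exists2 M : R, 0 < M & forall t, box T t -> `|f t| <= M.
Proof. by move=> cf; apply: box_bounded; exact: continuous_subspaceT. Qed.

End box.

Section divergence.
Variables (R : realType) (q : nat) (i : 'I_q.+1) (T : 'rV[R]_q.+1).
Hypothesis hT : forall j, 0 < T 0 j.
Local Notation face := (@face_box R q.+1 T i).

Let ins (z : measurableTypeR R * 'rV[R]_q) : 'rV[R]_q.+1 :=
  @insert_coord R q.+1 i z.1 z.2.

Let mins : measurable_fun setT ins.
Proof. exact: (@measurable_insert_coord R q.+1 i). Qed.

Lemma box_insert (c : R) (y : 'rV[R]_q) :
  box T (@insert_coord R q.+1 i c y) <-> (0 <= c <= T 0 i) /\ face y.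
Proof.
split => [h|[hc hy] j].
  split; first by have := h i; rewrite mxE unlift_none.
  by move=> j; have := h (lift i j); rewrite !mxE liftK.
by rewrite mxE; case: unliftP => [k ->|->]//=; have := hy k; rewrite mxE.
Qed.

(** Fubini's theorem through the slicing formula; boundedness of f on the box supplies the
    integrability. *)
Lemma Rint_slice (f : 'rV[R]_q.+1 -> R) : measurable_fun setT f ->
  (exists M, forall t, box T t -> `|f t| <= M) ->
  (\int[@lebesgue_rV R q.+1]_(t in box T) (f t)%:E =
   \int[@lebesgue_rV R q]_(y in face)
     \int[lebesgue_measure]_(c in `[0%R, T 0%R i]) (f (@insert_coord R q.+1 i c y))%:E)%E.
Proof.
move=> mf [M fM].
have mB := @measurable_box R _ T.
have mface : measurable (face : set 'rV[R]_q) by exact: measurable_box.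
have pre : ins @^-1` box T = `[0, T 0 i]%classic `*` face.
  apply/seteqP; split => -[c y]; rewrite /preimage/= in_itv/=; by move/box_insert.
have mp : measurable (`[0, T 0 i]%classic `*` face :
    set (measurableTypeR R * 'rV[R]_q)) by exact: measurableX.
have nuoo : ((lebesgue_measure \x @lebesgue_rV R q)
    (`[0%R, T 0%R i]%classic `*` face) < +oo)%E.
  rewrite product_measure1E// lte_mul_pinfty//.
    by rewrite ge0_fin_numE// lebesgue_measure_cc_lty.
  exact: box_lty.
have if1 : (lebesgue_measure \x @lebesgue_rV R q)%E.-integrable
    (`[0, T 0 i]%classic `*` face) (EFin \o f \o ins).
  apply: (@itg_bounded _ _ _ _ _ mp nuoo (f \o ins) M).
  - apply: measurable_funTS; exact: measurableT_comp mf mins.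
  - by move=> z hz; apply: fM; change ((ins @^-1` box T) z); rewrite pre.
transitivity (\int[pushforward (lebesgue_measure \x @lebesgue_rV R q) ins]_(t in box T) (f t)%:E)%E.
  apply: eq_measure_integral => A mA _; exact: lebesgue_rV_slice.
rewrite (integral_pushforward mins)//; [|exact/measurable_EFinP|by rewrite pre].
rewrite pre integral_mkcond -integral21_prod_meas1; last first.
  exact: (integrable_mkcond (EFin \o f \o ins) mp).1 if1.
rewrite [RHS]integral_mkcond; apply: eq_integral => y _.
rewrite /fubini_G patchE; case: ifPn => hy.
  rewrite [RHS]integral_mkcond; apply: eq_integral => c _; rewrite !patchE.
  congr (if _ then _ else _); apply/idP/idP; rewrite !inE/=; last by rewrite inE in hy.
  by case.
apply: integral0_eq => c _; rewrite patchE ifF//; apply/negbTE.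
by apply: contra hy; rewrite !inE => -[].
Qed.

Lemma insert_coordD (c s : R) (y : 'rV[R]_q) :
  @insert_coord R q.+1 i (s + c) y =
  s *: basis_vec R i + @insert_coord R q.+1 i c y.
Proof.
apply/rowP => j; rewrite !mxE eqxx/=; case: unliftP => [k ->|->]/=.
  by rewrite eq_sym (negbTE (neq_lift _ _)) mulr0 add0r.
by rewrite eqxx mulr1.
Qed.

Lemma derive_insert (h : 'rV[R]_q.+1 -> R) (c : R) y :
  derivable h (@insert_coord R q.+1 i c y) (basis_vec R i) ->
  is_derive c 1 (fun c => h (@insert_coord R q.+1 i c y))
    ('D_(basis_vec R i) h (@insert_coord R q.+1 i c y)).
Proof.
move=> dh.
have E : (fun s => s^-1 *: (((fun c => h (@insert_coord R q.+1 i c y)) \o shift c)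
    (s *: 1) - h (@insert_coord R q.+1 i c y))) =
  (fun s => s^-1 *: ((h \o shift (@insert_coord R q.+1 i c y))
    (s *: basis_vec R i) - h (@insert_coord R q.+1 i c y))).
  by apply/funext => s /=; rewrite -[s *: 1]/(s * 1) mulr1 insert_coordD.
by split; rewrite /derivable /derive E.
Qed.

(** Fubini, and the fundamental theorem of calculus on each segment parallel to the axis i. *)
Lemma divergence_box (h : 'rV[R]_q.+1 -> R) :
  (forall t, derivable h t (basis_vec R i)) ->
  continuous (fun t => 'D_(basis_vec R i) h t) ->
  \int[@lebesgue_rV R q.+1]_(t in box T) 'D_(basis_vec R i) h t =
  \int[@lebesgue_rV R q]_(y in face)
    (h (@insert_coord R q.+1 i (T 0 i) y) - h (@insert_coord R q.+1 i 0 y)).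
Proof.
move=> dh ch; rewrite /Rintegral Rint_slice; last 2 first.
  exact: continuous_measurable_rV.
  by have [M _ hM] := continuous_box_bounded T ch; exists M.
congr fine; apply: eq_integral => y _.
have dr c := derive_insert (dh (@insert_coord R q.+1 i c y)).
have cins : continuous (fun c : R => @insert_coord R q.+1 i c y).
  move=> c; apply/cvg_ballP => e e0; have nb := nbhsx_ballx c e e0.
  near=> c'; have bc : ball c e c' by near: c'.
  split => // j k; rewrite (ord1 j) !mxE; case: (unlift _ _) => [k'|]/=.
    exact: ballxx.
  exact: bc.
have ccont : continuous (fun c => h (@insert_coord R q.+1 i c y)).
  by move=> c; apply: differentiable_continuous; apply/derivable1_diffP; have [] := dr c.
rewrite (@continuous_FTC2 _ _ (fun c => h (@insert_coord R q.+1 i c y)))// ?EFinB//.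
- apply: continuous_subspaceT => c; apply: (@continuous_comp _ _ _
    (fun c : R => @insert_coord R q.+1 i c y) (fun t => 'D_(basis_vec R i) h t)).
    exact: cins.
  exact: ch.
- split => [c _| |]; first by have [] := dr c.
    exact/cvg_at_right_filter/ccont.
  exact/cvg_at_left_filter/ccont.
- by move=> c _; rewrite derive1E; apply: derive_val.
Unshelve. all: by end_near. Qed.

End divergence.

#[global] Hint Extern 0 (measurable (box _)) => solve [exact: measurable_box] : core.
#[global] Hint Extern 0 (measurable (face_box _ _)) => solve [exact: measurable_box] : core.
#[global] Hint Extern 0 (is_true (_ (box _) < +oo)%E) => solve [exact: box_lty] : core.
#[global] Hint Extern 0 (is_true (_ (face_box _ _) < +oo)%E) => solve [exact: box_lty] : core.

(** * Trigonometric polynomials *)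

Section waves.
Variables (R : realType) (p : nat) (T : 'rV[R]_p).
Implicit Types (k : 'rV[int]_p) (t : 'rV[R]_p).

Definition freq k (i : 'I_p) : R := 2 * pi * (k 0 i)%:~R / T 0 i.

Definition phase k t : R := \sum_i freq k i * t 0 i.

(* The triple (k, a, c) stands for t |-> c cos(<freq k, t> + a); shifting the phase *)
(* by pi/2 makes partial derivatives act on such triples.                           *)
Definition tpoly : Type := seq ('rV[int]_p * R * R).
Implicit Types s : tpoly.

Definition wave (w : 'rV[int]_p * R * R) t : R :=
  w.2 * cos (phase w.1.1 t + w.1.2).

Definition ev s t : R := \sum_(w <- s) wave w t.

Definition dt i s : tpoly :=
  [seq (w.1.1, w.1.2 + pi / 2, freq w.1.1 i * w.2) | w <- s].

(** The eigenvalue of minus the Laplacian on every wave with frequency vector k. *)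
Definition eigen k : R := \sum_i freq k i ^+ 2.

Definition lapl s : tpoly := [seq (w.1, - eigen w.1.1 * w.2) | w <- s].

Definition tscale (a : R) s : tpoly := [seq (w.1, a * w.2) | w <- s].

Lemma ev_cat s s' t : ev (s ++ s') t = ev s t + ev s' t.
Proof. by rewrite /ev big_cat. Qed.

Lemma ev_tscale a s t : ev (tscale a s) t = a * ev s t.
Proof. by rewrite /ev big_map mulr_sumr; apply: eq_bigr => w _; rewrite /wave mulrA. Qed.

Lemma dt_cat i s s' : dt i (s ++ s') = dt i s ++ dt i s'.
Proof. exact: map_cat. Qed.

Lemma lapl_cat s s' : lapl (s ++ s') = lapl s ++ lapl s'.
Proof. exact: map_cat. Qed.

Lemma dt_tscale i a s : dt i (tscale a s) = tscale a (dt i s).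
Proof. by rewrite /dt /tscale -!map_comp; apply: eq_map => w /=; rewrite mulrCA. Qed.

Lemma lapl_tscale a s : lapl (tscale a s) = tscale a (lapl s).
Proof. by rewrite /lapl /tscale -!map_comp; apply: eq_map => w /=; rewrite mulrCA. Qed.

Lemma dtC i j s : dt i (dt j s) = dt j (dt i s).
Proof. by rewrite /dt -!map_comp; apply: eq_map => w /=; rewrite mulrCA. Qed.

Lemma ev_lapl s t : ev (lapl s) t = \sum_i ev (dt i (dt i s)) t.
Proof.
rewrite /ev big_map.
under [RHS]eq_bigr do rewrite big_map big_map.
rewrite exchange_big/=; apply: eq_bigr => w _.
rewrite /wave/= -mulrA mulNr /eigen mulr_suml -sumrN.
apply: eq_bigr => i _.
by rewrite !addrA !cosDpihalf sinDpihalf; ring.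
Qed.

Lemma derive_comp1 (f : 'rV[R]_p -> R) (g : R -> R) t v :
  differentiable f t -> derivable g (f t) 1 ->
  'D_v (g \o f) t = 'D_1 g (f t) * 'D_v f t.
Proof.
move=> df /derivable1_diffP dg.
rewrite deriveE; last exact: differentiable_comp.
rewrite diff_comp// deriveE// deriveE//=.
rewrite -[X in 'd g _ X]mulr1 -[X in 'd g _ X]/(_ *: (1 : R)) linearZ/=.
exact: mulrC.
Qed.

Lemma differentiable_phase k t : differentiable (phase k) t.
Proof.
rewrite (_ : phase k = \sum_i (freq k i *: (fun t : 'rV[R]_p => t 0 i : R))); last first.
  by apply/funext => u; rewrite fct_sumE.
apply: differentiable_sum => i; apply: differentiableZ; exact: differentiable_coord.
Qed.

Lemma phaseD k t u : phase k (t + u) = phase k t + phase k u.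
Proof. by rewrite /phase -big_split; apply: eq_bigr => i _; rewrite mxE mulrDr. Qed.

Lemma phase_basis k a i : phase k (a *: basis_vec R i) = a * freq k i.
Proof.
rewrite /phase (bigD1 i)//= big1 ?addr0; first by rewrite !mxE !eqxx mulr1 mulrC.
by move=> j ji; rewrite !mxE eqxx (negbTE ji) !mulr0.
Qed.

Lemma derive_phase k t i : 'D_(basis_vec R i) (phase k) t = freq k i.
Proof.
apply/cvg_lim => //; apply: (@cvg_trans _ (nbhs (freq k i)) _); last exact: cvg_refl.
apply: cvg_near_cst; near=> h.
rewrite /= phaseD phase_basis addrK /GRing.scale/= mulrA mulVf ?mul1r//.
by near: h; exact: nbhs_dnbhs_neq.
Unshelve. all: by end_near. Qed.

Lemma differentiable_ev s t : differentiable (ev s) t.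
Proof.
elim: s => [|w s IH].
  rewrite (_ : ev [::] = cst 0); first exact: differentiable_cst.
  by apply/funext => u; rewrite /ev big_nil.
rewrite (_ : ev (w :: s) = w.2 *: (cos \o (phase w.1.1 + cst w.1.2)) + ev s).
  apply: differentiableD => //; apply: differentiableZ; apply: differentiable_comp.
    apply: differentiableD; [exact: differentiable_phase|exact: differentiable_cst].
  exact/derivable1_diffP.
by apply/funext => u; rewrite /ev big_cons.
Qed.

Lemma derive_ev s i t : 'D_(basis_vec R i) (ev s) t = ev (dt i s) t.
Proof.
elim: s => [|w s IH].
  rewrite (_ : ev [::] = cst 0); first by rewrite derive_cst.
  by apply/funext => u; rewrite /ev big_nil.
have dph : differentiable (phase w.1.1 + cst w.1.2) t.
  apply: differentiableD; [exact: differentiable_phase|exact: differentiable_cst].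
have dco : differentiable (cos \o (phase w.1.1 + cst w.1.2)) t.
  by apply: differentiable_comp => //; exact/derivable1_diffP.
rewrite (_ : ev (w :: s) = w.2 *: (cos \o (phase w.1.1 + cst w.1.2)) + ev s).
  rewrite deriveD; [|exact/diff_derivable/differentiableZ|].
    2: exact/diff_derivable/differentiable_ev.
  rewrite IH [RHS]/ev big_cons; congr (_ + _).
  rewrite deriveZ; last exact: diff_derivable.
  rewrite derive_comp1// deriveD; [|exact/diff_derivable/differentiable_phase|].
    2: exact: derivable_cst.
  rewrite derive_cst addr0 derive_phase derive_val /wave/= addrA cosDpihalf.
  by rewrite /GRing.scale/=; ring.
by apply/funext => u; rewrite /ev big_cons.
Qed.

Lemma continuous_ev s : continuous (ev s).
Proof. by move=> t; apply: differentiable_continuous; exact: differentiable_ev. Qed.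

Lemma cosD2piz (x : R) (m : int) : cos (x + 2 * pi * m%:~R) = cos x.
Proof.
have E (n : nat) (y : R) : cos (y + 2 * pi * n%:R) = cos y.
  rewrite -[RHS](periodicn (@cosD2pi R) n); congr cos.
  by rewrite mulr_natr (mulr_natl pi 2).
case: m => n; first exact: E.
by rewrite NegzE -(E n.+1) rmorphN/= mulrN subrK.
Qed.

Hypothesis hT : forall i, 0 < T 0 i.

Lemma ev_periodic s i t : ev s (t + T 0 i *: basis_vec R i) = ev s t.
Proof.
apply: eq_bigr => w _; rewrite /wave; congr (_ * _).
rewrite phaseD phase_basis /freq mulrC divfK ?gt_eqF//.
by rewrite addrAC cosD2piz.
Qed.

Variable n : nat.
Implicit Types S : 'I_n -> tpoly.

Definition vec S t : 'rV[R]_n := \row_j ev (S j) t.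

Lemma derive_vec S i t :
  'D_(basis_vec R i) (vec S) t = vec (fun j => dt i (S j)) t.
Proof.
have E a j : (fun t => vec S t a j) = ev (S j) by apply/funext => u; rewrite mxE.
rewrite derive_mx.
  by apply/matrixP => a j; rewrite !mxE E derive_ev.
by apply/derivable_mxP => a j; rewrite E; apply/diff_derivable/differentiable_ev.
Qed.

(** The class is stable under [dt], so each iterated partial derivative is again given by
    trigonometric polynomials and is differentiable. *)
Lemma smooth_vec S : smooth (vec S).
Proof.
move=> l t; have -> : iter_partial l (vec S) = vec (fun j => foldr dt (S j) l).
  elim: l => [//|i l IH]; rewrite /iter_partial/= -/(iter_partial l (vec S)) IH.
  by apply/funext => u; rewrite derive_vec.
rewrite (_ : vec _ = \sum_j (fun t => ev (foldr dt (S j) l) t *: basis_vec R j)).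
  apply: differentiable_sum => j; apply: differentiableZl; exact: differentiable_ev.
apply/funext => u; rewrite fct_sumE; apply/rowP => j.
rewrite mxE summxE (bigD1 j)//= big1 ?addr0; first by rewrite !mxE !eqxx mulr1.
by move=> m mj; rewrite !mxE eqxx eq_sym (negbTE mj) mulr0.
Qed.

Lemma smooth_coord (v : 'rV[R]_p -> 'rV[R]_n) j : smooth v ->
  [/\ continuous (fun t => v t 0 j),
      forall t i, derivable (fun t => v t 0 j) t (basis_vec R i),
      forall t i, 'D_(basis_vec R i) (fun t => v t 0 j) t =
                  ('D_(basis_vec R i) v t) 0 j &
      forall i, continuous (fun t => ('D_(basis_vec R i) v t) 0 j)].
Proof.
move=> sv.
have dv t : differentiable v t by exact: (sv [::]).
have dc t : differentiable (fun t => v t 0 j) t.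
  exact: (differentiable_comp (dv t) (@differentiable_coord _ 1 n (v t) 0 j)).
split.
- by move=> t; apply: differentiable_continuous.
- by move=> t i; exact: diff_derivable.
- by move=> t i; rewrite derive_mx ?mxE//; exact: diff_derivable.
- move=> i t; apply: differentiable_continuous.
  exact: (differentiable_comp (sv [:: i] t) (@differentiable_coord _ 1 n _ 0 j)).
Qed.

End waves.

(** * Integration by parts, spectral gap and trace inequality *)

Section continuous_arith.
Variables (R : realType) (U : topologicalType).
Implicit Types f g : U -> R.

Lemma continuous_add f g : continuous f -> continuous g ->
  continuous (fun x => f x + g x).
Proof. by move=> cf cg x; exact: (@continuousD _ _ _ f g x (cf x) (cg x)). Qed.

Lemma continuous_sub f g : continuous f -> continuous g ->
  continuous (fun x => f x - g x).
Proof. by move=> cf cg x; exact: (@continuousB _ _ _ f g x (cf x) (cg x)). Qed.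

Lemma continuous_mul f g : continuous f -> continuous g ->
  continuous (fun x => f x * g x).
Proof. by move=> cf cg x; exact: (@continuousM _ _ f g x (cf x) (cg x)). Qed.

End continuous_arith.

Section faces.
Variables (R : realType) (q : nat) (T : 'rV[R]_q.+1).
Local Notation p := q.+1.

Lemma continuous_insert_coord (i : 'I_p) (c : R) :
  continuous (fun y : 'rV[R]_q => @insert_coord R p i c y).
Proof.
move=> y A /nbhs_ballP[e e0 eA]; apply/nbhs_ballP; exists e => // y' by'.
apply: eA; split => // a b; rewrite !mxE; case: (unlift _ _) => [b'|]/=; last exact: ballxx.
by case: by' => _ /(_ 0 b').
Qed.

Lemma sqi_face (i : 'I_p) (c : R) (f : 'rV[R]_p -> R) : continuous f ->
  sqi (@lebesgue_rV R q) (@face_box R p T i) (fun y => f (@insert_coord R p i c y)).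
Proof.
move=> cf; have c1 : continuous (fun y => f (@insert_coord R p i c y)).
  by move=> y; exact: (continuous_comp (continuous_insert_coord (c := c) (x := y)) (cf _)).
have [M _ hM] := continuous_box_bounded (col' i T) c1.
apply: (sqi_bounded (@measurable_box R q _) (@box_lty R q _) _ hM).
exact: (measurable_funTS (continuous_measurable_rV c1)).
Qed.

End faces.

Section periodic_calculus.
Variables (R : realType) (q : nat) (T : 'rV[R]_q.+1).
Hypothesis hT : forall i, 0 < T 0 i.
Local Notation p := q.+1.
Local Notation mu := (@lebesgue_rV R q.+1).
Local Notation D := (box T).
Local Notation sqi := (sqi mu D).
Local Notation ip := (ip mu D).
Local Notation ev := (ev T).
Local Notation dt := (dt T).
Local Notation lapl := (lapl T).
Local Notation mD := (@measurable_box R _ T).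
Local Notation muD := (@box_lty R _ T).
Local Notation e_ := (basis_vec R).
Implicit Types (s : tpoly R p) (f g h : 'rV[R]_p -> R).

Lemma continuous_sqi f : continuous f -> sqi f.
Proof.
move=> cf; have [M _ hM] := continuous_box_bounded T cf.
by apply: (sqi_bounded mD muD _ hM); apply: measurable_funTS; exact: continuous_measurable_rV.
Qed.

Lemma sqi_ev s : sqi (ev s).
Proof. exact/continuous_sqi/continuous_ev. Qed.

(** The divergence theorem for the product f g: by periodicity the contributions of the two faces
    cancel. *)
Lemma ip_parts f g (i : 'I_p) :
  (forall t, derivable f t (e_ i)) -> (forall t, derivable g t (e_ i)) ->
  continuous f -> continuous g ->
  continuous (fun t => 'D_(e_ i) f t) -> continuous (fun t => 'D_(e_ i) g t) ->
  (forall t, f (t + T 0 i *: e_ i) = f t) ->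
  (forall t, g (t + T 0 i *: e_ i) = g t) ->
  ip f (fun t => 'D_(e_ i) g t) = - ip (fun t => 'D_(e_ i) f t) g.
Proof.
move=> df dg cf cg cdf cdg pf pg.
have DE : (fun t => 'D_(e_ i) (f * g) t) =
    (fun t => f t * 'D_(e_ i) g t + g t * 'D_(e_ i) f t).
  by apply/funext => t; rewrite deriveM.
have cDE : continuous (fun t => 'D_(e_ i) (f * g) t).
  by rewrite DE; apply: continuous_add; apply: continuous_mul.
have := divergence_box hT (fun t => derivableM (df t) (dg t)) cDE.
rewrite [X in _ = X -> _](_ : _ = 0); last first.
  rewrite /Rintegral integral0_eq// => y _; congr EFin.
  have E : insert_coord i (T 0 i) y = @insert_coord R p i 0 y + T 0 i *: e_ i.
    by rewrite -[in LHS](addr0 (T 0 i)) insert_coordD addrC.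
  by rewrite E /GRing.mul/= pf pg subrr.
under eq_Rintegral do rewrite (congr1 (@^~ _) DE)/=.
rewrite RintegralD//; last 2 first.
  by apply: (sqi_mul mD);exact: continuous_sqi.
  by apply: (sqi_mul mD); exact: continuous_sqi.
rewrite -/(ip f (fun t => 'D_(e_ i) g t)) -/(ip g (fun t => 'D_(e_ i) f t)).
by rewrite (ipC mu D g) => /eqP; rewrite addr_eq0 => /eqP.
Qed.

Lemma ip_parts_smooth s (v : 'rV[R]_p -> R) (i : 'I_p) : continuous v ->
  (forall t, derivable v t (e_ i)) -> continuous (fun t => 'D_(e_ i) v t) ->
  (forall t, v (t + T 0 i *: e_ i) = v t) ->
  ip (ev s) (fun t => 'D_(e_ i) v t) = - ip (ev (dt i s)) v.
Proof.
move=> cv dv cdv pv.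
have E : (fun t => 'D_(e_ i) (ev s) t) = ev (dt i s).
  by apply/funext => t; rewrite derive_ev.
rewrite -E; apply: ip_parts => //.
- by move=> t; apply: diff_derivable; exact: differentiable_ev.
- exact: continuous_ev.
- by rewrite E; exact: continuous_ev.
- by move=> t; rewrite ev_periodic.
Qed.

Lemma ip_parts_ev i s s' : ip (ev s) (ev (dt i s')) = - ip (ev (dt i s)) (ev s').
Proof.
have E : (fun t => 'D_(e_ i) (ev s') t) = ev (dt i s').
  by apply/funext => t; rewrite derive_ev.
rewrite -E; apply: ip_parts_smooth.
- exact: continuous_ev.
- by move=> t; apply: diff_derivable; exact: differentiable_ev.
- by rewrite E; exact: continuous_ev.
- by move=> t; rewrite ev_periodic.
Qed.

Lemma ip_lapl s s' :
  ip (ev (lapl s)) (ev s') = - \sum_i ip (ev (dt i s)) (ev (dt i s')).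
Proof.
have -> : ev (lapl s) = (fun t => \sum_i ev (dt i (dt i s)) t).
  by apply/funext => t; rewrite ev_lapl.
rewrite ip_suml//; try by move=> *; exact: sqi_ev.
by rewrite -sumrN; apply: eq_bigr => i _; rewrite ip_parts_ev opprK.
Qed.

(** Integrating by parts and commuting derivatives, the squared norm of d_a d_b s equals the inner
    product of d_a^2 s and d_b^2 s. The sum over all a and b is the squared norm of the Laplacian,
    so the latter dominates each term. *)
Lemma ip_hessian_le i j s : ip (ev (dt i (dt j s))) (ev (dt i (dt j s)))
  <= ip (ev (lapl s)) (ev (lapl s)).
Proof.
have H a b : ip (ev (dt a (dt b s))) (ev (dt a (dt b s))) =
    ip (ev (dt a (dt a s))) (ev (dt b (dt b s))).
  have h1 := ip_parts_ev b (dt a (dt a s)) (dt b s).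
  have h2 := ip_parts_ev a (dt b s) (dt a (dt b s)).
  have h3 := ip_parts_ev a (dt b (dt a s)) (dt b s).
  rewrite h1 dtC (dtC _ b a (dt a s)) (dtC _ b a s) in h3 *.
  by rewrite -h3 (dtC _ a b).
have -> : ip (ev (lapl s)) (ev (lapl s)) = \sum_a \sum_b
    ip (ev (dt a (dt b s))) (ev (dt a (dt b s))).
  have E : ev (lapl s) = (fun t => \sum_i ev (dt i (dt i s)) t).
    by apply/funext => t; rewrite ev_lapl.
  rewrite {1}E ip_suml//; try by move=> *; exact: sqi_ev.
  apply: eq_bigr => a _.
  rewrite E ip_sumr//; try by move=> *; exact: sqi_ev.
  by apply: eq_bigr => b _; rewrite H.
rewrite (bigD1 i)//= (bigD1 j)//= -addrA lerDl addr_ge0//.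
  by apply: sumr_ge0 => ? _; exact: ip_ge0.
by apply: sumr_ge0 => ? _; apply: sumr_ge0 => ? _; exact: ip_ge0.
Qed.

Definition osc s : tpoly R p := [seq w <- s | w.1.1 != 0].

(** Waves of zero frequency are constant, so this is the mean of [ev s] over the box, read off from
    the coefficients. *)
Definition avg s : R := \sum_(w <- s | w.1.1 == 0) w.2 * cos w.1.2.

Lemma phase0 t : phase T 0 t = 0.
Proof. by rewrite /phase big1// => i _; rewrite /freq mxE mulr0 !mul0r. Qed.

Lemma ev_avg s t : ev s t = avg s + ev (osc s) t.
Proof.
rewrite /ev big_filter (bigID (fun w => w.1.1 == 0))/=; congr (_ + _).
by apply: eq_bigr => w /eqP w0; rewrite /wave w0 phase0 add0r.
Qed.

Lemma ev_dt_osc i s t : ev (dt i (osc s)) t = ev (dt i s) t.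
Proof.
rewrite [RHS](ev_avg (dt i s)) [X in X + _](_ : _ = 0) ?add0r.
  by congr (ev _ t); rewrite /osc /dt filter_map.
rewrite /avg /dt big_map big1// => w /eqP/= w0.
by rewrite w0 /freq mxE mulr0 !mul0r.
Qed.

Lemma osc_cat s s' : osc (s ++ s') = osc s ++ osc s'.
Proof. exact: filter_cat. Qed.

Lemma osc_tscale a s : osc (tscale a s) = tscale a (osc s).
Proof. by rewrite /osc /tscale filter_map. Qed.

(** The least nonzero eigenvalue is (2 pi / max T)^2; with the sum of the periods in place of their
    maximum the constant is no larger and still positive. *)
Definition gap : R := (2 * pi / \sum_i T 0 i) ^+ 2.

Lemma sumT_gt0 : 0 < \sum_i T 0 i.
Proof. by rewrite (bigD1 ord0)//= ltr_pwDl// sumr_ge0// => i _; exact: ltW. Qed.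

Lemma gap_gt0 : 0 < gap.
Proof.
by rewrite exprn_gt0// divr_gt0// ?sumT_gt0// mulr_gt0// pi_gt0.
Qed.

Lemma gap_le k : k != 0 -> gap <= eigen T k.
Proof.
move=> k0; have [i ki] : exists i, k 0 i != 0.
  apply: contrapT => h; move/eqP: k0; apply; apply/rowP => i; rewrite mxE.
  by apply/eqP; apply: contra_notT h => ?; exists i.
apply: (@le_trans _ _ (freq T k i ^+ 2)); last first.
  by rewrite /eigen (bigD1 i)//= lerDl sumr_ge0// => j _; exact: sqr_ge0.
have Ti := hT i; have S0 := sumT_gt0.
have -> : freq T k i ^+ 2 = (2 * pi) ^+ 2 * ((k 0 i)%:~R ^+ 2 * (T 0 i)^-1 ^+ 2).
  by rewrite /freq !exprMn [RHS]mulrA.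
rewrite /gap exprMn ler_pM2l; last by rewrite exprn_gt0// mulr_gt0// pi_gt0.
apply: (@le_trans _ _ (1 * (T 0 i)^-1 ^+ 2)).
  rewrite mul1r ler_pXn2r ?nnegrE ?invr_ge0 ?(ltW Ti) ?(ltW S0)// lef_pV2 ?posrE//.
  by rewrite (bigD1 i)//= lerDl sumr_ge0// => j _; exact: ltW.
rewrite ler_pM2r; last by rewrite exprn_gt0// invr_gt0.
rewrite -rmorphXn/= ler1z -gtz0_ge1 lt_neqAle sqr_ge0 andbT eq_sym.
by rewrite expf_neq0.
Qed.

(** The Laplacian is symmetric, and the two waves are eigenfunctions for different eigenvalues. *)
Lemma eigen_orth w w' : eigen T w.1.1 != eigen T w'.1.1 ->
  ip (wave T w) (wave T w') = 0.
Proof.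
have E (x : 'rV[int]_p * R * R) : ev [:: x] = wave T x.
  by apply/funext => t; rewrite /ev big_seq1.
have L x : ev (lapl [:: x]) = (fun t => - eigen T x.1.1 * wave T x t).
  by apply/funext => t; rewrite /ev big_seq1 /wave/= mulrA.
have sw x : sqi (wave T x) by rewrite -E; exact: sqi_ev.
have h1 := ip_lapl [:: w] [:: w']; have h2 := ip_lapl [:: w'] [:: w].
have : ip (ev (lapl [:: w])) (ev [:: w']) = ip (ev (lapl [:: w'])) (ev [:: w]).
  by rewrite h1 h2; congr (- _); apply: eq_bigr => i _; rewrite ipC.
rewrite !L !E (ipZl mD (- eigen T w.1.1) (sw w) (sw w')).
rewrite (ipZl mD (- eigen T w'.1.1) (sw w') (sw w)).
rewrite (ipC _ _ (wave T w')) => h ne.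
have : (eigen T w.1.1 - eigen T w'.1.1) * ip (wave T w) (wave T w') = 0.
  by rewrite mulrBl; apply/eqP; rewrite subr_eq0 -eqr_opp -!mulNr; exact/eqP.
by move=> /eqP; rewrite mulf_eq0 subr_eq0 (negbTE ne) => /eqP.
Qed.

(* Since waves with distinct eigenvalues are orthogonal, the quadratic form of *)
(* -Laplacian - gap is the squared norm of sqrt(-Laplacian - gap) u.           *)
Lemma spectral_gap s : gap * ip (ev (osc s)) (ev (osc s))
  <= \sum_i ip (ev (dt i s)) (ev (dt i s)).
Proof.
set o := osc s.
have -> : \sum_i ip (ev (dt i s)) (ev (dt i s)) =
    \sum_i ip (ev (dt i o)) (ev (dt i o)).
  by apply: eq_bigr => i _; apply: eq_ip => t _; rewrite ev_dt_osc.
have sw x : sqi (wave T x).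
  rewrite (_ : wave T x = ev [:: x]); first exact: sqi_ev.
  by apply/funext => t; rewrite /ev big_seq1.
have IP (f g : 'rV[int]_p * R * R -> R) :
   ip (fun t => \sum_(w <- o) f w * wave T w t) (fun t => \sum_(w <- o) g w * wave T w t) =
   \sum_(w <- o) \sum_(w' <- o) f w * g w' * ip (wave T w) (wave T w').
  have sf (c : 'rV[int]_p * R * R -> R) w : sqi (fun t => c w * wave T w t) by exact: (sqiZ mD).
  rewrite ip_suml//; try by move=> *; exact: sqi_sum.
  apply: eq_bigr => w _; rewrite ip_sumr//.
  apply: eq_bigr => w' _; rewrite (ipZl mD (f w) (sw w) (sf g w')).
  by rewrite (ipZr mD (g w') (sw w') (sw w)) mulrA.
have -> : \sum_i ip (ev (dt i o)) (ev (dt i o)) = - ip (ev (lapl o)) (ev o).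
  by rewrite ip_lapl opprK.
have evo : ev o = (fun t => \sum_(w <- o) 1 * wave T w t).
  by apply/funext => t; apply: eq_bigr => w _; rewrite mul1r.
have -> : ev (lapl o) = (fun t => \sum_(w <- o) - eigen T w.1.1 * wave T w t).
  by apply/funext => t; rewrite /ev big_map; apply: eq_bigr => w _; rewrite /wave/= mulrA.
rewrite !evo !IP -subr_ge0 mulr_sumr -sumrN -sumrB.
have := ip_ge0 mu D (fun t => \sum_(w <- o) Num.sqrt (eigen T w.1.1 - gap) * wave T w t).
rewrite IP => h; apply: le_trans h _; rewrite le_eqVlt; apply/orP; left; apply/eqP.
apply: eq_big_seq => w wo; rewrite mulr_sumr -sumrN -sumrB.
apply: eq_big_seq => w' w'o.
(* The double sums agree term by term: by orthogonality both terms vanish for distinct eigenvalues,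
   and for equal ones the two square roots multiply to the eigenvalue minus [gap]. *)
have [e|ne] := eqVneq (eigen T w.1.1) (eigen T w'.1.1); last first.
  by rewrite eigen_orth// !mulr0 !oppr0 ?addr0.
rewrite -e -(expr2 (Num.sqrt _)) sqr_sqrtr; first by ring.
by rewrite subr_ge0 gap_le//; move: wo; rewrite mem_filter => /andP[].
Qed.

(** Divergence theorem for (T_i - t_i) g^2 with g = [ev s]: the weight vanishes on the face t_i =
    T_i and equals T_i on the face t_i = 0. Young's inequality, in the form (g + (T_i - t_i) d_i
    g)^2 >= 0, absorbs the cross term. *)
Lemma trace_le s i :
  T 0 i * \int[@lebesgue_rV R q]_(y in (@face_box R p T i))
      (ev s (@insert_coord R p i 0 y)) ^+ 2
  <= 2 * ip (ev s) (ev s) + T 0 i ^+ 2 * ip (ev (dt i s)) (ev (dt i s)).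
Proof.
pose g := ev s; pose l (t : 'rV[R]_p) : R := T 0 i - t 0 i.
have dg t : derivable g t (e_ i) by apply: diff_derivable; exact: differentiable_ev.
have dl t : is_derive t (e_ i) l (- 1).
  have dc : is_derive t (e_ i) (fun t : 'rV[R]_p => t 0 i) 1.
    split; first by apply: diff_derivable; exact: differentiable_coord.
    apply/cvg_lim => //; apply: cvg_near_cst; near=> x.
    rewrite /= !mxE !eqxx mulr1 addrK /GRing.scale/= mulVf//.
    by near: x; exact: nbhs_dnbhs_neq.
  have := is_deriveB (is_derive_cst (T 0 i) t (e_ i)) dc.
  by rewrite sub0r.
pose h := l * (g * g).
have dh t : derivable h t (e_ i).
  by apply: derivableM; [have [] := dl t|exact: derivableM].
have DE : (fun t => 'D_(e_ i) h t) =
    (fun t => 2 * (l t * (g t * ev (dt i s) t)) - g t * g t).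
  apply/funext => t; rewrite deriveM; [|by have [] := dl t|exact: derivableM].
  rewrite deriveM// derive_val -[(g * g) t]/(g t * g t) /g derive_ev.
  by rewrite /GRing.scale/=; ring.
have cl : continuous l.
  by apply: continuous_sub; [exact: cst_continuous|exact: coord_continuous].
have cg : continuous g by exact: continuous_ev.
have cDE : continuous (fun t => 'D_(e_ i) h t).
  rewrite DE; apply: continuous_sub; last exact: continuous_mul.
  apply: continuous_mul; first exact: cst_continuous.
  apply: continuous_mul => //; apply: continuous_mul => //; exact: continuous_ev.
have := divergence_box hT dh cDE.
rewrite (_ : (fun y => h _ - h _) = (fun y => - T 0 i * (ev s (@insert_coord R p i 0 y)) ^+ 2)); last first.
  apply/funext => y; rewrite -![h _]/(l _ * (g _ * g _)) /l !mxE unlift_none/=.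
  by rewrite subrr subr0 mul0r sub0r /g expr2; ring.
have iface := (sqi_face T i 0 (@continuous_ev _ _ T s)).2.
rewrite (RintegralZl _ _ iface)//.
move=> /(congr1 -%R); rewrite mulNr opprK => <-.
have iDh : itg mu D (fun t => 'D_(e_ i) h t).
  by apply: sqi_itg => //; exact: continuous_sqi.
have i1 := sqi_mul mD (sqi_ev s) (sqi_ev s).
have i2 := sqi_mul mD (sqi_ev (dt i s)) (sqi_ev (dt i s)).
rewrite -mulN1r -(RintegralZl _ mD iDh) -(RintegralZl _ mD i1) -(RintegralZl _ mD i2).
rewrite -(RintegralD mD (itgZ mD 2 i1) (itgZ mD (T 0 i ^+ 2) i2)).
apply: (le_Rint mD (itgZ mD _ iDh) (itgD mD (itgZ mD _ i1) (itgZ mD _ i2))).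
move=> t Dt; rewrite (congr1 (@^~ t) DE)/= -/g /l.
have /andP[t0 tT] := Dt i.
set G := g t; set G' := ev (dt i s) t; set L := T 0 i - t 0 i.
have L0 : 0 <= L by rewrite subr_ge0.
have LT : L ^+ 2 <= T 0 i ^+ 2 by rewrite lerXn2r ?nnegrE ?(ltW (hT i))// /L; lra.
have h1 : 0 <= G * G + 2 * (L * (G * G')) + L ^+ 2 * (G' * G').
  by rewrite (_ : _ + _ = (G + L * G') ^+ 2) ?sqr_ge0//; ring.
have h2 : 0 <= (T 0 i ^+ 2 - L ^+ 2) * (G' * G').
  by rewrite mulr_ge0 ?subr_ge0// -expr2 sqr_ge0.
by move: h1 h2; rewrite mulrBl; lra.
Unshelve. all: by end_near. Qed.

End periodic_calculus.

(** * Completeness of the trigonometric system *)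

Section step_function.
Variable R : realType.

Lemma bernoulli_ge (x : R) m : -1 <= x -> 1 + m%:R * x <= (1 + x) ^+ m.
Proof.
move=> x1; elim: m => [|m IH]; first by rewrite mul0r addr0 expr0.
rewrite exprS; apply: (@le_trans _ _ ((1 + x) * (1 + m%:R * x))); last first.
  by rewrite ler_wpM2l//; lra.
have : 0 <= m%:R * x ^+ 2 by rewrite mulr_ge0 ?sqr_ge0.
rewrite -natr1 expr2; nra.
Qed.

(** With y the square root of z, Bernoulli's inequality for 1 / y bounds n y^n by 1 / (1 - y), and
    the remaining factor y^n tends to 0. *)
Lemma cvg_natr_geometric (z : R) : 0 <= z < 1 -> n%:R * z ^+ n @[n --> \oo] --> (0 : R).
Proof.
move=> /andP[z0 z1].
pose y := Num.sqrt z.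
have y0 : 0 <= y by rewrite sqrtr_ge0.
have yz : y ^+ 2 = z by rewrite sqr_sqrtr.
have y1 : y < 1 by rewrite -(@ltr_pXn2r _ 2)// ?nnegrE// yz expr1n.
have gy : (1 - y)^-1 * y ^+ n @[n --> \oo] --> (0 : R).
  by apply: cvg_geometric; rewrite ger0_norm.
apply: (@squeeze_cvgr _ _ _ _ (fun=> 0) (fun n => (1 - y)^-1 * y ^+ n)); [|exact: cvg_cst|exact: gy].
near=> n; rewrite mulr_ge0 ?exprn_ge0//= -yz -exprM mulnC exprM expr2 mulrA.
rewrite ler_wpM2r ?exprn_ge0// -(ler_pM2r (_ : 0 < 1 - y)) ?subr_gt0//.
rewrite mulVf ?gt_eqF ?subr_gt0//.
have [->|yn0] := eqVneq y 0.
  rewrite expr0n; case: (eqVneq n 0%N) => [->|_]; first by rewrite !mul0r ler01.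
  by rewrite mulr0 mul0r ler01.
have yp : 0 < y by rewrite lt_neqAle eq_sym yn0.
have h : -1 <= y^-1 - 1 by rewrite -[leLHS]add0r lerD2r invr_ge0.
have := bernoulli_ge n h; rewrite (_ : 1 + (y^-1 - 1) = y^-1) => [h2|]; last by ring.
have : n%:R * (y^-1 - 1) <= y^-1 ^+ n by lra.
rewrite -(ler_pM2r (exprn_gt0 n yp)) -exprMn mulVf// expr1n => h3.
have e : n%:R * (y^-1 - 1) * y ^+ n * y = n%:R * y ^+ n * (1 - y) by field.
by rewrite -e; nra.
Unshelve. all: by end_near. Qed.

Definition step (n : nat) (x : R) : R := (1 - x ^+ n) ^+ (n * 2 ^ n).

Lemma step01 n x : 0 <= x <= 1 -> 0 <= step n x <= 1.
Proof.
move=> /andP[x0 x1]; have h : 0 <= 1 - x ^+ n by rewrite subr_ge0 exprn_ile1.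
by rewrite exprn_ge0//= exprn_ile1// gerBl exprn_ge0.
Qed.

(* The elementary approximate step function of Brosowski and Deutsch; the extra *)
(* factor n in the exponent makes the limit vanish at 1/2 as well.              *)
Lemma step_cvg x : 0 <= x <= 1 -> step n x @[n --> \oo] --> ((x < 2^-1)%R%:R : R).
Proof.
move=> /andP[x0 x1]; have [xh|xh] := ltP x 2^-1.
  have hz : 0 <= 2 * x < 1 by apply/andP; split; lra.
  apply: (@squeeze_cvgr _ _ _ _ (fun n => 1 - n%:R * (2 * x) ^+ n) (fun=> 1));
    [|rewrite -[X in _ --> X]subr0; apply: cvgB; [exact: cvg_cst|exact: cvg_natr_geometric]|exact: cvg_cst].
  near=> n; rewrite (andP (step01 n _)).2 ?x0//= andbT /step.
  have h : -1 <= - x ^+ n by rewrite lerN2 exprn_ile1.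
  apply: le_trans (bernoulli_ge (n * 2 ^ n) h).
  by rewrite natrM natrX exprMn mulrN mulrA.
apply: (@squeeze_cvgr _ _ _ _ (fun=> 0) (fun n => n.+1%:R^-1)); [|exact: cvg_cst|exact: cvg_harmonic].
near=> n; rewrite (andP (step01 n _)).1 ?x0//=.
pose y : R := 2^-1 ^+ n.
have y0 : 0 < y by rewrite exprn_gt0.
have xn : y <= x ^+ n by apply: lerXn2r; rewrite ?nnegrE ?invr_ge0.
have y1 : y <= 1 by rewrite exprn_ile1//; lra.
(* With m = n 2^n and y = 2^-n: (1 - y)(1 + y) <= 1 gives (1 - y)^m <= (1 + y)^-m <= 1 / (1 + m y),
   and m y = n. *)
apply: (@le_trans _ _ ((1 - y) ^+ (n * 2 ^ n))).
  apply: lerXn2r; rewrite ?nnegrE ?subr_ge0//; first exact: exprn_ile1.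
  by rewrite lerD2l lerN2.
apply: (@le_trans _ _ ((1 + y)^-1 ^+ (n * 2 ^ n))).
  apply: lerXn2r; rewrite ?nnegrE ?subr_ge0 ?invr_ge0//; first by lra.
  by rewrite -[leRHS]mul1r ler_pdivlMr; [have := sqr_ge0 y; rewrite expr2; lra|lra].
rewrite exprVn lef_pV2 ?posrE ?exprn_gt0//; last by lra.
have h : -1 <= y by lra.
apply: le_trans (bernoulli_ge (n * 2 ^ n) h).
rewrite natrM natrX -mulrA /y -exprMn mulfV ?expr1n ?mulr1; last by lra.
by rewrite -natr1 addrC.
Unshelve. all: by end_near. Qed.

End step_function.

(** * A function orthogonal to all waves vanishes almost everywhere *)

Section trigonometric_completeness.
Variables (R : realType) (q : nat) (T : 'rV[R]_q.+1).
Hypothesis hT : forall i, 0 < T 0 i.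
Local Notation p := q.+1.
Local Notation mu := (@lebesgue_rV R q.+1).
Local Notation D := (box T).
Local Notation ip := (ip mu D).
Implicit Types (g h : 'rV[R]_p -> R) (s : tpoly R p).

Definition is_trig g := exists s, forall t, g t = ev T s t.

Lemma is_trig_cst a : is_trig (fun=> a).
Proof.
exists [:: (0, 0, a)] => t.
by rewrite /ev big_seq1 /wave/= phase0 addr0 cos0 mulr1.
Qed.

Lemma is_trigD g h : is_trig g -> is_trig h -> is_trig (fun t => g t + h t).
Proof. by move=> [s gs] [s' hs']; exists (s ++ s') => t; rewrite ev_cat gs hs'. Qed.

Lemma is_trigZ a g : is_trig g -> is_trig (fun t => a * g t).
Proof. by move=> [s gs]; exists (tscale a s) => t; rewrite ev_tscale gs. Qed.

Lemma phase_add k k' t : phase T (k + k') t = phase T k t + phase T k' t.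
Proof.
rewrite /phase -big_split; apply: eq_bigr => i _.
by rewrite /freq mxE intrD/=; ring.
Qed.

Lemma phase_opp k t : phase T (- k) t = - phase T k t.
Proof. by apply/eqP; rewrite -addr_eq0 -phase_add addNr phase0. Qed.

(** The product-to-sum formula for cosines; it makes trigonometric polynomials an algebra, so [step]
    can be applied to them. *)
Lemma is_trig_wave2 w w' : is_trig (fun t => wave T w t * wave T w' t).
Proof.
exists [:: (w.1.1 + w'.1.1, w.1.2 + w'.1.2, w.2 * w'.2 / 2);
           (w.1.1 - w'.1.1, w.1.2 - w'.1.2, w.2 * w'.2 / 2)] => t.
rewrite /ev big_cons big_seq1 /wave/= !phase_add phase_opp.
set A := phase T w.1.1 t; set B := phase T w'.1.1 t.
rewrite (_ : A + B + _ = (A + w.1.2) + (B + w'.1.2)); last by ring.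
rewrite (_ : A - B + _ = (A + w.1.2) - (B + w'.1.2)); last by ring.
set X := A + w.1.2; set Y := B + w'.1.2.
by rewrite (cosD X Y) (cosB X Y); field.
Qed.

Lemma is_trigM g h : is_trig g -> is_trig h -> is_trig (fun t => g t * h t).
Proof.
move=> [s gs] [s' hs']; under eq_fun do rewrite gs hs'.
elim: s {gs} => [|w s IH].
  by under eq_fun do rewrite /ev big_nil mul0r; exact: is_trig_cst.
under eq_fun do rewrite /ev big_cons mulrDl -!/(ev T _ _).
apply: is_trigD => //.
elim: s' {hs' IH} => [|w' s' IH].
  by under eq_fun do rewrite /ev big_nil mulr0; exact: is_trig_cst.
under eq_fun do rewrite /ev big_cons mulrDr -!/(ev T _ _).
by apply: is_trigD => //; exact: is_trig_wave2.
Qed.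

Lemma is_trigX g m : is_trig g -> is_trig (fun t => g t ^+ m).
Proof.
move=> tg; elim: m => [|m IH]; first exact: is_trig_cst.
by under eq_fun do rewrite exprS; exact: is_trigM.
Qed.

Lemma is_trig_prod (I : Type) (r : seq I) (G : I -> 'rV[R]_p -> R) :
  (forall i, is_trig (G i)) -> is_trig (fun t => \prod_(i <- r) G i t).
Proof.
move=> tG; elim: r => [|i r IH].
  by under eq_fun do rewrite big_nil; exact: is_trig_cst.
by under eq_fun do rewrite big_cons; exact: is_trigM.
Qed.

Lemma is_trig_step m g : is_trig g -> is_trig (fun t => step m (g t)).
Proof.
move=> tg; apply: is_trigX; under eq_fun do rewrite -mulN1r.
apply: is_trigD; first exact: is_trig_cst.
by apply: is_trigZ; exact: is_trigX.
Qed.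

(** For 0 < c < T_i, [step] is applied to a trigonometric polynomial with values in [0, 1] that
    inside the box is below 1/2 exactly when t_i < c. *)
Lemma trig_indicator i (c : R) : exists r : nat -> 'rV[R]_p -> R,
  [/\ forall m, is_trig (r m), forall m t, 0 <= r m t <= 1 &
      forall t : 'rV[R]_p, 0 < t 0 i < T 0 i -> r m t @[m --> \oo] --> ((t 0 i < c)%R%:R : R)].
Proof.
have [c0|c0] := leP c 0.
  exists (fun _ _ => 0); split => [m|m t|t /andP[t0 _]]; first exact: is_trig_cst.
    by rewrite lexx ler01.
  by rewrite ltNge (le_trans c0 (ltW t0)); exact: cvg_cst.
have [cT|cT] := leP (T 0 i) c.
  exists (fun _ _ => 1); split => [m|m t|t /andP[_ tT]]; first exact: is_trig_cst.
    by rewrite lexx ler01.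
  by rewrite (lt_le_trans tT cT); exact: cvg_cst.
pose al := pi * c / T 0 i.
pose x (t : 'rV[R]_p) := 2^-1 + 4^-1 * (cos al - cos (2 * pi / T 0 i * t 0 i - al)).
have Ti := hT i.
have x01 t : 0 <= x t <= 1.
  have := cos_geN1 al; have := cos_le1 al.
  have := cos_geN1 (2 * pi / T 0 i * t 0 i - al).
  have := cos_le1 (2 * pi / T 0 i * t 0 i - al).
  by rewrite /x; lra.
have tx : is_trig x.
  apply: is_trigD; first exact: is_trig_cst.
  apply: is_trigZ; apply: is_trigD; first exact: is_trig_cst.
  exists [:: (delta_mx 0 i, - al, -1)] => t.
  rewrite /ev big_seq1 /wave/= mulN1r /phase (bigD1 i)//= big1 ?addr0.
    by rewrite /freq mxE !eqxx mulr1.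
  by move=> j ji; rewrite /freq mxE (negbTE ji) andbF mulr0 !mul0r.
exists (fun m t => step m (x t)); split.
- by move=> m; exact: is_trig_step.
- by move=> m t; exact: step01.
move=> t /andP[t0 tT]; have -> : (t 0 i < c) = (x t < 2^-1); last exact: step_cvg.
(* As al = u + v, x t = 1/2 - sin u sin v / 2. Inside the box sin u > 0, and sin v > 0 exactly when
   t_i < c. *)
pose u := pi / T 0 i * t 0 i; pose v := pi / T 0 i * (c - t 0 i).
have -> : x t = 2^-1 - 2^-1 * (sin u * sin v).
  rewrite /x.
  have -> : cos al = cos u * cos v - sin u * sin v.
    by rewrite -cosD; congr cos; rewrite /al /u /v; field; rewrite gt_eqF.
  have -> : cos (2 * pi / T 0 i * t 0 i - al) = cos u * cos v + sin u * sin v.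
    by rewrite -cosB; congr cos; rewrite /al /u /v; field; rewrite gt_eqF.
  by field.
rewrite gtrBl pmulr_rgt0 ?invr_gt0//.
have pT : 0 < pi / T 0 i by rewrite divr_gt0// pi_gt0.
have pTT : pi / T 0 i * T 0 i = pi by rewrite divfK// gt_eqF.
rewrite pmulr_rgt0; last first.
  by apply: sin_gt0_pi; rewrite /u mulr_gt0//= -[ltRHS]pTT ltr_pM2l.
have [tc|ct] := ltP (t 0 i) c.
  apply/esym/sin_gt0_pi; rewrite /v mulr_gt0 ?subr_gt0//= -[ltRHS]pTT ltr_pM2l//; lra.
apply/esym/negbTE; rewrite -leNgt.
rewrite (_ : v = - (pi / T 0 i * (t 0 i - c))) ?sinN ?oppr_le0; last by rewrite /v; ring.
move: ct; rewrite le_eqVlt => /predU1P[->|ct]; first by rewrite subrr mulr0 sin0.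
by apply/ltW/sin_gt0_pi; rewrite mulr_gt0 ?subr_gt0//= -[ltRHS]pTT ltr_pM2l//; lra.
Qed.

Lemma box_interior_ae :
  {ae mu, forall t, D t -> forall i, 0 < t 0 i < T 0 i}.
Proof.
have nul (i : 'I_p) (c : R) : mu.-negligible [set t : 'rV[R]_p | t 0 i = c].
  pose A (j : 'I_p) : set R := if j == i then [set c] else setT.
  have mA j : measurable (A j) by rewrite /A; case: ifP.
  have E : [set t : 'rV[R]_p | t 0 i = c] = [set t | forall j, A j (t ord0 j)].
    apply/seteqP; split => t /=.
      by move=> tc j; rewrite /A; case: ifPn => // /eqP ->.
    by move=> /(_ i); rewrite /A eqxx.
  rewrite E; apply/negligibleP; first exact: measurable_box_prod.
  apply: eq_trans (lebesgue_rV_prod mA) _.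
  by rewrite (bigD1 i)//= {1}/A eqxx lebesgue_measure_set1 mul0e.
apply: (@negligibleS _ _ _ mu
  (\big[setU/set0]_(i < p) ([set t | t 0 i = 0] `|` [set t | t 0 i = T 0 i]))).
  move=> t /= ht; apply: contrapT => h; apply: ht => Dt i.
  have /andP[h0 h1] := Dt i; rewrite !lt_neqAle h0 h1 !andbT; apply/andP; split.
    apply/eqP => e; apply: h; rewrite -bigcup_seq; exists i; first by rewrite /= mem_index_enum.
    by left.
  apply/eqP => e; apply: h; rewrite -bigcup_seq; exists i; first by rewrite /= mem_index_enum.
  by right.
by elim/big_ind : _ => [|A B|i _]; [exact: negligible_set0|exact: negligibleU|
  by apply: negligibleU; exact: nul].
Qed.

(** Open lower orthants: a pi-system generating the Borel sets, whose indicators are, inside the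
    box, limits of products of the polynomials of [trig_indicator]. *)
Let G : set (set 'rV[R]_p) :=
  [set A | exists c : 'I_p -> R, A = [set t : 'rV[R]_p | forall i, t 0 i < c i]].

Let measurable_G : measurable `<=` <<s G >>.
Proof.
have coordG i : @measurable_fun _ _ (g_sigma_algebraType G) R setT
    (fun t : 'rV[R]_p => t 0 i).
  apply: (measurability _ (RGenInftyO.measurableE R)) => // _ [_ [c ->] <-].
  rewrite setTI; apply: (_ : <<s G >> _).
  rewrite (_ : _ @^-1` _ = \bigcup_m
      [set t : 'rV[R]_p | forall j, t 0 j < if j == i then c else m%:R]).
    have sG : sigma_algebra setT <<s G >> by exact: smallest_sigma_algebra.
    case: sG => _ _; apply => m; apply: sub_sigma_algebra.
    by exists (fun j => if j == i then c else m%:R).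
  apply/seteqP; split => t /=; rewrite in_itv/=.
    move=> tc; pose M := \sum_j `|t 0 j|.
    exists (Num.truncn M).+1 => // j /=; case: ifP => [/eqP ->//|_].
    apply: le_lt_trans (truncnS_gt M).
    by rewrite (le_trans (ler_norm _))// /M (bigD1 j)//= lerDl sumr_ge0.
  by move=> [m _ /(_ i)]; rewrite eqxx.
apply: smallest_sub; first exact: smallest_sigma_algebra.
move=> C; rewrite -bigcup_seq => -[/= j _ [Y mY <-]].
exact: (coordG j measurableT Y mY).
Qed.

Variable f : 'rV[R]_p -> R.
Hypothesis sf : sqi mu D f.
Hypothesis f_orth : forall k a, ip f (wave T (k, a, 1)) = 0.

Let mf : measurable_fun D f := sqi_meas sf.
Let itf : itg mu D f.
Proof. exact: sqi_itg. Qed.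

Lemma trig_orth g : is_trig g -> ip f g = 0.
Proof.
move=> [s gs]; have sw w : sqi mu D (wave T w).
  rewrite (_ : wave T w = ev T [:: w]); first exact: sqi_ev.
  by apply/funext => t; rewrite /ev big_seq1.
rewrite (@eq_ip _ _ _ mu D f f g (fun t => \sum_(w <- s) wave T w t)) => [|//|t _]; last exact: gs.
rewrite ip_sumr// big1_seq// => w _.
rewrite -[RHS](mulr0 w.2) -(f_orth w.1.1 w.1.2) -ipZr//.
by apply: eq_ip => t _//; rewrite /wave/= mul1r.
Qed.

Lemma orth_dominated (g : nat -> 'rV[R]_p -> R) (h : 'rV[R]_p -> R) :
  (forall m, measurable_fun D (g m)) -> measurable_fun D h ->
  (forall m t, `|g m t| <= 1) ->
  {ae mu, forall t, D t -> g m t @[m --> \oo] --> h t} ->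
  (forall m, ip f (g m) = 0) -> ip f h = 0.
Proof.
move=> mg mh g1 gh g0.
have [_ _ H] := @dominated_convergence _ _ _ mu D (@measurable_box R _ T)
  (fun m t => (f t * g m t)%:E) (fun t => (f t * h t)%:E) (fun t => `|f t|%:E)
  (fun m => (measurable_EFinP _ _).2 (measurable_funM mf (mg m)))
  ((measurable_EFinP _ _).2 (measurable_funM mf mh))
  ltac:(by apply: filterS gh => t + Dt => /(_ Dt) ght; apply: cvg_EFin;
        [exact: nearW|apply: cvgM => //; exact: cvg_cst])
  (integrable_norm itf)
  ltac:(by apply: aeW => t m Dt; rewrite lee_fin normrM ler_piMr).
rewrite /ip /Rintegral -(cvg_lim _ H)//.
rewrite (_ : [sequence _]_m = fun=> 0%E) ?lim_cst//.
apply/funext => m /=.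
have i : itg mu D (fun t => f t * g m t).
  apply: (itg_le (@measurable_box R _ T) _ _ (itg_norm itf)).
    exact: measurable_funM.
  by move=> t _; rewrite normrM ler_piMr.
by rewrite Rint_EFin// -/(ip f (g m)) g0.
Qed.

Lemma ip_indic A : measurable A ->
  (\int[mu]_(t in D `&` A) (f t)%:E)%E = (ip f \1_A)%:E.
Proof.
move=> mA; rewrite /ip -Rint_EFin//; last first.
  apply: (itg_le (@measurable_box R _ T) _ _ (itg_norm itf)).
    by apply: measurable_funM => //; exact: measurable_indic.
  move=> t _; rewrite normrM ler_piMr// indicE.
  by case: (t \in A); rewrite ?normr1 ?normr0.
rewrite integral_mkcondr; apply: eq_integral => t _; rewrite patchE indicE.
by case: (t \in A); rewrite ?mulr1 ?mulr0.
Qed.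

(** Dynkin's argument: the Borel sets whose indicator is orthogonal to f form a lambda-system, which
    contains the orthants by dominated convergence. *)
Lemma indic_orth A : measurable A -> ip f \1_A = 0.
Proof.
move=> mA; suff : (measurable `&` [set B | ip f \1_B = 0]) A by case.
apply: (@lambda_system_subset _ G _ setT (measurable `&` [set B | ip f \1_B = 0])) => //.
- move=> _ _ [c ->] [c' ->]; exists (fun i => Num.min (c i) (c' i)).
  apply/seteqP; split => t /=.
    by move=> [h h'] i; rewrite lt_min h h'.
  by move=> h; split => i; have := h i; rewrite lt_min => /andP[].
- split.
  + by [].
  + split => //; apply: trig_orth; rewrite indicT; exact: is_trig_cst.
  + move=> B C CB [mB B0] [mC C0]; split; first exact: measurableD.
    have s E : measurable E -> sqi mu D \1_E.
      move=> mE; apply: (@sqi_bounded _ _ _ _ _ (@measurable_box R _ T) (@box_lty R _ T) _ 1).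
        exact: measurable_indic.
      by move=> t _; rewrite indicE; case: (t \in E); rewrite ?normr1 ?normr0.
    change (ip f \1_(B `\` C) = 0).
    rewrite (@eq_ip _ _ _ mu D f f _ (fun t => \1_B t - \1_C t)) => [|//|t _].
      by rewrite ipBr//; [rewrite B0 C0 subrr|exact: s|exact: s].
    rewrite !indicE in_setD; have [tC|tC] := boolP (t \in C).
      by rewrite (mem_set (CB _ (set_mem tC))) /= subrr.
    by rewrite andbT subr0.
  + move=> F ndF hF; have mF i : measurable (F i) by case: (hF i).
    split; first exact: bigcupT_measurable.
    apply: (@orth_dominated (fun m => \1_(F m))).
    * by move=> m; exact: measurable_indic.
    * by apply: measurable_indic; exact: bigcupT_measurable.
    * by move=> m t; rewrite indicE; case: (t \in F m); rewrite ?normr1 ?normr0.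
    * apply: aeW => t _; have [[m _ Fm]|nF] := pselect ((\bigcup_i F i) t).
        rewrite indicE mem_set; last by exists m.
        apply: cvg_near_cst; exists m => // m' /= mm'.
        by rewrite indicE mem_set//; have /subsetPset := ndF _ _ mm'; apply.
      rewrite indicE memNset//; apply: cvg_near_cst; apply: nearW => m.
      by rewrite indicE memNset// => Fm; apply: nF; exists m.
    * by move=> m; case: (hF m).
- move=> _ [c ->].
  have mB : measurable [set t : 'rV[R]_p | forall i, t 0 i < c i].
    have -> : [set t : 'rV[R]_p | forall i, t 0 i < c i] =
        [set t | forall i, `]-oo, c i[%classic (t ord0 i)].
      by apply/seteqP; split => t /= h i; have := h i; rewrite in_itv.
    exact: (@measurable_box_prod R p (fun i => `]-oo, c i[%classic)).
  split => //.
  have [r hr] := choice (fun i => trig_indicator i (c i)).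
  apply: (@orth_dominated (fun m t => \prod_i r i m t)).
  + move=> m; have tr i : is_trig (r i m) by have [] := hr i.
    have [s hs] := is_trig_prod (index_enum 'I_p) tr.
    rewrite (_ : (fun _ => _) = ev T s); first exact: sqi_meas (sqi_ev _ _).
    by apply/funext => t; rewrite hs.
  + exact: measurable_indic.
  + move=> m t; suff /andP[h0 h1] : 0 <= \prod_i r i m t <= 1 by rewrite ger0_norm.
    elim/big_ind : _ => [|a b /andP[a0 a1] /andP[b0 b1]|i _]; first by rewrite ler01 lexx.
      by rewrite mulr_ge0//= mulr_ile1.
    by have [_ + _] := hr i.
  + apply: filterS box_interior_ae => t + Dt => /(_ Dt) ht.
    have -> : \1_[set t : 'rV[R]_p | forall i, t 0 i < c i] t =
        \prod_i (t 0 i < c i)%R%:R :> R.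
      rewrite indicE; have [/set_mem/= tc|/negP tc] := boolP (t \in _).
        by rewrite big1// => i _; rewrite tc.
      have [i /negbTE h] : exists i, ~~ (t 0 i < c i).
        apply: contrapT => h; apply: tc; rewrite inE/= => i.
        by apply: contrapT => /negP h'; apply: h; exists i.
      by rewrite (bigD1 i)//= h mul0r.
    by apply: cvg_big => [|i _]; [exact: mul_continuous|have [_ _] := hr i; apply].
  + by move=> m; apply: trig_orth; apply: is_trig_prod => i; have [h _ _] := hr i.
- exact: measurable_G.
Qed.

Lemma trig_complete : {ae mu, forall t, D t -> f t = 0}.
Proof.
have := @integral_ae_eq _ _ _ mu D (@measurable_box R _ T) (cst 0%E) (EFin \o f) itf.
move=> /(_ (measurable_cst _)) H.
have : ae_eq mu D (EFin \o f) (cst 0%E).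
  apply: H => E ED mE; rewrite integral0.
  by rewrite -(setIidr ED) ip_indic// indic_orth.
by apply: filterS => t + Dt => /(_ Dt)[].
Qed.

End trigonometric_completeness.

(** * Convex functions and growth bounds *)

Section euclidean_norm.
Variables (R : realType) (n : nat).
Implicit Types x y : 'rV[R]_n.

Lemma dotv_ge0 x : 0 <= dotv x x.
Proof. by apply: sumr_ge0 => i _; rewrite -expr2 sqr_ge0. Qed.

Lemma sqr_enorm x : enorm x ^+ 2 = \sum_i x 0 i ^+ 2.
Proof. by rewrite sqr_sqrtr ?dotv_ge0//; apply: eq_bigr => i _; rewrite expr2. Qed.

Lemma enorm_ge0 x : 0 <= enorm x. Proof. exact: sqrtr_ge0. Qed.

Lemma coord_le_enorm x i : `|x 0 i| <= enorm x.
Proof.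
rewrite -(@ler_pXn2r _ 2) ?nnegrE ?enorm_ge0// sqr_enorm real_normK ?num_real//.
by rewrite (bigD1 i)//= lerDl sumr_ge0// => j _; exact: sqr_ge0.
Qed.

Lemma enorm_le_sum x : enorm x <= \sum_i `|x 0 i|.
Proof.
rewrite -(@ler_pXn2r _ 2) ?nnegrE ?enorm_ge0 ?sumr_ge0// sqr_enorm expr2 mulr_suml.
apply: ler_sum => i _; rewrite -real_normK ?num_real// expr2 ler_wpM2l//.
by rewrite (bigD1 i)//= lerDl sumr_ge0.
Qed.

Lemma rV_sum_basis x : x = \sum_i x 0 i *: basis_vec R i.
Proof.
apply/rowP => j; rewrite summxE (bigD1 j)//= big1 ?addr0.
  by rewrite !mxE !eqxx mulr1.
by move=> m mj; rewrite !mxE eqxx eq_sym (negbTE mj) mulr0.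
Qed.

Lemma derive_grad (f : 'rV[R]_n -> R) x v : differentiable f x ->
  'D_v f x = dotv (grad f x) v.
Proof.
move=> df; rewrite deriveE// [in LHS](rV_sum_basis v) linear_sum.
by apply: eq_bigr => i _; rewrite linearZ/= mxE deriveE// mulrC.
Qed.

(** A sequential form of the directional derivative, so that results on sequences apply, such as
    measurability of pointwise limits. *)
Lemma derive_seq (f : 'rV[R]_n -> R) x v : derivable f x v ->
  k.+1%:R * (f (x + k.+1%:R^-1 *: v) - f x) @[k --> \oo] --> 'D_v f x.
Proof.
move=> df.
have h0 : k.+1%:R^-1 @[k --> \oo] --> (0 : R)^'.
  move=> A hA; suff : \forall k \near \oo, A (k.+1%:R^-1) by [].
  have : \forall k \near \oo, k.+1%:R^-1 != 0 :> R -> A (k.+1%:R^-1).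
    exact: (@cvg_harmonic R _ hA).
  by apply: filterS => k; apply; rewrite invr_eq0 pnatr_eq0.
rewrite (_ : (fun k : nat => _) = (fun h => h^-1 *: ((f \o shift x) (h *: v) - f x)) \o
    (fun k : nat => k.+1%:R^-1)).
  exact: (cvg_comp _ _ h0 df).
by apply/funext => k /=; rewrite invrK (addrC x).
Qed.

(** By convexity the difference quotients of f at x along y - x are at most f y - f x; the bound
    passes to the limit. *)
Lemma convex_grad_le (f : 'rV[R]_n -> R) x y : differentiable f x ->
  convex_function (E := 'rV[R]_n) [set: 'rV[R]_n] f ->
  f x + dotv (grad f x) (y - x) <= f y.
Proof.
move=> df cf; rewrite -derive_grad// addrC -lerBrDr.
have h := derive_seq (@diff_derivable _ _ _ _ _ (y - x) df).
apply: (cvgr_to_le h); apply: nearW => k.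
have k0 : 0 < k.+1%:R :> R by rewrite ltr0n.
pose c : R := k.+1%:R^-1; have k01 : 0 <= c <= 1.
  by rewrite /c invr_ge0 (ltW k0)/= invf_le1// ler1n.
have /andP[l0 l1] := k01; pose l : {i01 R} := Itv01 l0 l1.
have := cf l y x (in_setT _) (in_setT _).
rewrite /conv/= /conv/= /unstable.onem => hc.
have e : l%:num *: y + (1 - l%:num) *: x = x + k.+1%:R^-1 *: (y - x).
  by rewrite scalerBl scale1r scalerBr addrCA.
have {}hc : f (x + k.+1%:R^-1 *: (y - x)) <= k.+1%:R^-1 * f y + (1 - k.+1%:R^-1) * f x.
  by rewrite -e.
rewrite -(ler_pM2l (_ : 0 < k.+1%:R^-1)) ?invr_gt0// mulKf ?gt_eqF//.
by rewrite mulrBr lerBlDr -addrA (addrC (- _)); rewrite mulrBl mul1r in hc.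
Qed.

End euclidean_norm.

Section affine_growth.
Variables (R : realType) (a da : R -> R) (M : R).
Hypotheses (ha : C1_Rplus a da) (hM : forall s : R, 0 <= s -> da s <= M).

Let quotient (x e : R) : 0 <= x -> 0 < e -> \forall r \near x, r != x -> 0 <= r ->
  `|da x - (a r - a x) / (r - x)| < e.
Proof. by move=> x0 e0; have /cvgrPdist_lt/(_ e e0) := ha.1 x x0. Qed.

Let derivable_a (x : R) : 0 < x -> is_derive x 1 a (da x).
Proof.
move=> x0.
have cv : h^-1 *: ((a \o shift x) (h *: 1) - a x) @[h --> 0^'] --> da x.
  apply/cvgrPdist_lt => e e0.
  have h1 := quotient (ltW x0) e0.
  have h2 : \forall r \near x, r != x -> `|da x - (a r - a x) / (r - x)| < e.
    near=> r; move=> rx; apply: (near h1 r) => //; apply: ltW.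
    by near: r; exact: lt_nbhsr.
  move/nbhs0P : h2 => h2.
  suff : nbhs (0 : R) (fun h => h != 0 ->
    `|da x - h^-1 *: ((a \o shift x) (h *: 1) - a x)| < e) by [].
  apply: filterS h2 => h hh h0.
  have := hh; rewrite /= addrAC subrr add0r mulrC -[X in x + X]mulr1 (addrC x).
  by apply; rewrite -subr_eq0 addrK mulr1.
by split; [apply/cvg_ex; exists (da x)|exact: cvg_lim].
Unshelve. all: by end_near. Qed.

Let continuous_at_a (x : R) : 0 < x -> a @ x --> a x.
Proof.
move=> x0; apply: differentiable_continuous; apply/derivable1_diffP.
by have [] := derivable_a x0.
Qed.

Let right_continuous_a : a @ 0^'+ --> a 0.
Proof.
have h1 := quotient (lexx 0) ltr01; set c := `|da 0| + 1.
have c0 : 0 < c by rewrite ltr_wpDl.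
apply/cvgrPdist_le => e e0.
have h2 : \forall r \near 0^'+, r != 0 -> 0 <= r -> `|da 0 - (a r - a 0) / (r - 0)| < 1.
  exact: cvg_within.
near=> r; have r0 : 0 < r by [].
have hr : `|da 0 - (a r - a 0) / (r - 0)| < 1.
  by apply: (near h2 r) => //; rewrite ?gt_eqF ?ltW.
have re : r <= e / c by near: r; apply: nbhs_right_le; rewrite divr_gt0.
rewrite distrC; apply: (@le_trans _ _ (c * r)); last by rewrite mulrC -ler_pdivlMr.
rewrite -ler_pdivrMr// -[X in _ / X](gtr0_norm r0) -normf_div.
rewrite -[X in `|X|](subrK (da 0)) addrC (le_trans (ler_normD _ _))// lerD2l.
by move: hr; rewrite subr0 distrC => /ltW.
Unshelve. all: by end_near. Qed.

(** The mean value theorem on [0, s]. The derivative at 0 is one-sided, so that end point is covered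
    by right continuity. *)
Lemma affine_growth (s : R) : 0 <= s -> a s <= a 0 + M * s.
Proof.
rewrite le_eqVlt => /predU1P[<-|s0]; first by rewrite mulr0 addr0.
have [c] : exists2 c, c \in `]0, s[ & a s - a 0 = da c * (s - 0).
  apply: MVT => //.
    by move=> x; rewrite in_itv/= => /andP[x0 _]; exact: derivable_a.
  apply/(continuous_within_itvP _ s0); split.
  - by move=> x; rewrite in_itv/= => /andP[x0 _]; exact: continuous_at_a.
  - exact: right_continuous_a.
  - by apply: cvg_at_left_filter; exact: continuous_at_a.
rewrite in_itv/= => /andP[c0 cs] /eqP; rewrite subr_eq subr0 addrC => /eqP ->.
by rewrite lerD2l ler_wpM2r ?hM// ltW.
Qed.

End affine_growth.

(** * Borel version of the potential *)

Section null_modification.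
Context d (X : measurableType d) (R : realType) (mu : {measure set X -> \bar R}).
Import HBNNSimple.

(* No measurability is assumed: the integral of a nonnegative function is the *)
(* supremum of the integrals of the simple functions below it.                *)
Lemma integral_eq_off_null (D N : set X) (f g : X -> \bar R) :
  measurable N -> mu N = 0%E -> (forall x, D x -> ~ N x -> f x = g x) ->
  (\int[mu]_(x in D) f x = \int[mu]_(x in D) g x)%E.
Proof.
move=> mN N0 fg.
have le (u v : X -> \bar R) : (forall x, 0 <= u x)%E -> (forall x, 0 <= v x)%E ->
    (forall x, ~ N x -> u x = v x) -> (\int[mu]_x u x <= \int[mu]_x v x)%E.
  move=> u0 v0 uv; rewrite !ge0_integralTE//.
  apply/ge_ereal_sup => _ [h /= hu <-].
  have mC : measurable (~` N) by exact: measurableC.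
  have hC x : proj_nnsfun h mC x = if x \in ~` N then h x else 0.
    by rewrite -[LHS]/((proj_nnsfun h mC : X -> R) x) -mrestrict patchE.
  have -> : sintegral mu h = sintegral mu (proj_nnsfun h mC).
    rewrite -!integralT_nnsfun; apply: ae_eq_integral => //.
    - exact/measurable_EFinP.
    - exact/measurable_EFinP.
    exists N; split => // x /= /not_implyP[_ hx]; apply: contrapT => nN; apply: hx.
    by have := hC x; rewrite mem_set// => e; rewrite -[in LHS]e.
  apply: ereal_sup_ubound; exists (proj_nnsfun h mC) => // x.
  rewrite hC; have [Nx|nNx] := pselect (N x); first by rewrite memNset//; exact.
  by rewrite mem_set// -uv.
have eq (u v : X -> \bar R) : (forall x, 0 <= u x)%E -> (forall x, 0 <= v x)%E ->
    (forall x, ~ N x -> u x = v x) -> (\int[mu]_x u x = \int[mu]_x v x)%E.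
  by move=> u0 v0 uv; apply/eqP; rewrite eq_le !le// => x /uv.
have fgD x : ~ N x -> (f \_ D) x = (g \_ D) x.
  by move=> nN; rewrite !patchE; case: ifPn => // /set_mem Dx; exact: fg.
rewrite integral_mkcond [RHS]integral_mkcond integralE [RHS]integralE; congr (_ - _)%E.
  by apply: eq => x //; rewrite !funeposE => /fgD ->.
by apply: eq => x //; rewrite !funenegE => /fgD ->.
Qed.

Lemma negligible_bigcup_count (I : countType) (F : I -> set X) :
  (forall i, mu.-negligible (F i)) ->
  mu.-negligible (\bigcup_(i in [set: I]) F i).
Proof.
move=> hF; pose H k := if @unpickle I k is Some i then F i else set0.
apply: (@negligibleS _ _ _ mu (\bigcup_k H k)).
  by move=> x [i _ Fi]; exists (pickle i) => //; rewrite /H pickleK.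
apply: negligible_bigcup => k; rewrite /H; case: unpickle => [i|]; first exact: hF.
exact: negligible_set0.
Qed.

(** For each rational r the set of x in D with r < f x agrees with a Borel set off a Borel null set.
    Off the union N of these countably many null sets, all superlevel sets of f are Borel. *)
Lemma completion_modification (D : set X) (f : X -> R) : measurable D ->
  (forall Y, measurable Y -> completed_algebra_gen mu (D `&` f @^-1` Y)) ->
  exists N, [/\ measurable N, mu N = 0%E &
    measurable_fun setT (fun x => if x \in D `\` N then f x else 0)].
Proof.
move=> mD hf.
have /choice[A hA] : forall r : rat, exists A : set X * set X,
    [/\ measurable A.1, measurable A.2, mu A.2 = 0%E &
    forall x, ~ A.2 x -> (D x /\ ratr r < f x) <-> A.1 x].
  move=> r; have [A mA [M [B [mB B0 MB]] AM]] := hf _ (measurable_itv `]ratr r, +oo[).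
  exists (A, B); split => // x nB.
  have E : (D `&` f @^-1` `]ratr r, +oo[) x <-> (A `|` M) x by rewrite AM.
  split.
    move=> [Dx rx]; have [] : (A `|` M) x; [|by []|by move=> /MB].
    by apply/E; split => //=; rewrite in_itv/= rx.
  move=> Ax; have [Dx /=] : (D `&` f @^-1` `]ratr r, +oo[) x by apply/E; left.
  by rewrite in_itv/= andbT.
pose N := \bigcup_(r in [set: rat]) (A r).2.
have mN : measurable N.
  by apply: countable_bigcupT_measurable => // r; have [] := hA r.
have N0 : mu N = 0%E.
  apply/negligibleP => //.
  by apply: negligible_bigcup_count => r; have [_ m z _] := hA r; apply/negligibleP.
exists N; split => //.
apply: (measurability _ (RGenOInfty.measurableE R)) => // _ [_ [r ->] <-].
rewrite setTI.
have mDN : measurable (D `\` N) by exact: measurableD.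
(* A superlevel set is a union over rational levels s > r; for r < 0 it also contains the points
   where the modified function takes its default value 0. *)
rewrite (_ : _ @^-1` _ =
  (\bigcup_(s in [set s : rat | r < ratr s]) ((A s).1 `\` N)) `|`
  (if r < 0 then ~` (D `\` N) else set0)).
  apply: measurableU; last by case: ifP => _ //; exact: measurableC.
  rewrite bigcup_mkcond; apply: countable_bigcupT_measurable => // s.
  by case: ifP => // _; apply: measurableD => //; have [] := hA s.
apply/seteqP; split => x /=; rewrite in_itv/= andbT.
  case: ifPn => [/set_mem[Dx nN] rf|/negP]; last first.
    by rewrite inE => h r0; right; rewrite r0.
  left; have [s] := rat_in_itvoo rf; rewrite in_itv/= => /andP[rs sf].
  exists s => //; split => //; have [_ _ _ h] := hA s.
  by apply/h => // As; apply: nN; exists s.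
move=> [[s rs [As nN]]|].
  have [_ _ _ /(_ x) h] := hA s.
  have [|Dx sf] := (h _).2 As; first by move=> A2; apply: nN; exists s.
  by rewrite mem_set//; exact: lt_trans sf.
by case: ifPn => // r0 nDN; rewrite memNset.
Qed.

End null_modification.

Section borel_version.
Variables (R : realType) (p n : nat) (T : 'rV[R]_p).
Local Notation mu := (@lebesgue_rV R p).
Local Notation D := (box T).

(** The properties of the potential on which the minimization rests. Convexity is kept as the
    gradient inequality, and the two growth bounds are affine in the l^1 norm. *)
Record convex_integrand (G : 'rV[R]_p -> 'rV[R]_n -> R) (K : R) : Prop :=
  ConvexIntegrand {
  ci_meas : forall x, measurable_fun setT (G ^~ x);
  ci_diff : forall t x, differentiable (G t) x;
  ci_grad_cont : forall t, continuous (grad (G t));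
  ci_convex : forall t x y, G t x + dotv (grad (G t) x) (y - x) <= G t y;
  ci_growth : forall t x, D t -> `|G t x| <= K * (1 + \sum_j `|x 0 j|);
  ci_grad_growth : forall t x j, D t ->
    `|grad (G t) x 0 j| <= K * (1 + \sum_j `|x 0 j|);
  ci_coercive : forall M : R, exists r : R, forall x : 'rV[R]_n,
    r <= enorm x -> M <= \int[mu]_(t in D) G t x }.

Variable F : 'rV[R]_p -> 'rV[R]_n -> R.
Hypothesis F_meas : forall x : 'rV[R]_n, Lebesgue_measurable_on D (fun t => F t x).
Hypothesis F_C1 : forall t, D t -> class_C1 (F t).
Variables a da : R -> R.
Hypothesis a_C1 : C1_Rplus a da.
Hypothesis a_ge0 : forall s : R, 0 <= s -> 0 <= a s.
Hypothesis da_bounded_above : exists M : R, forall s : R, 0 <= s -> da s <= M.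
Variable b : 'rV[R]_p -> R.
Hypothesis b_cont : {within D, continuous b}.
Hypothesis F_bound : forall t x, D t -> `|F t x| <= a (enorm x) * b t.
Hypothesis gradF_bound : forall t x, D t ->
  enorm (grad (F t) x) <= a (enorm x) * b t.
Hypothesis F_coercive : forall M : R, exists r : R, forall x : 'rV[R]_n,
  r <= enorm x -> M <= \int[mu]_(t in D) F t x.
Hypothesis F_convex : forall t, D t ->
  convex_function (E := 'rV[R]_n) [set: 'rV[R]_n] (F t).

Lemma growth_constant : exists2 K : R, 0 <= K & forall t (x : 'rV[R]_n), D t ->
  a (enorm x) * b t <= K * (1 + \sum_j `|x 0 j|).
Proof.
have [M hM] := da_bounded_above; have [B B0 hB] := box_bounded b_cont.
have a0 := a_ge0 (lexx 0).
exists ((a 0 + `|M|) * B) => [|t x Dt]; first by rewrite mulr_ge0 ?addr_ge0// ltW.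
have e0 := enorm_ge0 x.
have h1 := affine_growth a_C1 hM e0.
have h2 : a (enorm x) <= (a 0 + `|M|) * (1 + \sum_j `|x 0 j|).
  apply: le_trans h1 _; have h3 := enorm_le_sum x.
  have h4 : M * enorm x <= `|M| * \sum_j `|x 0 j|.
    apply: (@le_trans _ _ (`|M| * enorm x)); first by rewrite ler_wpM2r// ler_norm.
    by rewrite ler_wpM2l.
  have h5 : 0 <= \sum_j `|x 0 j| by exact: sumr_ge0.
  have h6 : 0 <= `|M| by [].
  by rewrite mulrDr mulr1 mulrDl; nra.
apply: (@le_trans _ _ (a (enorm x) * B)).
  by rewrite ler_wpM2l ?a_ge0// (le_trans (ler_norm _))// hB.
by rewrite mulrAC ler_wpM2r// ltW.
Qed.

(** F is made Borel in t at the countably many rational grid points, with one null set N for all of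
    them; continuity in x carries measurability to every x. Setting G t = 0 outside D minus N keeps
    convexity, smoothness and growth. *)
Lemma borel_version : exists (G : 'rV[R]_p -> 'rV[R]_n -> R) (K : R) (N : set 'rV[R]_p),
  [/\ mu.-negligible N, forall t, D t -> ~ N t -> G t = F t & convex_integrand G K].
Proof.
have mD : measurable D by [].
have /choice[M hM] : forall mz : nat * 'rV[int]_n, exists M, [/\ measurable M, mu M = 0%E &
    measurable_fun setT (fun t => if t \in D `\` M then F t (gridpt R mz.1 mz.2) else 0)].
  by move=> mz; apply: completion_modification => // Y mY; exact: F_meas.
pose N := \bigcup_(mz in [set: nat * 'rV[int]_n]) M mz.
have mN : measurable N.
  by apply: countable_bigcupT_measurable => // mz; have [] := hM mz.
have N0 : mu N = 0%E.
  apply/negligibleP => //.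
  by apply: negligible_bigcup_count => mz; have [m z _] := hM mz; apply/negligibleP.
pose G t x := if t \in D `\` N then F t x else 0.
have GE t : D t -> ~ N t -> G t = F t.
  by move=> Dt Nt; apply/funext => x; rewrite /G mem_set.
have G0 t : ~ (D `\` N) t -> G t = cst 0.
  by move=> h; apply/funext => x; rewrite /G memNset.
have gradG0 t x : ~ (D `\` N) t -> grad (G t) x = 0.
  by move=> h; rewrite G0//; apply/rowP => i; rewrite !mxE derive_cst.
have Gdiff t x : differentiable (G t) x.
  have [[Dt Nt]|h] := pselect ((D `\` N) t).
    by rewrite GE//; exact: (F_C1 Dt).1.
  by rewrite G0//; exact: differentiable_cst.
have [K K0 hK] := growth_constant.
exists G, K, N; split.
- exact/negligibleP.
- exact: GE.
split.
- move=> x; apply: (@measurable_fun_cvg _ _ _ setT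
    (fun m t => G t (gridpt R m (grid_floor m x)))); last first.
    move=> t _; apply: (cvg_comp (fun m => gridpt R m (grid_floor m x)) (G t)).
      exact: cvg_grid.
    exact/differentiable_continuous/Gdiff.
  move=> m; pose z := grid_floor m x.
  have [_ _ mF] := hM (m, z).
  rewrite (_ : (fun _ => _) = (fun t => (if t \in D `\` M (m, z)
     then F t (gridpt R m z) else 0) * \1_(~` N) t)).
    by apply: measurable_funM => //; apply: measurable_indic; exact: measurableC.
  apply/funext => t; rewrite /G indicE in_setC in_setD.
  have [Nt|Nt] := boolP (t \in N); first by rewrite andbF mulr0.
  rewrite andbT mulr1 in_setD (_ : t \in M (m, z) = false) ?andbT//.
  apply/negP => /set_mem Mt; move/negP: Nt; apply; rewrite inE.
  by exists (m, z).
- exact: Gdiff.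
- move=> t; have [[Dt Nt]|h] := pselect ((D `\` N) t).
    by rewrite GE//; exact: (F_C1 Dt).2.
  rewrite (_ : grad (G t) = cst 0); first exact: cst_continuous.
  by apply/funext => x; rewrite gradG0.
- move=> t x y; have [[Dt Nt]|h] := pselect ((D `\` N) t).
    rewrite GE//; apply: convex_grad_le; [exact: (F_C1 Dt).1|exact: F_convex].
  by rewrite gradG0// G0// add0r /dotv big1// => i _; rewrite mxE mul0r.
- move=> t x Dt; have [[_ Nt]|h] := pselect ((D `\` N) t).
    by rewrite GE// (le_trans (F_bound x Dt))// hK.
  by rewrite G0//= normr0 mulr_ge0// addr_ge0// sumr_ge0.
- move=> t x j Dt; have [[_ Nt]|h] := pselect ((D `\` N) t).
    rewrite GE// (le_trans (coord_le_enorm _ _))// (le_trans (gradF_bound x Dt))//.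
    exact: hK.
  by rewrite gradG0// mxE normr0 mulr_ge0// addr_ge0// sumr_ge0.
- move=> c; have [r hr] := F_coercive c; exists r => x rx.
  rewrite (le_trans (hr x rx))// /Rintegral le_eqVlt; apply/orP; left; apply/eqP.
  (* The coercivity integrals involve F itself, which need not be Borel, hence the comparison of
     integrals without measurability. *)
  congr fine; apply: (integral_eq_off_null mN N0) => t Dt Nt.
  by rewrite GE.
Qed.

End borel_version.

(** * Superposition operators *)

Lemma cvg_sumr (R : realType) (I : Type) (r : seq I) (F : I -> nat -> R) (l : I -> R) :
  (forall i, F i k @[k --> \oo] --> l i) ->
  \sum_(i <- r) F i k @[k --> \oo] --> \sum_(i <- r) l i.
Proof.
move=> Fl; elim: r => [|i r IH].
  by rewrite big_nil; under eq_cvg do rewrite big_nil; exact: cvg_cst.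
by rewrite big_cons; under eq_cvg do rewrite big_cons; exact: cvgD.
Qed.

Section superposition.
Variables (R : realType) (q n : nat) (T : 'rV[R]_q.+1).
Local Notation p := q.+1.
Local Notation mu := (@lebesgue_rV R q.+1).
Local Notation D := (box T).
Local Notation sqi := (sqi mu D).
Local Notation ip := (ip mu D).
Local Notation mD := (@measurable_box R q.+1 T).
Local Notation muD := (@box_lty R q.+1 T).
Variables (G : 'rV[R]_p -> 'rV[R]_n -> R) (K : R).
Hypothesis hG : convex_integrand T G K.
Implicit Types u v : 'I_n -> 'rV[R]_p -> R.

Definition rowf (X : Type) (w : 'I_n -> X -> R) (t : X) : 'rV[R]_n := \row_j w j t.

Definition nem u : R := \int[mu]_(t in D) G t (rowf u t).

Definition nemgrad u (j : 'I_n) (t : 'rV[R]_p) : R := grad (G t) (rowf u t) 0 j.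

Lemma continuous_G t : continuous (G t).
Proof. by move=> x; apply: differentiable_continuous; exact: (ci_diff hG). Qed.

Lemma nem_meas u : (forall j, measurable_fun D (u j)) ->
  measurable_fun D (fun t => G t (rowf u t)).
Proof.
move=> mu'; apply: (@eq_measurable_fun _ _ _ _ D
    (fun t => G t (rowf (fun j => u j \_ D) t))).
  by move=> t /set_mem Dt; congr G; apply/rowP => j; rewrite !mxE patchE mem_set.
apply: measurable_funTS; apply: (@measurable_fun_superposition R _ _ n G (rowf (fun j => u j \_ D))).
- exact: (ci_meas hG).
- exact: continuous_G.
- move=> j.
  have -> : (fun t => rowf (fun j => u j \_ D) t 0 j) = u j \_ D.
    by apply/funext => t; rewrite mxE.
  exact/(measurable_restrictT (u j) mD).
Qed.

(** A partial derivative is a pointwise limit of difference quotients, which are superpositions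
    already known to be measurable. *)
Lemma nemgrad_meas u j : (forall j, measurable_fun D (u j)) ->
  measurable_fun D (nemgrad u j).
Proof.
move=> mu'; apply: (@measurable_fun_cvg _ _ _ D (fun k t =>
  k.+1%:R * (G t (rowf (fun i t => u i t + k.+1%:R^-1 * (i == j)%:R) t) - G t (rowf u t)))).
  move=> k; apply: measurable_funM; first exact: measurable_cst.
  apply: measurable_funB; last exact: nem_meas.
  by apply: nem_meas => i; apply: measurable_funD => //; exact: measurable_cst.
move=> t _; rewrite /nemgrad mxE.
have d := @diff_derivable _ _ _ _ _ (basis_vec R j) (ci_diff hG t (rowf u t)).
have E k : rowf (fun i t => u i t + k.+1%:R^-1 * (i == j)%:R) t =
    rowf u t + k.+1%:R^-1 *: basis_vec R j.
  by apply/rowP => i; rewrite !mxE eqxx.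
by under eq_cvg do rewrite E; exact: derive_seq d.
Qed.

Lemma growth_ge0 : D !=set0 -> 0 <= K.
Proof.
move=> [t Dt]; have := ci_growth hG (0 : 'rV[R]_n) Dt.
rewrite big1 ?addr0 ?mulr1; last by move=> j _; rewrite mxE normr0.
exact: le_trans.
Qed.

Lemma sqi_growth u (c : R) : (forall j, sqi (u j)) ->
  sqi (fun t => c * (1 + \sum_j `|u j t|)).
Proof.
move=> su; apply: (sqiZ mD); apply: (sqiD mD); first exact: (sqi_cst mD muD).
by apply: (sqi_sum mD muD) => j; exact: (sqi_norm (su j)).
Qed.

Lemma nem_sqi u : (forall j, sqi (u j)) -> sqi (fun t => G t (rowf u t)).
Proof.
move=> su; apply: (sqi_le mD _ _ (sqi_growth K su)).
  by apply: nem_meas => j; exact: sqi_meas (su j).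
move=> t Dt; apply: le_trans (ci_growth hG (rowf u t) Dt) _.
by under eq_bigr do rewrite mxE.
Qed.

Lemma nem_itg u : (forall j, sqi (u j)) -> itg mu D (fun t => G t (rowf u t)).
Proof. by move=> su; apply: (sqi_itg mD muD); exact: nem_sqi. Qed.

(** Affine growth maps L^2 to L^2; this puts the right-hand side of the equation in L^2, as the
    second-order regularity demands. *)
Lemma nemgrad_sqi u j : (forall j, sqi (u j)) -> sqi (nemgrad u j).
Proof.
move=> su; apply: (sqi_le mD _ _ (sqi_growth K su)).
  by apply: nemgrad_meas => i; exact: sqi_meas (su i).
move=> t Dt; apply: le_trans (ci_grad_growth hG (rowf u t) j Dt) _.
by under eq_bigr do rewrite mxE.
Qed.

(** The gradient inequalities at the midpoint are added; their linear terms cancel. *)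
Lemma convex_midpoint t (x y : 'rV[R]_n) :
  2 * G t (2^-1 *: (x + y)) <= G t x + G t y.
Proof.
set z := 2^-1 *: (x + y).
have h1 := ci_convex hG t z x; have h2 := ci_convex hG t z y.
have h3 : dotv (grad (G t) z) (x - z) + dotv (grad (G t) z) (y - z) = 0.
  rewrite /dotv -big_split/= big1// => i _; rewrite -mulrDr !mxE.
  by apply/eqP; rewrite mulf_eq0; apply/orP; right; apply/eqP; field.
lra.
Qed.

Lemma nem_midpoint u v : (forall j, sqi (u j)) -> (forall j, sqi (v j)) ->
  2 * nem (fun j t => 2^-1 * (u j t + v j t)) <= nem u + nem v.
Proof.
move=> su sv.
have sw j : sqi (fun t => 2^-1 * (u j t + v j t)).
  by apply: (sqiZ mD); exact: (sqiD mD).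
rewrite /nem -(RintegralZl _ mD (nem_itg sw)) -(RintegralD mD (nem_itg su) (nem_itg sv)).
apply: (le_Rint mD (itgZ mD _ (nem_itg sw)) (itgD mD (nem_itg su) (nem_itg sv))).
move=> t _; apply: le_trans (convex_midpoint t _ _).
rewrite le_eqVlt; apply/orP; left; apply/eqP; congr (_ * G t _).
by apply/rowP => j; rewrite !mxE.
Qed.

(** The gradient inequalities at x and at y bound the difference from both sides, and affine growth
    of the gradient makes the bound at most quadratic in the distance, hence integrable for L^2
    arguments. *)
Lemma G_lipschitz t (x y : 'rV[R]_n) : D t -> `|G t x - G t y| <=
  K * (1 + 2 * \sum_j `|y 0 j|) * \sum_j `|x 0 j - y 0 j|
  + K * (\sum_j `|x 0 j - y 0 j|) ^+ 2.
Proof.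
move=> Dt; have K0 : 0 <= K by apply: growth_ge0; exists t.
set s := \sum_j `|x 0 j - y 0 j|; set sy := \sum_j `|y 0 j|.
have s0 : 0 <= s by exact: sumr_ge0.
have sy0 : 0 <= sy by exact: sumr_ge0.
have sx : \sum_j `|x 0 j| <= sy + s.
  rewrite /sy /s -big_split; apply: ler_sum => j _.
  by rewrite -[X in `|X| <= _](subrK (y 0 j)) addrC ler_normD.
have B (z w : 'rV[R]_n) : \sum_j `|z 0 j| <= sy + s -> \sum_j `|w 0 j - z 0 j| = s ->
    - dotv (grad (G t) z) (w - z) <= K * (1 + (sy + s)) * s.
  move=> hz hw; apply: le_trans (ler_norm _) _; rewrite normrN.
  apply: le_trans (ler_norm_sum _ _ _) _; rewrite -hw mulr_sumr.
  apply: ler_sum => j _; rewrite !mxE normrM ler_wpM2r//.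
  have := ci_grad_growth hG z j Dt; rewrite mxE => h.
  by rewrite (le_trans h)// ler_wpM2l// lerD2l hw.
have h1 := ci_convex hG t x y; have h2 := ci_convex hG t y x.
have b1 : - dotv (grad (G t) x) (y - x) <= K * (1 + (sy + s)) * s.
  by apply: B => //; apply: eq_bigr => j _; rewrite distrC.
have b2 : - dotv (grad (G t) y) (x - y) <= K * (1 + (sy + s)) * s.
  by apply: B => //; rewrite lerDl.
have b3 : K * (1 + (sy + s)) * s <= K * (1 + 2 * sy) * s + K * s ^+ 2.
  have : 0 <= K * sy * s by rewrite !mulr_ge0.
  by rewrite expr2; nra.
rewrite ler_norml; apply/andP; split; lra.
Qed.

Lemma nem_cvg (u_ : nat -> 'I_n -> 'rV[R]_p -> R) u :
  (forall k j, sqi (u_ k j)) -> (forall j, sqi (u j)) ->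
  (forall j, l2c mu D (fun k => u_ k j) (u j)) ->
  nem (u_ k) @[k --> \oo] --> nem u.
Proof.
move=> su_ su uu.
pose dl k (t : 'rV[R]_p) : R := \sum_j `|u_ k j t - u j t|.
have sd k j : sqi (fun t => u_ k j t - u j t) by exact: (sqiB mD).
have sdl k : sqi (dl k) by apply: (sqi_sum mD muD) => j; exact: (sqi_norm (sd k j)).
pose w (t : 'rV[R]_p) : R := K * (1 + 2 * \sum_j `|u j t|).
have sw : sqi w.
  apply: (sqiZ mD); apply: (sqiD mD); first exact: (sqi_cst mD muD).
  apply: (sqiZ mD); by apply: (sqi_sum mD muD) => j; exact: (sqi_norm (su j)).
have dl0 : ip (dl k) (dl k) @[k --> \oo] --> (0 : R).
  apply: (@squeeze_cvgr _ _ _ _ (fun=> 0) (fun k => #|'I_n|%:R * \sum_j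
    ip (fun t => u_ k j t - u j t) (fun t => u_ k j t - u j t))).
  - apply: nearW => k; rewrite ip_ge0/=.
    apply: le_trans (ip_sum_sq mD muD (fun j => sqi_norm (sd k j))) _.
    rewrite ler_wpM2l//; apply: ler_sum => j _; rewrite /ip.
    by under eq_Rintegral do rewrite -expr2 real_normK ?num_real// expr2.
  - exact: cvg_cst.
  - rewrite -[X in _ --> X](mulr0 #|'I_n|%:R); apply: cvgM; first exact: cvg_cst.
    have := @cvg_sumr R _ (index_enum 'I_n) _ _ uu; rewrite big1//.
have sdl0 : l2c mu D dl (fun=> 0).
  rewrite /l2c (_ : (fun k => _) = (fun k => ip (dl k) (dl k)))//.
  by apply/funext => k; apply: eq_ip => t _; rewrite subr0.
have w0 : ip (dl k) w @[k --> \oo] --> (0 : R).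
  have := l2c_ipl mD sdl (sqi_cst mD muD 0) sw sdl0.
  rewrite (_ : ip (fun=> 0) w = 0)//.
  by rewrite /ip; under eq_Rintegral do rewrite mul0r; rewrite Rintegral_cst// mul0r.
have i1 k : itg mu D (fun t => dl k t * w t) by exact: (sqi_mul mD).
have i2 k : itg mu D (fun t => dl k t * dl k t) by exact: (sqi_mul mD).
have iB k := itgB mD (nem_itg (su_ k)) (nem_itg su).
apply/subr_cvg0; apply/norm_cvg0P.
(* The integrated Lipschitz bound: [dl k] tends to 0 in L^2, so both its product with the fixed
   weight w and its square tend to 0 in the mean. *)
apply: (@squeeze_cvgr _ _ _ _ (fun=> 0) (fun k => ip (dl k) w + K * ip (dl k) (dl k))).
- apply: nearW => k; rewrite normr_ge0/= /nem.
  rewrite -(RintegralB mD (nem_itg (su_ k)) (nem_itg su)).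
  apply: le_trans (le_normr_Rintegral mD (iB k)) _.
  rewrite /ip -(RintegralZl _ mD (i2 k)) -(RintegralD mD (i1 k) (itgZ mD _ (i2 k))).
  apply: (le_Rint mD (itg_norm (iB k)) (itgD mD (i1 k) (itgZ mD _ (i2 k)))).
  move=> t Dt; apply: le_trans (G_lipschitz _ _ Dt) _.
  rewrite le_eqVlt; apply/orP; left; apply/eqP.
  rewrite -expr2 mulrC; congr (_ * (K * (1 + 2 * _)) + K * _ ^+ 2);
    by apply: eq_bigr => j _; rewrite !mxE.
- exact: cvg_cst.
- have -> : 0 = 0 + K * 0 :> R by rewrite mulr0 addr0.
  by apply: cvgD => //; apply: cvgM => //; exact: cvg_cst.
Qed.

End superposition.

(** * Minimization of the action *)

Section extraction.
Variable R : realType.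

Lemma cvg_extract (v : nat -> R) (g : nat -> nat) (l : R) :
  (forall k, (k <= g k)%N) -> v @ \oo --> l -> v (g k) @[k --> \oo] --> l.
Proof.
move=> kg vl; apply: (cvg_comp g v); last exact: vl.
by move=> A [N _ NA]; exists N => // k /= Nk; apply: NA => /=; exact: leq_trans (kg k).
Qed.

Lemma bounded_family_extract n (u : nat -> 'I_n -> R) (M : R) :
  (forall k j, `|u k j| <= M) -> exists g : nat -> nat,
  (forall k, (k <= g k)%N) /\ forall j, cvgn (fun k => u (g k) j).
Proof.
move=> uM; suff [g [kg hg]] : exists g : nat -> nat, (forall k, (k <= g k)%N) /\
    forall j, j \in enum 'I_n -> cvgn (fun k => u (g k) j).
  by exists g; split => // j; apply: hg; rewrite mem_enum.
elim: (enum 'I_n) => [|j r [g [kg hg]]]; first by exists id.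
have [|f fi cf] := @bolzano_weierstrass R (fun k => u (g k) j).
  exists M; split; first exact: num_real.
  by move=> x Mx k _ /=; exact: le_trans (ltW Mx).
have kf k : (k <= f k)%N.
  elim: k => // k IH; apply: (leq_ltn_trans IH).
  by rewrite ltnNge; have := fi k.+1 k; rewrite leEnat ltnn => ->.
exists (g \o f); split => [k|i]; first exact: leq_trans (kf k) (kg _).
rewrite inE => /predU1P[->|ir]; first exact: cf.
have /cvg_ex[l hl] := hg i ir.
by apply/cvg_ex; exists l; exact: (cvg_extract kf hl).
Qed.

End extraction.

Section minimization.
Variables (R : realType) (q n : nat) (T : 'rV[R]_q.+1).
Hypothesis hT : forall i, 0 < T 0 i.
Local Notation p := q.+1.
Local Notation mu := (@lebesgue_rV R q.+1).
Local Notation D := (box T).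
Local Notation sqi := (sqi mu D).
Local Notation ip := (ip mu D).
Local Notation ev := (ev T).
Local Notation dt := (dt T).
Local Notation mD := (@measurable_box R q.+1 T).
Local Notation muD := (@box_lty R q.+1 T).
Variables (G : 'rV[R]_p -> 'rV[R]_n -> R) (K : R).
Hypothesis hG : convex_integrand T G K.
Implicit Types S V : 'I_n -> tpoly R p.

Definition comb (a b : R) S V (j : 'I_n) : tpoly R p :=
  tscale a (S j) ++ tscale b (V j).

Lemma ev_comb a b S V j t :
  ev (comb a b S V j) t = a * ev (S j) t + b * ev (V j) t.
Proof. by rewrite ev_cat !ev_tscale. Qed.

Lemma ev_dt_comb a b S V i j t :
  ev (dt i (comb a b S V j)) t = a * ev (dt i (S j)) t + b * ev (dt i (V j)) t.
Proof. by rewrite dt_cat ev_cat !dt_tscale !ev_tscale. Qed.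

Definition dirichlet S V : R :=
  \sum_j \sum_i ip (ev (dt i (S j))) (ev (dt i (V j))).

Lemma dirichlet_comb a b S V :
  dirichlet (comb a b S V) (comb a b S V) =
  a ^+ 2 * dirichlet S S + 2 * a * b * dirichlet S V + b ^+ 2 * dirichlet V V.
Proof.
rewrite /dirichlet !mulr_sumr -!big_split; apply: eq_bigr => j _ /=.
rewrite !mulr_sumr -!big_split; apply: eq_bigr => i _ /=.
rewrite -(ip_lin mD a b (sqi_ev T (dt i (S j))) (sqi_ev T (dt i (V j)))).
by apply: eq_ip => t _; rewrite ev_dt_comb.
Qed.

Lemma dirichlet_ge0 S : 0 <= dirichlet S S.
Proof. by apply: sumr_ge0 => j _; apply: sumr_ge0 => i _; exact: ip_ge0. Qed.

Lemma ip_dt_le_dirichlet S i j :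
  ip (ev (dt i (S j))) (ev (dt i (S j))) <= dirichlet S S.
Proof.
rewrite /dirichlet (bigD1 j)//= (bigD1 i)//= -addrA lerDl addr_ge0//.
  by apply: sumr_ge0 => ? _; exact: ip_ge0.
by apply: sumr_ge0 => ? _; apply: sumr_ge0 => ? _; exact: ip_ge0.
Qed.

Lemma ip_osc_le_dirichlet S j :
  gap T * ip (ev (osc (S j))) (ev (osc (S j))) <= dirichlet S S.
Proof.
apply: le_trans (spectral_gap hT (S j)) _.
rewrite /dirichlet (bigD1 j)//= lerDl.
by apply: sumr_ge0 => ? _; apply: sumr_ge0 => ? _; exact: ip_ge0.
Qed.

Definition evf S (j : 'I_n) : 'rV[R]_p -> R := ev (S j).

Lemma sqi_evf S j : sqi (evf S j). Proof. exact: sqi_ev. Qed.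

Definition action S : R := 2^-1 * dirichlet S S + nem T G (evf S).

(** The potential energy of the constant function x; coercivity is a statement about this function
    alone. *)
Definition mean_energy (x : 'rV[R]_n) : R := \int[mu]_(t in D) G t x.

Lemma mean_energyE x : mean_energy x = nem T G (fun j _ => x 0 j).
Proof.
rewrite /mean_energy /nem; congr Rintegral; apply/funext => t; congr (G t _).
by apply/rowP => j; rewrite mxE.
Qed.

(** Coercivity handles large x; on the remaining ball the growth bound does. *)
Lemma mean_energy_lbound : exists c : R, forall x, c <= mean_energy x.
Proof.
have [r hr] := ci_coercive hG 0.
have K0 : 0 <= K.
  by apply: (growth_ge0 hG); exists 0 => i; rewrite mxE lexx ltW.
pose B := K * (1 + n%:R * `|r|); have B0 : 0 <= B.
  by rewrite mulr_ge0// addr_ge0// mulr_ge0.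
exists (- (B * fine (mu D))) => x; have [rx|xr] := leP r (enorm x).
  by rewrite (le_trans _ (hr x rx))// oppr_le0 mulr_ge0// fine_ge0.
have iG : itg mu D (fun t => G t x).
  have := nem_itg hG (fun j => sqi_cst mD muD (x 0 j)).
  congr (itg _ _ _); apply/funext => t; congr (G t _).
  by apply/rowP => j; rewrite mxE.
rewrite -mulNr -Rintegral_cst//; apply: (le_Rint mD (itg_cst mD muD _) iG) => t Dt.
rewrite lerNl (le_trans (ler_norm _))// normrN (le_trans (ci_growth hG x Dt))//.
rewrite ler_wpM2l// lerD2l.
apply: (@le_trans _ _ (\sum_(j < n) `|r|)); last by rewrite sumr_const card_ord mulr_natl.
apply: ler_sum => j _; rewrite (le_trans (coord_le_enorm x j))//.
by rewrite (le_trans (ltW xr))// ler_norm.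
Qed.

Definition avgv S : 'rV[R]_n := \row_j avg (S j).

(** Half the mean is the midpoint of u and of minus its oscillating part. Convexity bounds twice its
    energy by the potential energies of these two; the second grows at most linearly, and the
    spectral gap lets a quarter of the Dirichlet integral absorb it. *)
Lemma action_lbound : exists C : R, forall S,
  4^-1 * dirichlet S S - C + 2 * mean_energy (2^-1 *: avgv S) <= action S.
Proof.
have K0 : 0 <= K.
  by apply: (growth_ge0 hG); exists 0 => i; rewrite mxE lexx ltW.
have g0 := gap_gt0 hT.
(* From K (1 + sum_j y_j) with K y <= K^2 / gap + gap y^2 / 4 in each of the n coordinates. *)
pose C0 := K + n%:R * (K ^+ 2 / gap T).
exists (C0 * fine (mu D)) => S.
pose o j := ev (osc (S j)); pose no j t := - o j t.
have so j : sqi (o j) by exact: sqi_ev.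
have sno j : sqi (no j) by exact: (sqiN mD).
have io j := sqi_mul mD (so j) (so j).
have h1 := nem_midpoint hG (sqi_evf S) sno.
have h2 : mean_energy (2^-1 *: avgv S) =
    nem T G (fun j t => 2^-1 * (evf S j t + no j t)).
  rewrite mean_energyE; congr (nem T G); apply/funext => j; apply/funext => t.
  by rewrite !mxE /evf ev_avg /no /o addrK.
have h3 : nem T G no <= C0 * fine (mu D) + 4^-1 * dirichlet S S.
  pose d t := \sum_j 4^-1 * gap T * (o j t * o j t).
  have id : itg mu D d by apply: (itg_sum mD muD) => j; exact: (itgZ mD).
  have : nem T G no <= \int[mu]_(t in D) (C0 + d t).
    apply: (le_Rint mD (nem_itg hG sno) (itgD mD (itg_cst mD muD _) id)) => t Dt.
    apply: le_trans (ler_norm _) _; apply: le_trans (ci_growth hG _ Dt) _.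
    rewrite mulrDr mulr1 /C0 -addrA lerD2l mulr_sumr /d.
    have -> : n%:R * (K ^+ 2 / gap T) = \sum_(j < n) (K ^+ 2 / gap T).
      by rewrite sumr_const card_ord mulr_natl.
    rewrite -big_split; apply: ler_sum => j _ /=; rewrite !mxE normrN.
    rewrite -(expr2 (o j t)) -(real_normK (num_real (o j t))).
    set y := `|o j t|; rewrite -(ler_pM2r g0).
    have -> : (K ^+ 2 / gap T + 4^-1 * gap T * y ^+ 2) * gap T =
      K ^+ 2 + (2^-1 * (gap T * y)) ^+ 2 by field; rewrite gt_eqF.
    have := sqr_ge0 (K - 2^-1 * (gap T * y)); rewrite sqrrB; lra.
  move=> h; apply: le_trans h _.
  rewrite (RintegralD mD (itg_cst mD muD _) id) Rintegral_cst// lerD2l.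
  rewrite /d (Rint_sum mD muD); last by move=> j; exact: (itgZ mD).
  rewrite /dirichlet mulr_sumr; apply: ler_sum => j _.
  rewrite (RintegralZl _ mD (io j)) -mulrA ler_wpM2l//.
  exact: spectral_gap.
rewrite /action h2; lra.
Qed.

(** The parallelogram identity for the Dirichlet part and midpoint convexity for the potential. For
    near minimizers the right-hand side is small, hence their gradients are close. *)
Lemma action_midpoint S V :
  8^-1 * dirichlet (comb 1 (-1) S V) (comb 1 (-1) S V) <=
  2^-1 * action S + 2^-1 * action V - action (comb 2^-1 2^-1 S V).
Proof.
have := nem_midpoint hG (sqi_evf S) (sqi_evf V).
rewrite (_ : (fun j t => _) = evf (comb 2^-1 2^-1 S V)) => [h|]; last first.
  by apply/funext => j; apply/funext => t; rewrite /evf ev_comb mulrDr.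
by rewrite /action !dirichlet_comb; lra.
Qed.

Lemma near_minimizers : exists (m : R) (S : nat -> 'I_n -> tpoly R p) (M : R),
  [/\ forall V, m <= action V, forall k, action (S k) <= m + k.+1%:R^-1 &
      forall k j, `|avg (S k j)| <= M].
Proof.
have [c hc] := mean_energy_lbound; have [C hC] := action_lbound.
have lb V : True -> 2 * c - C <= action V.
  by move=> _; have := hC V; have := hc (2^-1 *: avgv V); have := dirichlet_ge0 V; lra.
have [m [hm [S hS]]] := near_min_seq (w0 := fun=> [::]) I lb.
(* Action at most m + 1 forces the mean energy of half the average to be at most (m + 1 + C) / 2;
   the threshold lies above it, so half the average stays within radius r'. *)
have [r' hr'] : exists r, forall x, r <= enorm x -> (m + 1 + C) / 2 + 1 <= mean_energy x.
  exact: (ci_coercive hG).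
exists m, S, (2 * `|r'|); split => [V|k|k j]; [exact: hm|by have [] := hS k|].
have [_ Sk] := hS k.
have S1 : action (S k) <= m + 1.
  by apply: (le_trans Sk); rewrite lerD2l invf_le1// ler1n.
have small : enorm (2^-1 *: avgv (S k)) < r'.
  rewrite ltNge; apply/negP => /hr' h.
  suff : (0 : R) < 0 by rewrite ltxx.
  by have := hC (S k); have := dirichlet_ge0 (S k); lra.
have := coord_le_enorm (2^-1 *: avgv (S k)) j; rewrite !mxE normrM.
rewrite (gtr0_norm (_ : 0 < 2^-1))// => h.
have := ler_norm r'; lra.
Qed.

End minimization.

(** * The limit of a minimizing sequence and its Euler-Lagrange equation *)

Section weak_solution.
Variables (R : realType) (q n : nat) (T : 'rV[R]_q.+1).
Hypothesis hT : forall i, 0 < T 0 i.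
Local Notation p := q.+1.
Local Notation mu := (@lebesgue_rV R q.+1).
Local Notation D := (box T).
Local Notation sqi := (sqi mu D).
Local Notation ip := (ip mu D).
Local Notation ev := (ev T).
Local Notation dt := (dt T).
Local Notation mD := (@measurable_box R q.+1 T).
Local Notation muD := (@box_lty R q.+1 T).
Variables (G : 'rV[R]_p -> 'rV[R]_n -> R) (K : R).
Hypothesis hG : convex_integrand T G K.
Implicit Types V : 'I_n -> tpoly R p.

Lemma invS_lt (e : R) : 0 < e -> exists N, forall k, (N <= k)%N -> k.+1%:R^-1 < e.
Proof.
move=> e0; have [N _ hN] := near_infty_natSinv_lt (PosNum e0).
by exists N => k; exact: hN.
Qed.

(** The means converge along a subsequence, the gradients are Cauchy by the midpoint estimate, and
    the oscillating parts by the spectral gap; the limit u is the sum of the two limits. *)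
Lemma minimizing_limit : exists (m : R) (S : nat -> 'I_n -> tpoly R p)
    (u : 'I_n -> 'rV[R]_p -> R) (du : 'I_p -> 'I_n -> 'rV[R]_p -> R),
  [/\ forall V, m <= action T G V, action T G (S k) @[k --> \oo] --> m,
      (forall j, sqi (u j) /\ l2c mu D (fun k => ev (S k j)) (u j)) &
      (forall i j, sqi (du i j) /\ l2c mu D (fun k => ev (dt i (S k j))) (du i j))].
Proof.
have [m [S0 [M [hm hS0 hM]]]] := near_minimizers hT hG.
have [g [kg cg]] := bounded_family_extract hM.
pose S k := S0 (g k).
have hS k : action T G (S k) <= m + k.+1%:R^-1.
  apply: le_trans (hS0 (g k)) _.
  by rewrite lerD2l lef_pV2 ?posrE// ler_nat ltnS.
have dS k l : dirichlet T (comb 1 (-1) (S k) (S l)) (comb 1 (-1) (S k) (S l)) <=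
    4 * (k.+1%:R^-1 + l.+1%:R^-1).
  have h := action_midpoint hG (S k) (S l).
  have h1 := hm (comb 2^-1 2^-1 (S k) (S l)).
  have h2 := hS k; have h3 := hS l.
  move: h h1 h2 h3; move: k.+1%:R^-1 l.+1%:R^-1 => a b; lra.
have dS0 e : 0 < e -> exists N, forall k l, (N <= k)%N -> (N <= l)%N ->
    dirichlet T (comb 1 (-1) (S k) (S l)) (comb 1 (-1) (S k) (S l)) <= e.
  move=> e0; have e8 : 0 < e / 8 by rewrite divr_gt0.
  have [N hN] := invS_lt e8; exists N => k l Nk Nl.
  apply: le_trans (dS k l) _; have := hN k Nk; have := hN l Nl.
  move: k.+1%:R^-1 l.+1%:R^-1 => a b; lra.
have cd i j : l2cauchy mu D (fun k => ev (dt i (S k j))).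
  move=> e e0; have [N hN] := dS0 e e0; exists N => k l Nk Nl.
  apply: le_trans (hN k l Nk Nl).
  apply: le_trans (ip_dt_le_dirichlet T _ i j).
  by rewrite le_eqVlt; apply/orP; left; apply/eqP; apply: eq_ip => t _;
    rewrite ev_dt_comb; ring.
have co j : l2cauchy mu D (fun k => ev (osc (S k j))).
  move=> e e0; have g0 := gap_gt0 hT.
  have [N hN] := dS0 _ (mulr_gt0 g0 e0); exists N => k l Nk Nl.
  rewrite -(ler_pM2l g0); apply: le_trans (hN k l Nk Nl).
  apply: le_trans (ip_osc_le_dirichlet hT (comb 1 (-1) (S k) (S l)) j).
  rewrite ler_pM2l// le_eqVlt; apply/orP; left; apply/eqP; apply: eq_ip => t _;
    by rewrite osc_cat !osc_tscale ev_cat !ev_tscale; ring.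
have /choice[w hw] : forall j, exists f, sqi f /\ l2c mu D (fun k => ev (osc (S k j))) f.
  by move=> j; have [f] := l2_complete mD muD (fun k => sqi_ev T _) (co j); exists f.
have /choice[du hdu] : forall ij : 'I_p * 'I_n, exists f, sqi f /\
    l2c mu D (fun k => ev (dt ij.1 (S k ij.2))) f.
  by move=> [i j]; have [f] := l2_complete mD muD (fun k => sqi_ev T _) (cd i j); exists f.
have /choice[c hc] : forall j, exists c : R, avg (S k j) @[k --> \oo] --> c.
  by move=> j; have /cvg_ex[l hl] := cg j; exists l.
exists m, S, (fun j t => c j + w j t), (fun i j => du (i, j)); split => [//||j|i j].
- apply: (@squeeze_cvgr _ _ _ _ (fun=> m) (fun k => m + k.+1%:R^-1)); last 2 first.
    exact: cvg_cst.
    rewrite -[X in _ --> X]addr0; apply: cvgD; first exact: cvg_cst.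
    exact: (@cvg_harmonic R).
  by apply: nearW => k; rewrite hm hS.
- have [sw lw] := hw j; split; first by apply: (sqiD mD) => //; exact: (sqi_cst mD muD).
  have lc : l2c mu D (fun k _ => avg (S k j)) (fun=> c j).
    rewrite /l2c (_ : (fun k => _) =
        (fun k => (avg (S k j) - c j) * (avg (S k j) - c j) * fine (mu D))).
      have h : avg (S k j) - c j @[k --> \oo] --> (0 : R) by apply/subr_cvg0; exact: hc.
      rewrite -(mul0r (fine (mu D))); apply: cvgM; last exact: cvg_cst.
      by rewrite -(mul0r 0); apply: cvgM.
    by apply/funext => k; rewrite /ip Rintegral_cst.
  have := l2cD mD (fun k => sqi_cst mD muD (avg (S k j))) (sqi_cst mD muD (c j))
    (fun k => sqi_ev T (osc (S k j))) sw lc lw.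
  congr (l2c mu D _ _); apply/funext => k; apply/funext => t.
  by rewrite [RHS]ev_avg.
- exact: (hdu (i, j)).
Qed.

Lemma weak_solution : exists (S : nat -> 'I_n -> tpoly R p)
    (u : 'I_n -> 'rV[R]_p -> R) (du : 'I_p -> 'I_n -> 'rV[R]_p -> R),
  [/\ (forall j, sqi (u j) /\ l2c mu D (fun k => ev (S k j)) (u j)),
      (forall i j, sqi (du i j) /\ l2c mu D (fun k => ev (dt i (S k j))) (du i j)) &
      forall V, \sum_j \sum_i ip (du i j) (ev (dt i (V j))) +
        \sum_j ip (nemgrad G u j) (ev (V j)) = 0].
Proof.
have [m [S [u [du [hm Sm hu hdu]]]]] := minimizing_limit.
exists S, u, du; split => //.
have su j : sqi (u j) by have [] := hu j.
have sdu i j : sqi (du i j) by have [] := hdu i j.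
pose B V := \sum_j \sum_i ip (du i j) (ev (dt i (V j))).
have BV V : dirichlet T (S k) V @[k --> \oo] --> B V.
  apply: cvg_sumr => j; apply: cvg_sumr => i.
  exact: (l2c_ipl mD (fun k => sqi_ev T _) (sdu i j) (sqi_ev T _) (hdu i j).2).
pose uh h V j t := u j t + h * ev (V j) t.
have suh h V j : sqi (uh h V j).
  by apply: (sqiD mD) => //; apply: (sqiZ mD); exact: sqi_ev.
have ngs v j : (forall i, sqi (v i)) -> sqi (nemgrad G v j).
  by move=> sv; apply: (nemgrad_sqi hG).
(* The minimality m <= A(S_k + h V) is passed to the limit in k: u itself is only a limit of
   competitors, and only the difference of the two actions is computed there. *)
have step1 h V : 0 <= h * B V + 2^-1 * h ^+ 2 * dirichlet T V V +
    (nem T G (uh h V) - nem T G u).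
  have lim : action T G (comb 1 h (S k) V) - action T G (S k) @[k --> \oo] -->
      h * B V + 2^-1 * h ^+ 2 * dirichlet T V V + (nem T G (uh h V) - nem T G u).
    rewrite (_ : (fun k => _) = (fun k => h * dirichlet T (S k) V +
      2^-1 * h ^+ 2 * dirichlet T V V +
      (nem T G (evf T (comb 1 h (S k) V)) - nem T G (evf T (S k))))); last first.
      by apply/funext => k; rewrite /action dirichlet_comb; field.
    apply: cvgD.
      apply: cvgD; last exact: cvg_cst.
      by apply: cvgM; [exact: cvg_cst|exact: BV].
    apply: cvgB.
      apply: (nem_cvg hG) => [k j|//|j]; first exact: sqi_evf.
      have hZ : l2c mu D (fun _ t => h * ev (V j) t) (fun t => h * ev (V j) t).
        rewrite /l2c (_ : (fun k => _) = fun=> 0); first exact: cvg_cst.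
        apply/funext => k; rewrite /ip; under eq_Rintegral do rewrite subrr mul0r.
        by rewrite Rintegral_cst// mul0r.
      have sZ : sqi (fun t => h * ev (V j) t) by apply: (sqiZ mD); exact: sqi_ev.
      have := l2cD mD (fun k => sqi_ev T (S k j)) (su j) (fun _ => sZ) sZ (hu j).2 hZ.
      congr (l2c mu D _ _); apply/funext => k; apply/funext => t.
      by rewrite /evf ev_comb mul1r.
    by apply: (nem_cvg hG) => [k j|//|j]; [exact: sqi_evf|exact: (hu j).2].
  have lim0 : m - action T G (S k) @[k --> \oo] --> (0 : R).
    by rewrite -(subrr m); apply: cvgB => //; exact: cvg_cst.
  apply: (ler_cvg_to lim0 lim); apply: nearW => k.
  by rewrite lerD2r; exact: hm.
(* The gradient inequality at the perturbed point u + h V bounds the increment of the potential from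
   above; the whole is then divided by h. *)
have step2 h V : 0 < h -> 0 <= B V + 2^-1 * h * dirichlet T V V +
    \sum_j ip (nemgrad G (uh h V) j) (ev (V j)).
  move=> h0; rewrite -(pmulr_rge0 _ h0); apply: le_trans (step1 h V) _.
  rewrite [leRHS]mulrDr -[X in _ <= X + _](_ : h * B V + 2^-1 * h ^+ 2 * dirichlet T V V = _); last by ring.
  rewrite lerD2l.
  have ig j : itg mu D (fun t => nemgrad G (uh h V) j t * ev (V j) t).
    by apply: (sqi_mul mD); [exact: ngs|exact: sqi_ev].
  rewrite /ip -(Rint_sum mD muD _ ig) /nem.
  have is_ := itg_sum mD muD (index_enum 'I_n) ig.
  rewrite -(RintegralB mD (nem_itg hG (suh h V)) (nem_itg hG su)) -(RintegralZl _ mD is_).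
  apply: (le_Rint mD (itgB mD (nem_itg hG (suh h V)) (nem_itg hG su)) (itgZ mD _ is_)).
  move=> t Dt; have := ci_convex hG t (rowf (uh h V) t) (rowf u t).
  have -> : dotv (grad (G t) (rowf (uh h V) t)) (rowf u t - rowf (uh h V) t) =
      - (h * \sum_j nemgrad G (uh h V) j t * ev (V j) t).
    rewrite mulr_sumr -sumrN; apply: eq_bigr => j _.
    by rewrite /nemgrad mxE !mxE /uh; ring.
  lra.
(* Along h = 1 / (k + 1), gradients at u + h V converge pointwise and, as h <= 1, are dominated
   through their affine growth. *)
have step3 V : 0 <= B V + \sum_j ip (nemgrad G u j) (ev (V j)).
  pose h k : R := k.+1%:R^-1.
  have h0 k : 0 < h k by rewrite invr_gt0.
  have hcv : h k @[k --> \oo] --> (0 : R) by exact: (@cvg_harmonic R).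
  have lim : B V + 2^-1 * h k * dirichlet T V V +
      \sum_j ip (nemgrad G (uh (h k) V) j) (ev (V j)) @[k --> \oo] -->
      B V + 2^-1 * 0 * dirichlet T V V + \sum_j ip (nemgrad G u j) (ev (V j)).
    apply: cvgD.
      apply: cvgD; first exact: cvg_cst.
      apply: cvgM; last exact: cvg_cst.
      by apply: cvgM; [exact: cvg_cst|exact: hcv].
    apply: cvg_sumr => j.
    pose bd (t : 'rV[R]_p) : R := K * (1 + \sum_i `|(`|u i t| + `|ev (V i) t|)|) * `|ev (V j) t|.
    have ibd : itg mu D bd.
      apply: (sqi_mul mD); last by apply: sqi_norm; exact: sqi_ev.
      apply: (sqi_growth (u := fun i t => `|u i t| + `|ev (V i) t|)) => i.
      by apply: (sqiD mD); apply: sqi_norm => //; exact: sqi_ev.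
    have ing v : (forall i, sqi (v i)) -> itg mu D (fun t => nemgrad G v j t * ev (V j) t).
      by move=> sv; apply: (sqi_mul mD); [exact: ngs|exact: sqi_ev].
    have cg t : nemgrad G (uh (h k) V) j t @[k --> \oo] --> nemgrad G u j t.
      have E k : rowf (uh (h k) V) t = rowf u t + h k *: rowf (evf T V) t.
        by apply/rowP => i; rewrite !mxE.
      have cr : rowf u t + h k *: rowf (evf T V) t @[k --> \oo] --> rowf u t.
        rewrite -[X in _ --> X](addr0 (rowf u t)) -(scale0r (rowf (evf T V) t)).
        by apply: cvgD; [exact: cvg_cst|apply: cvgZ; [exact: hcv|exact: cvg_cst]].
      rewrite /nemgrad; under eq_cvg do rewrite E.
      have cc : continuous (fun x => grad (G t) x 0 j).
        move=> x; apply: (@continuous_comp _ _ _ (grad (G t)) (fun x : 'rV[R]_n => x 0 j)).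
          exact: (ci_grad_cont hG).
        exact: coord_continuous.
      by apply: (cvg_comp _ (fun x => grad (G t) x 0 j) cr); exact: cc.
    have fcv : {ae mu, forall t, D t -> (nemgrad G (uh (h k) V) j t * ev (V j) t)%:E
        @[k --> \oo] --> (nemgrad G u j t * ev (V j) t)%:E}.
      apply: aeW => t _; apply: cvg_EFin; first exact: nearW.
      by apply: cvgM; [exact: cg|exact: cvg_cst].
    have hbd : {ae mu, forall t k, D t ->
        (`|(nemgrad G (uh (h k) V) j t * ev (V j) t)%:E| <= (bd t)%:E)%E}.
      apply: aeW => t k Dt; rewrite lee_fin normrM ler_wpM2r//.
      apply: le_trans (ci_grad_growth hG _ j Dt) _.
      rewrite ler_wpM2l//; first by apply: (growth_ge0 hG); exists t.
      rewrite lerD2l; apply: ler_sum => i _; rewrite !mxE.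
      rewrite (le_trans (ler_normD _ _))// [leRHS]ger0_norm ?addr_ge0// lerD2l normrM.
      by rewrite (gtr0_norm (h0 k)) ler_piMl// /h invf_le1// ler1n.
    have [_ _ H] := @dominated_convergence _ _ _ mu D mD _ _ _
      (fun k => measurable_int _ (ing _ (suh (h k) V)))
      (measurable_int _ (ing _ su)) fcv ibd hbd.
    rewrite (Rint_EFin mD (ing _ su)) in H.
    exact: (fine_cvg H).
  have := cvgr_to_ge lim; rewrite mulr0 mul0r addr0; apply; apply: nearW => k.
  exact: step2.
move=> V; apply/eqP; rewrite eq_le; apply/andP; split; last exact: step3.
(* The expression is linear in V, so the inequality for -V gives equality. *)
have := step3 (fun j => tscale (-1) (V j)).
rewrite -oppr_le0; apply: le_trans; rewrite le_eqVlt; apply/orP; left; apply/eqP.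
rewrite opprD -!sumrN; congr (_ + _); apply: eq_bigr => j _.
  rewrite -sumrN; apply: eq_bigr => i _.
  have -> : ev (dt i (tscale (-1) (V j))) = (fun t => -1 * ev (dt i (V j)) t).
    by apply/funext => t; rewrite dt_tscale ev_tscale.
  by rewrite (ipZr mD) ?mulN1r ?opprK//; exact: sqi_ev.
have -> : ev (tscale (-1) (V j)) = (fun t => -1 * ev (V j) t).
  by apply/funext => t; rewrite ev_tscale.
rewrite (ipZr mD) ?mulN1r ?opprK//; first exact: sqi_ev.
exact: ngs.
Qed.

End weak_solution.

(** * Second-order regularity *)

Section projection.
Context d (X : measurableType d) (R : realType).
Variables (mu : {measure set X -> \bar R}) (D : set X).
Hypotheses (mD : measurable D) (muD : (mu D < +oo)%E).
Local Notation sqi := (sqi mu D).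
Local Notation ip := (ip mu D).

Lemma l2c_cauchy (u : nat -> X -> R) f : (forall k, sqi (u k)) -> sqi f ->
  l2c mu D u f -> l2cauchy mu D u.
Proof.
move=> su sf uf e e0; have e4 : 0 < e / 4 by rewrite divr_gt0.
have /cvgrPdist_le/(_ _ e4)[N _ hN] := uf.
exists N => k l Nk Nl.
have := hN k Nk; have := hN l Nl; rewrite /= !sub0r !normrN !ger0_norm ?ip_ge0// => hl hk.
have := ip_sqB_le mD (sqiB mD (su k) sf) (sqiB mD (su l) sf).
rewrite (@eq_ip _ _ _ mu D _ (fun x => u k x - u l x) _ (fun x => u k x - u l x));
  try by move=> x _; ring.
by move=> /le_trans; apply; lra.
Qed.

Lemma l2c_ae (u : nat -> X -> R) f g : (forall k, sqi (u k)) -> sqi f -> sqi g ->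
  {ae mu, forall x, D x -> g x - f x = 0} -> l2c mu D u f -> l2c mu D u g.
Proof.
move=> su sf sg gf uf.
have ss : sqi (fun x => g x - f x) by exact: (sqiB mD).
have z : ip (fun x => g x - f x) (fun x => g x - f x) = 0.
  rewrite /ip /Rintegral (_ : (\int[mu]_(x in D) _)%E = (\int[mu]_(x in D) cst 0 x)%E).
    by rewrite integral0.
  apply: ae_eq_integral => //.
    by apply/measurable_EFinP; apply: measurable_funM; exact: sqi_meas ss.
  by apply: filterS gf => x + Dx => /(_ Dx) -> /=; rewrite mul0r.
apply: (@squeeze_cvgr _ _ _ _ (fun=> 0)
  (fun k => 2 * ip (fun x => u k x - f x) (fun x => u k x - f x))).
- apply: nearW => k; rewrite ip_ge0/=.
  have := ip_sqB_le mD (sqiB mD (su k) sf) ss; rewrite z mulr0 addr0.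
  rewrite (@eq_ip _ _ _ mu D _ (fun x => u k x - g x) _ (fun x => u k x - g x))//;
    by move=> x _; ring.
- exact: cvg_cst.
- by rewrite -(mulr0 2); apply: cvgM; [exact: cvg_cst|exact: uf].
Qed.

Variables (I : finType) (W : Type) (op : W -> I -> X -> R).
Variables (comb : R -> R -> W -> W -> W) (w0 : W).
Hypothesis op_sqi : forall w i, sqi (op w i).
Hypothesis op_comb : forall a b w w' i x,
  op (comb a b w w') i x = a * op w i x + b * op w' i x.
Variable x : I -> X -> R.
Hypothesis x_sqi : forall i, sqi (x i).

(** Orthogonal projection of x onto the closure of the linear family [op], whose stability under
    combinations is expressed by [comb]. A minimizing sequence for the distance is Cauchy by the
    parallelogram identity. *)
Lemma projection : exists (w : nat -> W) (z : I -> X -> R),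
  [/\ forall i, sqi (z i), forall i, l2c mu D (fun k => op (w k) i) (z i) &
      forall v, \sum_i ip (fun t => x i t - z i t) (op v i) = 0].
Proof.
pose res w i t := x i t - op w i t.
have sres w i : sqi (res w i) by exact: (sqiB mD).
pose J w := \sum_i ip (res w i) (res w i).
have J0 w : True -> 0 <= J w by move=> _; apply: sumr_ge0 => i _; exact: ip_ge0.
have [m [hm [w hw]]] := near_min_seq (inW := fun=> True) (w0 := w0) Logic.I J0.
have diff k l i : ip (fun t => op (w k) i t - op (w l) i t)
    (fun t => op (w k) i t - op (w l) i t) <= 2 * (k.+1%:R^-1 + l.+1%:R^-1).
  have h1 := hm (comb 2^-1 2^-1 (w k) (w l)) Logic.I.
  have [_ hk] := hw k; have [_ hl] := hw l.
  have E : J (comb 2^-1 2^-1 (w k) (w l)) = 2^-1 * J (w k) + 2^-1 * J (w l) -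
    4^-1 * \sum_i ip (fun t => op (w k) i t - op (w l) i t)
                     (fun t => op (w k) i t - op (w l) i t).
    rewrite /J !mulr_sumr -!big_split/= -sumrB; apply: eq_bigr => a _.
    have := ip_lin mD 2^-1 2^-1 (sres (w k) a) (sres (w l) a).
    rewrite (@eq_ip _ _ _ mu D _ (res (comb 2^-1 2^-1 (w k) (w l)) a) _
      (res (comb 2^-1 2^-1 (w k) (w l)) a)); try by
      move=> t _; rewrite /res op_comb; field.
    move=> ->; have := ip_sqB mD (sres (w l) a) (sres (w k) a).
    rewrite (@eq_ip _ _ _ mu D _ (fun t => op (w k) a t - op (w l) a t) _
      (fun t => op (w k) a t - op (w l) a t)); try by move=> t _; rewrite /res; ring.
    by move=> ->; rewrite (ipC mu D (res (w l) a)); field.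
  have le : ip (fun t => op (w k) i t - op (w l) i t)
    (fun t => op (w k) i t - op (w l) i t) <=
    \sum_i ip (fun t => op (w k) i t - op (w l) i t)
              (fun t => op (w k) i t - op (w l) i t).
    by rewrite [leRHS](bigD1 i)//= lerDl sumr_ge0// => a _; exact: ip_ge0.
  apply: le_trans le _; move: h1 hk hl; rewrite E.
  move: k.+1%:R^-1 l.+1%:R^-1 => a b; lra.
have cau i : l2cauchy mu D (fun k => op (w k) i).
  move=> e e0; have e4 : 0 < e / 4 by rewrite divr_gt0.
  have [N hN] := invS_lt e4; exists N => k l Nk Nl.
  apply: le_trans (diff k l i) _; have := hN k Nk; have := hN l Nl.
  move: k.+1%:R^-1 l.+1%:R^-1 => a b; lra.
have /choice[z hz] : forall i, exists f, sqi f /\ l2c mu D (fun k => op (w k) i) f.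
  by move=> i; have [f] := l2_complete mD muD (fun k => op_sqi (w k) i) (cau i); exists f.
have sz i : sqi (z i) by have [] := hz i.
exists w, z; split => [//|i|v]; first by have [] := hz i.
pose c k := \sum_i ip (res (w k) i) (op v i).
have clim : c k @[k --> \oo] --> \sum_i ip (fun t => x i t - z i t) (op v i).
  apply: cvg_sumr => i; rewrite (ipBl mD)//.
  under eq_cvg do rewrite (ipBl mD (x_sqi i) (op_sqi _ i) (op_sqi v i)).
  apply: cvgB; first exact: cvg_cst.
  exact: (l2c_ipl mD (fun k => op_sqi (w k) i) (sz i) (op_sqi v i) (hz i).2).
set cz := \sum_i _ in clim *.
pose A := \sum_i ip (op v i) (op v i).
(* Comparing w k with its perturbation by r v costs at most 1 / (k + 1); in the limit the quadratic
   in r has no constant term, so its linear coefficient vanishes by [quad_discr]. *)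
have h r : 0 <= 0 + 2 * r * (- cz) + r ^+ 2 * A.
  have hk k : 0 <= k.+1%:R^-1 + 2 * r * (- c k) + r ^+ 2 * A.
    have h1 := hm (comb 1 r (w k) v) Logic.I; have [_ h2] := hw k.
    have E : J (comb 1 r (w k) v) = J (w k) + 2 * r * (- c k) + r ^+ 2 * A.
      rewrite /J /c /A -sumrN !mulr_sumr -!big_split/=; apply: eq_bigr => i _.
      have := ip_lin mD 1 (- r) (sres (w k) i) (op_sqi v i).
      rewrite (@eq_ip _ _ _ mu D _ (res (comb 1 r (w k) v) i) _
        (res (comb 1 r (w k) v) i)); try by move=> t _; rewrite /res op_comb; ring.
      by move=> ->; ring.
    move: h1; rewrite E; move: h2; move: k.+1%:R^-1 => a; lra.
  have lim : k.+1%:R^-1 + 2 * r * (- c k) + r ^+ 2 * A @[k --> \oo] -->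
      0 + 2 * r * (- cz) + r ^+ 2 * A.
    apply: cvgD; last exact: cvg_cst.
    apply: cvgD; first exact: (@cvg_harmonic R).
    by apply: cvgM; [exact: cvg_cst|exact: cvgN].
  by apply: (cvgr_to_ge lim); apply: nearW.
have A0 : 0 <= A by apply: sumr_ge0 => i _; exact: ip_ge0.
have := quad_discr A0 h; rewrite mul0r sqrrN => cz2.
by apply/eqP; rewrite -sqrf_eq0 eq_le cz2 sqr_ge0.
Qed.

End projection.

(** * Approximation together with gradients and Laplacians *)

Section second_order.
Variables (R : realType) (q : nat) (T : 'rV[R]_q.+1).
Hypothesis hT : forall i, 0 < T 0 i.
Local Notation p := q.+1.
Local Notation mu := (@lebesgue_rV R q.+1).
Local Notation D := (box T).
Local Notation sqi := (sqi mu D).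
Local Notation ip := (ip mu D).
Local Notation ev := (ev T).
Local Notation dt := (dt T).
Local Notation lapl := (lapl T).
Local Notation mD := (@measurable_box R q.+1 T).
Local Notation muD := (@box_lty R q.+1 T).
Variables (u f : 'rV[R]_p -> R) (du : 'I_p -> 'rV[R]_p -> R).
Hypotheses (su : sqi u) (sf : sqi f) (sdu : forall i, sqi (du i)).
Hypothesis weak_du : forall i s, ip u (ev (dt i s)) = - ip (du i) (ev s).
Hypothesis weak_f : forall s, \sum_i ip (du i) (ev (dt i s)) = - ip f (ev s).

(** Packs a function, its Laplacian and its p partial derivatives into one family, the form required
    by [projection]. *)
Let pick (X : Type) (a b : X) (c : 'I_p -> X) (j : 'I_p.+2) : X :=
  if unlift ord0 j is Some j' then
    if unlift ord0 j' is Some i then c i else b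
  else a.

Let pick_sum (F : 'I_p.+2 -> R) : \sum_j F j =
  F ord0 + F (lift ord0 ord0) + \sum_i F (lift ord0 (lift ord0 i)).
Proof. by rewrite big_ord_recl big_ord_recl addrA. Qed.

Let pick0 X a b c : @pick X a b c ord0 = a.
Proof. by rewrite /pick unlift_none. Qed.

Let pick1 X a b c : @pick X a b c (lift ord0 ord0) = b.
Proof. by rewrite /pick liftK unlift_none. Qed.

Let pick2 X a b c i : @pick X a b c (lift ord0 (lift ord0 i)) = c i.
Proof. by rewrite /pick !liftK. Qed.

(** Tested on one wave of eigenvalue l, the weak relations turn orthogonality to the graph into (1 +
    l^2 + l) c = 0 for the coefficient c of r. As l >= 0, c = 0; then the coefficients of w and of
    each e i vanish too, and the waves are complete. *)
Lemma graph_orth_eq0 (r w : 'rV[R]_p -> R) (e : 'I_p -> 'rV[R]_p -> R) :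
  sqi r -> sqi w -> (forall i, sqi (e i)) ->
  (forall i s, ip r (ev (dt i s)) = - ip (e i) (ev s)) ->
  (forall s, \sum_i ip (e i) (ev (dt i s)) = - ip w (ev s)) ->
  (forall s, ip r (ev s) + ip w (ev (lapl s)) + \sum_i ip (e i) (ev (dt i s)) = 0) ->
  [/\ {ae mu, forall t, D t -> r t = 0}, {ae mu, forall t, D t -> w t = 0} &
      forall i, {ae mu, forall t, D t -> e i t = 0}].
Proof.
move=> sr sw se weak_e weak_w orth.
pose wv k a : tpoly R p := [:: (k, a, 1)].
have evw k a : ev (wv k a) = wave T (k, a, 1).
  by apply/funext => t; rewrite /ev big_seq1.
have lw g k a : sqi g -> ip g (ev (lapl (wv k a))) = - eigen T k * ip g (ev (wv k a)).
  move=> sg; rewrite -(ipZr mD)//; last exact: sqi_ev.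
  by apply: eq_ip => t _//; rewrite /ev !big_seq1 /wave/= mulrA.
have er k a : \sum_i ip (e i) (ev (dt i (wv k a))) = - ip r (ev (lapl (wv k a))).
  have -> : ev (lapl (wv k a)) = (fun t => \sum_i ev (dt i (dt i (wv k a))) t).
    by apply/funext => t; rewrite ev_lapl.
  rewrite (ip_sumr mD muD _ _ sr); last by move=> i; exact: sqi_ev.
  by rewrite -sumrN; apply: eq_bigr => i _; rewrite weak_e opprK.
have r0 k a : ip r (wave T (k, a, 1)) = 0.
  have h1 := orth (wv k a); have h2 := weak_w (wv k a).
  rewrite er lw// in h2 h1; rewrite (lw w)// in h1; rewrite -evw.
  have l0 : 0 <= eigen T k by apply: sumr_ge0 => i _; exact: sqr_ge0.
  have h3 : ip w (ev (wv k a)) = - eigen T k * ip r (ev (wv k a)).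
    by apply: oppr_inj; rewrite -h2.
  rewrite h3 in h1; have : (1 + eigen T k ^+ 2 + eigen T k) * ip r (ev (wv k a)) = 0.
    by rewrite -[RHS]h1; ring.
  move=> /eqP; rewrite mulf_eq0 => /orP[/eqP l1|/eqP//].
  have := sqr_ge0 (eigen T k); lra.
have r1 s : ip r (ev s) = 0 by apply: (trig_orth sr r0); exists s.
have e0 i k a : ip (e i) (wave T (k, a, 1)) = 0.
  by rewrite -evw -[LHS]opprK -weak_e r1 oppr0.
have w0 k a : ip w (wave T (k, a, 1)) = 0.
  by rewrite -evw -[LHS]opprK -weak_w er r1 !oppr0.
split; [exact: (trig_complete hT sr r0)|exact: (trig_complete hT sw w0)|].
by move=> i; exact: (trig_complete hT (se i) (e0 i)).
Qed.

(** The residual of the projection of (u, f, du) onto the closed graph satisfies the weak relations,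
    because both (u, f, du) and the limit of the graph elements do. By [graph_orth_eq0] it vanishes
    almost everywhere. *)
Lemma second_order_approx : exists s : nat -> tpoly R p,
  [/\ l2c mu D (fun k => ev (s k)) u, forall i, l2c mu D (fun k => ev (dt i (s k))) (du i) &
      l2c mu D (fun k => ev (lapl (s k))) f].
Proof.
pose op s := pick (ev s) (ev (lapl s)) (fun i => ev (dt i s)).
pose x := pick u f du.
pose cb (a b : R) (s s' : tpoly R p) : tpoly R p := tscale a s ++ tscale b s'.
have sop s j : sqi (op s j).
  by rewrite /op /pick; case: (unlift _ _) => [j'|]; first case: (unlift _ _) => [i|]; exact: sqi_ev.
have opc a b s s' j t : op (cb a b s s') j t = a * op s j t + b * op s' j t.
  rewrite /op /pick; case: (unlift _ _) => [j'|]; first case: (unlift _ _) => [i|].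
  - by rewrite dt_cat ev_cat !dt_tscale !ev_tscale.
  - by rewrite lapl_cat ev_cat !lapl_tscale !ev_tscale.
  - by rewrite ev_cat !ev_tscale.
have sx j : sqi (x j).
  by rewrite /x /pick; case: (unlift _ _) => [j'|//]; case: (unlift _ _) => [i|//].
have [s [z [sz lz oz]]] := projection mD muD [::] sop opc sx.
pose z0 := z ord0; pose z1 := z (lift ord0 ord0); pose zd i := z (lift ord0 (lift ord0 i)).
have l0 : l2c mu D (fun k => ev (s k)) z0.
  by have := lz ord0; under [X in l2c _ _ X]eq_fun do rewrite /op pick0.
have l1 : l2c mu D (fun k => ev (lapl (s k))) z1.
  by have := lz (lift ord0 ord0); under [X in l2c _ _ X]eq_fun do rewrite /op pick1.
have ld i : l2c mu D (fun k => ev (dt i (s k))) (zd i).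
  by have := lz (lift ord0 (lift ord0 i)); under [X in l2c _ _ X]eq_fun do rewrite /op pick2.
have L (c : nat -> tpoly R p) g v : sqi g -> l2c mu D (fun k => ev (c k)) g ->
    ip (ev (c k)) (ev v) @[k --> \oo] --> ip g (ev v).
  by move=> sg; apply: (l2c_ipl mD) => [k||]; [exact: sqi_ev| |exact: sqi_ev].
have zw1 i v : ip z0 (ev (dt i v)) = - ip (zd i) (ev v).
  have h := L s z0 (dt i v) (sz _) l0.
  have h' : ip (ev (s k)) (ev (dt i v)) @[k --> \oo] --> - ip (zd i) (ev v).
    under eq_cvg do rewrite (ip_parts_ev hT).
    by apply: cvgN; exact: (L (fun k => dt i (s k)) (zd i) v (sz _) (ld i)).
  exact: (cvg_unique _ h h').
have zw2 v : \sum_i ip (zd i) (ev (dt i v)) = - ip z1 (ev v).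
  have h : \sum_i ip (ev (dt i (s k))) (ev (dt i v)) @[k --> \oo] -->
      \sum_i ip (zd i) (ev (dt i v)).
    by apply: cvg_sumr => i; exact: (L (fun k => dt i (s k)) (zd i) (dt i v) (sz _) (ld i)).
  have h' : \sum_i ip (ev (dt i (s k))) (ev (dt i v)) @[k --> \oo] --> - ip z1 (ev v).
    rewrite (_ : (fun k => _) = fun k => - ip (ev (lapl (s k))) (ev v)); last first.
      by apply/funext => k; rewrite (ip_lapl hT) opprK.
    by apply: cvgN; exact: (L (fun k => lapl (s k)) z1 v (sz _) l1).
  exact: (cvg_unique _ h h').
have se s' : sqi (ev s') by exact: sqi_ev.
have sB g h : sqi g -> sqi h -> sqi (fun t => g t - h t) by exact: (sqiB mD).
have [h0 h1 hd] : [/\ {ae mu, forall t, D t -> u t - z0 t = 0},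
    {ae mu, forall t, D t -> f t - z1 t = 0} &
    forall i, {ae mu, forall t, D t -> du i t - zd i t = 0}].
  apply: (graph_orth_eq0 (r := fun t => u t - z0 t) (w := fun t => f t - z1 t)
     (e := fun i t => du i t - zd i t)) => [|||i v|v|v].
  - exact: (sB _ _ su (sz _)).
  - exact: (sB _ _ sf (sz _)).
  - by move=> i; exact: (sB _ _ (sdu i) (sz _)).
  - by rewrite (ipBl mD su (sz _) (se _)) (ipBl mD (sdu i) (sz _) (se _)) weak_du zw1; ring.
  - under eq_bigr do rewrite (ipBl mD (sdu _) (sz _) (se _)).
    by rewrite sumrB weak_f zw2 (ipBl mD sf (sz _) (se _)); ring.
  - rewrite -[RHS](oz v) pick_sum /op /x !pick0 !pick1; congr (_ + _).
    by apply: eq_bigr => i _; rewrite !pick2.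
exists s; split => [|i|].
- exact: (l2c_ae mD (fun k => se _) (sz _) su h0 l0).
- exact: (l2c_ae mD (fun k => se _) (sz _) (sdu i) (hd i) (ld i)).
- exact: (l2c_ae mD (fun k => se _) (sz _) sf h1 l1).
Qed.

End second_order.

(** * Traces and weak derivatives *)

Section vector_L2.
Variables (R : realType) (m n : nat) (T : 'rV[R]_m).
Local Notation mu := (@lebesgue_rV R m).
Local Notation D := (box T).
Local Notation sqi := (sqi mu D).
Local Notation ip := (ip mu D).
Local Notation mD := (@measurable_box R m T).
Local Notation muD := (@box_lty R m T).
Implicit Types w : 'I_n -> 'rV[R]_m -> R.

Lemma measurable_rowf w : (forall j, measurable_fun D (w j)) -> measurable_fun D (rowf w).
Proof.
move=> mw; apply: (@measurability _ _ _ _ _ _ (\big[setU/set0]_(j < n)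
  preimage_set_system setT (fun x : 'rV[R]_n => x 0 j) measurable)) => //.
move=> _ [B] + <-; rewrite -bigcup_seq/= => -[j _ [Y mY <-]].
have := mw j mD Y mY; rewrite setTI; congr (measurable (_ `&` _)).
by apply/seteqP; split => t; rewrite /preimage/= mxE.
Qed.

Lemma integral_enorm w : (forall j, sqi (w j)) ->
  (\int[mu]_(t in D) (enorm (rowf w t) ^+ 2)%:E = (\sum_j ip (w j) (w j))%:E)%E.
Proof.
move=> sw.
have E t : enorm (rowf w t) ^+ 2 = \sum_j w j t * w j t.
  by rewrite sqr_enorm; apply: eq_bigr => j _; rewrite mxE expr2.
under eq_integral do rewrite E; rewrite (Rint_EFin mD).
  by rewrite (Rint_sum mD muD)// => j; exact: (sqi_mul mD).
by apply: (itg_sum mD muD) => j; exact: (sqi_mul mD).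
Qed.

Lemma L2_rowf w : (forall j, sqi (w j)) -> L2 D (rowf w).
Proof.
move=> sw; split; first by apply: measurable_rowf => j; exact: sqi_meas (sw j).
by rewrite integral_enorm// ltry.
Qed.

Lemma L2_cvg_rowf (u : nat -> 'I_n -> 'rV[R]_m -> R) w :
  (forall k j, sqi (u k j)) -> (forall j, sqi (w j)) ->
  (forall j, l2c mu D (u ^~ j) (w j)) -> L2_cvg D (fun k => rowf (u k)) (rowf w).
Proof.
move=> su sw uw; rewrite /L2_cvg.
rewrite (_ : (fun k => _) = EFin \o (fun k => \sum_j
    ip (fun t => u k j t - w j t) (fun t => u k j t - w j t))).
  apply: cvg_EFin; first by exact: nearW.
  have s0 : \sum_(j <- index_enum 'I_n) 0 = 0 :> R by rewrite big1.
  by have := cvg_sumr (r := index_enum 'I_n) uw; rewrite s0.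
apply/funext => k /=; rewrite -integral_enorm => [|j]; last exact: (sqiB mD).
apply: eq_integral => t _; congr (enorm _ ^+ 2)%:E.
by apply/rowP => j; rewrite !mxE.
Qed.

Lemma Rint_dotv w (v : 'rV[R]_m -> 'rV[R]_n) : (forall j, sqi (w j)) ->
  (forall j, sqi (fun t => v t 0 j)) ->
  \int[mu]_(t in D) dotv (rowf w t) (v t) = \sum_j ip (w j) (fun t => v t 0 j).
Proof.
move=> sw sv; rewrite /ip -(Rint_sum mD muD)/=; last by move=> j; exact: (sqi_mul mD).
by apply: eq_Rintegral => t _; apply: eq_bigr => j _; rewrite mxE.
Qed.

Lemma itg_dotv w (v : 'rV[R]_m -> 'rV[R]_n) : (forall j, sqi (w j)) ->
  (forall j, sqi (fun t => v t 0 j)) -> itg mu D (fun t => dotv (rowf w t) (v t)).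
Proof.
move=> sw sv.
rewrite (_ : (fun t => _) = (fun t => \sum_j w j t * v t 0 j)).
  by apply: (itg_sum mD muD) => j; exact: (sqi_mul mD).
by apply/funext => t; apply: eq_bigr => j _; rewrite mxE.
Qed.

End vector_L2.

Section traces.
Variables (R : realType) (q n : nat) (T : 'rV[R]_q.+1).
Hypothesis hT : forall i, 0 < T 0 i.
Local Notation p := q.+1.
Local Notation mu := (@lebesgue_rV R q.+1).
Local Notation nu := (@lebesgue_rV R q).
Local Notation D := (box T).
Local Notation ev := (ev T).
Local Notation dt := (dt T).
Local Notation mD := (@measurable_box R q.+1 T).
Local Notation muD := (@box_lty R q.+1 T).

Lemma l2cauchy_face (i : 'I_p) (s : nat -> tpoly R p) :
  l2cauchy mu D (fun k => ev (s k)) -> l2cauchy mu D (fun k => ev (dt i (s k))) ->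
  l2cauchy nu (@face_box R p T i) (fun k y => ev (s k) (@insert_coord R p i 0 y)).
Proof.
move=> cs cds e e0; have Ti := hT i.
(* Chosen so that the right-hand side of [trace_le] is at most 2 e1 + T_i^2 e1 = T_i e. *)
pose e1 := T 0 i * e / (2 + T 0 i ^+ 2).
have c0 : 0 < 2 + T 0 i ^+ 2 by rewrite ltr_wpDr// sqr_ge0.
have e10 : 0 < e1 by rewrite divr_gt0// mulr_gt0.
have [N1 h1] := cs _ e10; have [N2 h2] := cds _ e10.
exists (maxn N1 N2) => k l; rewrite !geq_max => /andP[k1 k2] /andP[l1 l2].
have := h1 k l k1 l1; have := h2 k l k2 l2.
pose d : tpoly R p := tscale 1 (s k) ++ tscale (-1) (s l).
have dE t : ev d t = ev (s k) t - ev (s l) t by rewrite ev_cat !ev_tscale; ring.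
have ddE t : ev (dt i d) t = ev (dt i (s k)) t - ev (dt i (s l)) t.
  by rewrite dt_cat !dt_tscale ev_cat !ev_tscale; ring.
rewrite -(eq_ip mu (fun t _ => ddE t) (fun t _ => ddE t)).
rewrite -(eq_ip mu (fun t _ => dE t) (fun t _ => dE t)) => a2 a1.
have := trace_le hT d i.
rewrite (_ : \int[_]_(y in _) _ = ip nu (@face_box R p T i)
   (fun y => ev (s k) (@insert_coord R p i 0 y) - ev (s l) (@insert_coord R p i 0 y))
   (fun y => ev (s k) (@insert_coord R p i 0 y) - ev (s l) (@insert_coord R p i 0 y))).
  move=> h; rewrite -(ler_pM2l Ti); apply: le_trans h _.
  apply: (@le_trans _ _ (2 * e1 + T 0 i ^+ 2 * e1)).
    by apply: lerD; rewrite ler_wpM2l// sqr_ge0.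
  by rewrite -mulrDl /e1 mulrC divfK ?gt_eqF.
by apply: eq_Rintegral => y _; rewrite dE expr2.
Qed.

(** The traces on both faces are limits of restrictions of the same periodic polynomials, and these
    restrictions coincide. The trace inequality gives their convergence to a common g. *)
Lemma same_trace_rowf (i : 'I_p) (s : nat -> 'I_n -> tpoly R p)
    (w : 'I_n -> 'rV[R]_p -> R) (dw : 'I_p -> 'I_n -> 'rV[R]_p -> R) :
  (forall j, sqi mu D (w j)) -> (forall l j, sqi mu D (dw l j)) ->
  (forall j, l2c mu D (fun k => ev (s k j)) (w j)) ->
  (forall l j, l2c mu D (fun k => ev (dt l (s k j))) (dw l j)) ->
  same_trace T i (rowf w).
Proof.
move=> sw sdw lw ldw.
have /choice[g hg] : forall j, exists f, sqi nu (@face_box R p T i) f /\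
    l2c nu (@face_box R p T i) (fun k y => ev (s k j) (@insert_coord R p i 0 y)) f.
  move=> j; have [||f sf lf] := @l2_complete _ _ _ nu (@face_box R p T i) (@measurable_box R q _) (@box_lty R q _)
    (fun k y => ev (s k j) (@insert_coord R p i 0 y)); last by exists f.
    by move=> k; apply: sqi_face; exact: continuous_ev.
  apply: l2cauchy_face; first exact: (l2c_cauchy mD (fun k => sqi_ev T _) (sw j) (lw j)).
  exact: (l2c_cauchy mD (fun k => sqi_ev T _) (sdw i j) (ldw i j)).
have tr c : (forall S : tpoly R p, forall y, ev S (@insert_coord R p i c y) = ev S (@insert_coord R p i 0 y)) ->
    is_trace T i c (rowf w) (rowf g : 'rV[R]_p.-1 -> _).
  move=> pc; split; [exact: L2_rowf| |].
    by apply: (@L2_rowf R q n (col' i T)) => j; have [] := hg j.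
  exists (fun l => rowf (dw l)), (fun k => vec T (s k)); split.
  - by move=> l; exact: L2_rowf.
  - by move=> k; exact: smooth_vec.
  - by apply: (L2_cvg_rowf (u := fun k j => ev (s k j))) => // k j; exact: sqi_ev.
  - move=> l; rewrite (_ : (fun k t => _) = fun k => rowf (fun j => ev (dt l (s k j)))).
      by apply: L2_cvg_rowf => // k j; exact: sqi_ev.
    by apply/funext => k; apply/funext => t; rewrite derive_vec.
  - rewrite (_ : (fun k y => _) = fun k => rowf (fun j y => ev (s k j) (@insert_coord R p i 0 y))).
      apply: (@L2_cvg_rowf R q n (col' i T)) => [k j|j|j].
      + by apply: sqi_face; exact: continuous_ev.
      + by have [] := hg j.
      + by have [] := hg j.
    by apply/funext => k; apply/funext => y; apply/rowP => j; rewrite !mxE pc.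
exists (rowf g); split; apply: tr => // S y.
have -> : @insert_coord R p i (T 0 i) y = @insert_coord R p i 0 y + T 0 i *: basis_vec R i.
  by rewrite -[in LHS](addr0 (T 0 i)) insert_coordD addrC.
by rewrite ev_periodic.
Qed.

End traces.

Section weak_derivatives.
Variables (R : realType) (q n : nat) (T : 'rV[R]_q.+1).
Hypothesis hT : forall i, 0 < T 0 i.
Local Notation p := q.+1.
Local Notation mu := (@lebesgue_rV R q.+1).
Local Notation D := (box T).
Local Notation ev := (ev T).
Local Notation dt := (dt T).
Local Notation lapl := (lapl T).
Local Notation mD := (@measurable_box R q.+1 T).
Local Notation muD := (@box_lty R q.+1 T).
Local Notation e_ := (basis_vec R).

Lemma sqi_smooth (v : 'rV[R]_p -> 'rV[R]_n) j : smooth v -> sqi mu D (fun t => v t 0 j).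
Proof. by move=> /(smooth_coord j)[c _ _ _]; exact: continuous_sqi. Qed.

Lemma sqi_smooth_derive (v : 'rV[R]_p -> 'rV[R]_n) i j : smooth v ->
  sqi mu D (fun t => 'D_(e_ i) v t 0 j).
Proof. by move=> /(smooth_coord j)[_ _ _ c]; exact: continuous_sqi. Qed.

Lemma ip_parts_coord s (v : 'rV[R]_p -> 'rV[R]_n) i j : CT_infty T v ->
  ip mu D (ev s) (fun t => 'D_(e_ i) v t 0 j) = - ip mu D (ev (dt i s)) (fun t => v t 0 j).
Proof.
move=> [/(smooth_coord j)[cv dv dE cdv] pv].
have E : (fun t => 'D_(e_ i) v t 0 j) = (fun t => 'D_(e_ i) (fun t => v t 0 j) t).
  by apply/funext => t; rewrite dE.
by rewrite E; apply: (ip_parts_smooth hT) => // [t|t]; rewrite ?pv// -?E.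
Qed.

Lemma ip_lapl_coord s (v : 'rV[R]_p -> 'rV[R]_n) j : CT_infty T v ->
  \sum_i ip mu D (ev (dt i s)) (fun t => 'D_(e_ i) v t 0 j) =
  - ip mu D (ev (lapl s)) (fun t => v t 0 j).
Proof.
move=> Tv; have [sv _] := Tv.
have -> : ev (lapl s) = (fun t => \sum_i ev (dt i (dt i s)) t).
  by apply/funext => t; rewrite ev_lapl.
rewrite (ip_suml mD muD)//; [|by move=> i; exact: sqi_ev|exact: sqi_smooth].
by rewrite -sumrN; apply: eq_bigr => i _; rewrite ip_parts_coord.
Qed.

Variables (s : nat -> 'I_n -> tpoly R p).
Variables (u f : 'I_n -> 'rV[R]_p -> R) (du : 'I_p -> 'I_n -> 'rV[R]_p -> R).
Hypotheses (su : forall j, sqi mu D (u j)) (sf : forall j, sqi mu D (f j)).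
Hypothesis sdu : forall i j, sqi mu D (du i j).
Hypothesis lu : forall j, l2c mu D (fun k => ev (s k j)) (u j).
Hypothesis ldu : forall i j, l2c mu D (fun k => ev (dt i (s k j))) (du i j).
Hypothesis lf : forall j, l2c mu D (fun k => ev (lapl (s k j))) (f j).

Lemma H1T_rowf : H1T T (rowf u) (fun i => rowf (du i)).
Proof.
split=> [|i]; first exact: L2_rowf.
split=> [|v Tv]; first exact: L2_rowf.
have [sv _] := Tv.
have s1 j := sqi_smooth_derive i j sv; have s0 j := sqi_smooth j sv.
rewrite !Rint_dotv// -sumrN; apply: eq_bigr => j _.
have h := l2c_ipl mD (fun k => sqi_ev T _) (su j) (s1 j) (lu j).
have h' := l2c_ipl mD (fun k => sqi_ev T _) (sdu i j) (s0 j) (ldu i j).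
have {}h' : ip mu D (ev (s k j)) (fun t => 'D_(e_ i) v t 0 j) @[k --> \oo] -->
    - ip mu D (du i j) (fun t => v t 0 j).
  by under eq_cvg do rewrite ip_parts_coord//; exact: cvgN h'.
exact: (cvg_unique _ h h').
Qed.

(** The Euler-Lagrange equation was tested on trigonometric polynomials; convergence of gradients
    and Laplacians of the approximants extends it to all smooth periodic test functions. *)
Lemma weak_laplacian_rowf : weak_laplacian T (fun i => rowf (du i)) (rowf f).
Proof.
split=> [j|v Tv].
  have := sqi_itg mD muD (sf j); rewrite /itg; congr (_.-integrable _ _).
  by apply/funext => t /=; rewrite mxE.
have [sv _] := Tv.
have s1 i j := sqi_smooth_derive i j sv; have s0 j := sqi_smooth j sv.
rewrite (Rint_sum mD muD); last by move=> i; exact: itg_dotv.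
under eq_bigr do rewrite Rint_dotv//.
rewrite exchange_big/= Rint_dotv// -sumrN; apply: eq_bigr => j _.
have h' := l2c_ipl mD (fun k => sqi_ev T _) (sf j) (s0 j) (lf j).
have h : \sum_i ip mu D (ev (dt i (s k j))) (fun t => 'D_(e_ i) v t 0 j) @[k --> \oo] -->
    \sum_i ip mu D (du i j) (fun t => 'D_(e_ i) v t 0 j).
  by apply: cvg_sumr => i; exact: (l2c_ipl mD (fun k => sqi_ev T _) (sdu i j) (s1 i j) (ldu i j)).
have {}h' : \sum_i ip mu D (ev (dt i (s k j))) (fun t => 'D_(e_ i) v t 0 j) @[k --> \oo] -->
    - ip mu D (f j) (fun t => v t 0 j).
  by under eq_cvg do rewrite ip_lapl_coord//; exact: cvgN h'.
exact: (cvg_unique _ h h').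
Qed.

(** The Laplacians of the approximants converge, hence by [ip_hessian_le] all their second
    derivatives are Cauchy, and [same_trace_rowf] applies to the first derivatives. *)
Lemma same_trace_partial i l : same_trace T l (rowf (du i)).
Proof.
have /choice[ddu h] : forall mj : 'I_p * 'I_n, exists g, sqi mu D g /\
    l2c mu D (fun k => ev (dt mj.1 (dt i (s k mj.2)))) g.
  move=> [m j]; have [||g sg lg] := l2_complete mD muD
    (u := fun k => ev (dt m (dt i (s k j)))); last by exists g.
    by move=> k; exact: sqi_ev.
  move=> e e0.
  have [N hN] := l2c_cauchy mD (fun k => sqi_ev T _) (sf j) (lf j) e0.
  exists N => k k' Nk Nk'; apply: le_trans (hN k k' Nk Nk').
  pose d : tpoly R p := tscale 1 (s k j) ++ tscale (-1) (s k' j).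
  have lE t : ev (lapl d) t = ev (lapl (s k j)) t - ev (lapl (s k' j)) t.
    by rewrite lapl_cat !lapl_tscale ev_cat !ev_tscale; ring.
  have dE t : ev (dt m (dt i d)) t =
      ev (dt m (dt i (s k j))) t - ev (dt m (dt i (s k' j))) t.
    by rewrite !dt_cat !dt_tscale ev_cat !ev_tscale; ring.
  rewrite -(eq_ip mu (fun t _ => lE t) (fun t _ => lE t)).
  rewrite -(eq_ip mu (fun t _ => dE t) (fun t _ => dE t)).
  exact: ip_hessian_le.
apply: (@same_trace_rowf _ _ _ _ hT l (fun k j => dt i (s k j)) _ (fun m j => ddu (m, j))).
- by move=> j; exact: sdu.
- by move=> m j; have [] := h (m, j).
- by move=> j; exact: ldu.
- by move=> m j; have [] := h (m, j).
Qed.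

End weak_derivatives.

(** * Existence of a periodic solution *)

Theorem corollary3 (R : realType) (p n : nat) (hp : (0 < p)%N) (hn : (0 < n)%N)
    (T : 'rV[R]_p) (hT : forall i, 0 < T 0 i)
    (F : 'rV[R]_p -> 'rV[R]_n -> R)
    (F_meas : forall x, Lebesgue_measurable_on (box T) (fun t => F t x))
    (F_C1 : forall t, box T t -> class_C1 (F t))
    (a da : R -> R)
    (a_C1 : C1_Rplus a da)
    (a_ge0 : forall s : R, 0 <= s -> 0 <= a s)
    (da_bounded_above : exists M : R, forall s : R, 0 <= s -> da s <= M)
    (b : 'rV[R]_p -> R)
    (b_cont : {within box T, continuous b})
    (b_ge0 : forall t, box T t -> 0 <= b t)
    (F_bound : forall t x, box T t -> `|F t x| <= a (enorm x) * b t)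
    (gradF_bound : forall t x, box T t ->
      enorm (grad (F t) x) <= a (enorm x) * b t)
    (F_coercive : forall M : R, exists r : R, forall x : 'rV[R]_n,
      r <= enorm x -> M <= \int[lebesgue_rV]_(t in box T) F t x)
    (F_convex : forall t, box T t ->
      convex_function (E := 'rV[R]_n) [set: 'rV[R]_n] (F t)) :
  exists (u : 'rV[R]_p -> 'rV[R]_n) (du : 'I_p -> 'rV[R]_p -> 'rV[R]_n)
         (Lu : 'rV[R]_p -> 'rV[R]_n),
    [/\ H1T T u du,
        weak_laplacian T du Lu,
        {ae lebesgue_rV, forall t, box T t -> Lu t = grad (F t) (u t)},
        forall i, same_trace T i u &
        forall i j, same_trace T i (du j)].
Proof.
destruct p as [|q]; first by [].
have [G [K [N [N0 GF hG]]]] := borel_version F_meas F_C1 a_C1 a_ge0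
  da_bounded_above b_cont F_bound gradF_bound F_coercive F_convex.
have [S [u [du [hu hdu EL]]]] := weak_solution hT hG.
pose mu := @lebesgue_rV R q.+1; have mD := @measurable_box R q.+1 T.
have su j : sqi mu (box T) (u j) by have [] := hu j.
have sdu i j : sqi mu (box T) (du i j) by have [] := hdu i j.
have sf j : sqi mu (box T) (nemgrad G u j) by exact: (nemgrad_sqi hG j su).
have /choice[s hs] : forall j, exists s : nat -> tpoly R q.+1,
    [/\ l2c mu (box T) (fun k => ev T (s k)) (u j),
        forall i, l2c mu (box T) (fun k => ev T (dt T i (s k))) (du i j) &
        l2c mu (box T) (fun k => ev T (lapl T (s k))) (nemgrad G u j)].
  move=> j; apply: (second_order_approx hT (su j) (sf j) (sdu^~ j)) => [i v|v].
    have h := l2c_ipl mD (fun k => sqi_ev T _) (su j) (sqi_ev T (dt T i v)) (hu j).2.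
    have h' : ip mu (box T) (ev T (S k j)) (ev T (dt T i v)) @[k --> \oo] -->
        - ip mu (box T) (du i j) (ev T v).
      under eq_cvg do rewrite (ip_parts_ev hT).
      apply: cvgN.
      exact: (l2c_ipl mD (fun k => sqi_ev T _) (sdu i j) (sqi_ev T v) (hdu i j).2).
    exact: (cvg_unique _ h h').
  (* A test family supported on the coordinate j alone extracts the scalar equation for that
     coordinate. *)
  pose V j' : tpoly R q.+1 := if j' == j then v else [::].
  have ip0 (f : 'rV[R]_q.+1 -> R) : ip mu (box T) f (ev T [::]) = 0.
    by rewrite /ip /Rintegral integral0_eq// => t _; rewrite /ev big_nil mulr0.
  have := EL V; rewrite (bigD1 j)//= [X in _ + X + _]big1 => [|j' /negbTE j'j]; last first.
    by rewrite /V j'j big1.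
  rewrite (bigD1 j)//= [X in _ + (_ + X)]big1 => [|j' /negbTE j'j]; last by rewrite /V j'j.
  by rewrite !addr0 /V eqxx => /eqP; rewrite addr_eq0 => /eqP.
have lu j : l2c mu (box T) (fun k => ev T (s j k)) (u j) by have [] := hs j.
have ldu i j : l2c mu (box T) (fun k => ev T (dt T i (s j k))) (du i j) by have [] := hs j.
have lf j : l2c mu (box T) (fun k => ev T (lapl T (s j k))) (nemgrad G u j) by have [] := hs j.
exists (rowf u), (fun i => rowf (du i)), (rowf (nemgrad G u)); split.
- exact: (H1T_rowf hT su sdu lu ldu).
- exact: (weak_laplacian_rowf hT sf sdu ldu lf).
(* The weak Laplacian is the gradient of G along u; off the null set N it is the gradient of F. *)
- have [M [mM M0 NM]] := N0; exists M; split=> // t /= h; apply: NM; apply: contrapT => Nt.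
  apply: h => Dt; apply/rowP => j; rewrite mxE /nemgrad.
  by rewrite (GF t Dt Nt).
- by move=> i; exact: (same_trace_rowf hT i su sdu lu ldu).
- by move=> i j; exact: (same_trace_partial hT sf sdu ldu lf).
Qed.
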